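(* Let $(B_t)$ be a Brownian motion started at $0$ with local time $(L_t)$ at $0$. Let $\phi_+:[0,\infty)\to[0,\infty)$ be increasing and $\phi_-:[0,\infty)\to(-\infty,0]$ decreasing, and let $F:[0,\infty)\to\mathbb{R}$ be convex and increasing, such that $\Delta(l)=\int_0^l\big(\frac{1}{2\phi_+(m)}+\frac{1}{2|\phi_-(m)|}\big)dm$ is finite for each $l>0$ and $\Delta(l)\to\infty$ as $l\to\infty$. Let $\nu$ be the probability measure on $[0,\infty)$ with $\bar\nu(l)=\nu([l,\infty))=e^{-\Delta(l)}$, and set $\Sigma(l)=\frac{1}{\bar\nu(l)}\int_l^\infty F'(m)\nu(dm)$, $\delta(l)=\Sigma(l)-F'(l)$ (where $F'(l)$ exists), $A_+(l)=\Sigma(0)+\int_0^l\frac{\delta(m)}{\phi_+(m)}dm$, $A_-(l)=-\Sigma(0)-\int_0^l\frac{\delta(m)}{|\phi_-(m)|}dm$, $C(l)=-F(0)+\int_0^l\delta(m)dm$, and define $H(x)=\sup_{l>0}\{xA_+(l)-C(l)\}$ for $x>0$, $H(0)=F(0)$, $H(x)=\sup_{l>0}\{xA_-(l)-C(l)\}$ for $x<0$. Then for every stopping time $\tau$ such that $(B_{t\wedge\tau})_{t\ge0}$ is a uniformly integrable martingale, $$\mathbb{E}[F(L_\tau)]\le\mathbb{E}[H(B_\tau)].$$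
   Context: $F'$ denotes the derivative of the convex function $F$, which exists almost everywhere.
   Formalization: The hypothesis that F' is integrable with respect to ν (i.e. Σ(0) is finite) is added; without it Σ, δ, A_+ and C are infinite and H(x) is of the form ∞−∞ for x≠0, e.g. for φ_±=±1 and F(l)=e^l. *)

(* Defs.v *)
From HB Require Import structures.
From mathcomp Require Import all_boot all_order all_algebra.
From mathcomp Require Import all_classical all_reals all_analysis.
Set Implicit Arguments. Unset Strict Implicit. Unset Printing Implicit Defensive.
Import Order.TTheory GRing.Theory Num.Theory.
Import numFieldNormedType.Exports.
Local Open Scope classical_set_scope.
Local Open Scope ring_scope.

Section stochastic.
Context {R : realType} {d : measure_display} {T : measurableType d}.
Variable P : probability T R.

Definition filtration (Filt : R -> set (set T)) :=
  (forall t, 0 <= t -> sigma_algebra setT (Filt t) /\ Filt t `<=` measurable) /\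
  (forall s t, 0 <= s -> s <= t -> Filt s `<=` Filt t).

Definition adapted (Filt : R -> set (set T)) (X : R -> T -> R) :=
  forall t, 0 <= t -> forall U : set R, measurable U -> Filt t (X t @^-1` U).

Definition brownian_motion (Filt : R -> set (set T)) (B : R -> T -> R) :=
  [/\ filtration Filt, adapted Filt B,
      (forall w, B 0 w = 0),
      (forall w, {within `[0, +oo[, continuous (fun t => B t w)}) &
      (forall s t, 0 <= s -> s < t -> forall A, Filt s A ->
        forall U : set R, measurable U ->
        P (A `&` [set w | U (B t w - B s w)]) =
          (P A * normal_prob 0 (Num.sqrt (t - s)) U)%E)].

Definition occupation (B : R -> T -> R) (t : R) (w : T) (e : R) : R :=
  fine (lebesgue_measure [set s : R | 0 <= s <= t /\ `|B s w| < e]).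

Definition local_time_at0 (Filt : R -> set (set T)) (B L : R -> T -> R) :=
  [/\ adapted Filt L,
      (forall w, L 0 w = 0),
      (forall w, {within `[0, +oo[, continuous (fun t => L t w)}),
      (forall w, {in `[0, +oo[ &, {homo (fun t => L t w) : x y / x <= y}}) &
      {ae P, forall w, forall t, 0 <= t ->
         (fun e => (2 * e)^-1 * occupation B t w e) @ 0^'+ --> L t w}].

Definition stopping_time (Filt : R -> set (set T)) (tau : T -> \bar R) :=
  (forall w, (0 <= tau w)%E) /\
  (forall t, 0 <= t -> Filt t [set w | (tau w <= t%:E)%E]).

Definition stopped (X : R -> T -> R) (tau : T -> \bar R) (t : R) (w : T) : R :=
  X (fine (Order.min (tau w) t%:E)) w.

(** martingale w.r.t. Filt (conditional expectations expressed by
    integrals over the events of Filt s) *)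
Definition martingale (Filt : R -> set (set T)) (X : R -> T -> R) :=
  [/\ adapted Filt X,
      (forall t, 0 <= t -> P.-integrable setT (EFin \o X t)) &
      (forall s t, 0 <= s -> s <= t -> forall A, Filt s A ->
        (\int[P]_(w in A) (X t w)%:E = \int[P]_(w in A) (X s w)%:E)%E)].

Definition uniformly_integrable (X : R -> T -> R) :=
  forall e : R, 0 < e -> exists K : R, forall t : R, 0 <= t ->
    (\int[P]_(w in [set w | (K < `|X t w|)%R]) (`|X t w|)%:E <= e%:E)%E.

End stochastic.

Section analytic.
Context {R : realType}.

Definition recip_half (x : R) : \bar R :=
  if x == 0 then +oo%E else ((2 * `|x|)^-1)%:E.

Definition DeltaE (phip phim : R -> R) (l : R) : \bar R :=
  (\int[lebesgue_measure]_(m in `[0%R, l]) (recip_half (phip m) + recip_half (phim m)))%E.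

Definition Delta (phip phim : R -> R) (l : R) : R := fine (DeltaE phip phim l).

Definition Sigma (nu : {measure set R -> \bar R}) (F : R -> R) (l : R) : R :=
  (fine (nu `[l, +oo[%classic))^-1 * fine (\int[nu]_(m in `[l, +oo[) ((F^`())%classic m)%:E)%E.

Definition delta (nu : {measure set R -> \bar R}) (F : R -> R) (l : R) : R :=
  Sigma nu F l - (F^`())%classic l.

Definition Aplus nu F (phip : R -> R) (l : R) : R :=
  Sigma nu F 0 + Rintegral lebesgue_measure `[0, l] (fun m => delta nu F m / phip m).

Definition Aminus nu F (phim : R -> R) (l : R) : R :=
  - Sigma nu F 0 - Rintegral lebesgue_measure `[0, l] (fun m => delta nu F m / `|phim m|).

Definition Cfun nu F (l : R) : R :=
  - F 0 + Rintegral lebesgue_measure `[0, l] (delta nu F).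

Definition Hfun nu F (phip phim : R -> R) (x : R) : \bar R :=
  if 0 < x then ereal_sup [set (x * Aplus nu F phip l - Cfun nu F l)%:E | l in `]0, +oo[]
  else if x < 0 then ereal_sup [set (x * Aminus nu F phim l - Cfun nu F l)%:E | l in `]0, +oo[]
  else (F 0)%:E.

End analytic.

(* Main.v *)
(** Write [X] and [l] for [B] and [L] stopped at [tau], [x^+] and [x^-] for the positive and
    negative parts of [x], and [A_m := - A_-].  Smoothing [x^+] on a grid and letting the mesh
    tend to [0] gives the half of Tanaka's formula that is needed: on every event of the past,
    [X^+] and [X^-] grow in mean by at least half of the increase of [l].  As [A_+] and [A_m] are
    nondecreasing and [l] is a continuous increasing process, summing these inequalities with the
    weights [A_+(l)] and [A_m(l)] along a grid yields
      [E (A_+(l) X^+ + A_m(l) X^-) >= E int ((A_+ + A_m) / 2)(l) dl >= E (F(l) + C(l))],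
    where the last step uses [(A_+ + A_m) / 2 >= Sigma = (F + C)'].  On the other hand
    [H(x) >= A_+(l) x^+ + A_m(l) x^- - C(l)] for every [l], by definition of [H].  Uniform
    integrability forces [tau] to be finite and lets one pass to [B_tau] and [L_tau]; all
    integrands are bounded below by [F 0], so Fatou's lemma concludes. *)

Require Import Defs.
From HB Require Import structures.
From mathcomp Require Import all_boot all_order all_algebra.
From mathcomp Require Import all_classical all_reals all_analysis.
From mathcomp Require Import measurable_realfun ring lra.
Import Order.TTheory GRing.Theory Num.Theory.
Import numFieldNormedType.Exports.
Set Implicit Arguments. Unset Strict Implicit. Unset Printing Implicit Defensive.
Local Open Scope classical_set_scope.
Local Open Scope ring_scope.

(** * Gaussian moments *)

Section real_integrable.
Context d (T : measurableType d) (R : realType) (mu : {measure set T -> \bar R}).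
Implicit Types (D : set T) (f g : T -> R).

(** The data give [B] through its Gaussian increments and [L] as an almost sure limit of normalised
    occupation times, and the argument works from these alone. Over one step of length [h] a
    smoothed positive part is bounded below by a quadratic with a quartic error. The fourth moment
    makes that error [O(h ^+ 2)], so it disappears when summed over about [1 / h] steps. The
    smoothing radius [r] is slightly larger than the occupation radius [e]: the gap keeps a point of
    the small window in the quadratic zone after a short step, and [r / e] tending to [1] preserves
    the factor [1 / 2].

    Stieltjes integrals are replaced by grid sums, and the error is always a product of increments
    of a monotone function and of a continuous one. For [Sigma] the relation behind the sums is
    [dSigma = (Sigma - F') dDelta].

    The weights and [C(l)] need not be integrable, so the local time is truncated at a level [n].
    For fixed [n] the expectation of [C] is finite and cancels, and the late-time error is at most a
    constant times [|X|] on the event that [tau] is late. The mesh goes to [0] first, then the time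
    of [X] to infinity, and [n] last. *)

Lemma integrableD_real D f g : measurable D -> mu.-integrable D (EFin \o f) ->
  mu.-integrable D (EFin \o g) -> mu.-integrable D (EFin \o (fun x => f x + g x)).
Proof. by move=> mD If Ig; apply: eq_integrable (integrableD mD If Ig). Qed.

Lemma integrableZ_real D k f : measurable D -> mu.-integrable D (EFin \o f) ->
  mu.-integrable D (EFin \o (fun x => k * f x)).
Proof. by move=> mD If; apply: eq_integrable (integrableZl mD k If). Qed.

Lemma le_integrable_real D f g : measurable D -> measurable_fun D f ->
  (forall x, D x -> `|f x| <= g x) -> mu.-integrable D (EFin \o g) ->
  mu.-integrable D (EFin \o f).
Proof.
move=> mD mf fg; apply: le_integrable => //; first exact/measurable_EFinP.
by move=> x Dx /=; rewrite lee_fin (le_trans (fg _ Dx))// ler_norm.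
Qed.

Lemma ge0_integrable_real D f : measurable_fun D f -> (forall x, D x -> 0 <= f x) ->
  (\int[mu]_(x in D) (f x)%:E < +oo)%E -> mu.-integrable D (EFin \o f).
Proof.
move=> mf f0 h; apply/integrableP; split; first exact/measurable_EFinP.
apply: le_lt_trans h; rewrite le_eqVlt; apply/orP; left; apply/eqP.
by apply: eq_integral => x /[!inE] Dx /=; rewrite ger0_norm// f0.
Qed.

End real_integrable.

Section probability_affine.
Context d (T : measurableType d) (R : realType) (P : probability T R).
Implicit Types f g : T -> R.

Lemma Rintegral_cst_prob (c : R) : Rintegral P setT (fun=> c) = c.
Proof. rewrite /Rintegral integral_cst//; transitivity (fine (c%:E * 1)%E); last by rewrite mule1.
by congr (fine (_ * _)%E); exact: probability_setT. Qed.

Lemma integrable_cst_prob D (c : R) : measurable D -> P.-integrable D (EFin \o (fun=> c)).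
Proof. by move=> mD; exact: finite_measure_integrable_cst. Qed.

Lemma integrable_affine f g (a b c : R) : P.-integrable setT (EFin \o f) ->
  P.-integrable setT (EFin \o g) ->
  P.-integrable setT (EFin \o (fun x => a + b * f x + c * g x)).
Proof.
move=> If Ig; have Ia := integrable_cst_prob a measurableT.
apply: (integrableD_real measurableT (integrableD_real measurableT Ia _)) => //;
  exact: integrableZ_real.
Qed.

Lemma Rintegral_affine f g (a b c : R) : P.-integrable setT (EFin \o f) ->
  P.-integrable setT (EFin \o g) ->
  Rintegral P setT (fun x => a + b * f x + c * g x) =
  a + b * Rintegral P setT f + c * Rintegral P setT g.
Proof.
move=> If Ig; have Ia := integrable_cst_prob a measurableT.
have Ib := integrableZ_real b measurableT If.
rewrite (RintegralD measurableT (integrableD_real measurableT Ia Ib)); last first.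
  exact: integrableZ_real.
by rewrite (RintegralD measurableT Ia Ib) !RintegralZl// Rintegral_cst_prob.
Qed.

End probability_affine.

Section gaussian_moments.
Context {R : realType}.
Implicit Types (m s t x z : R).
Local Notation mu := (@lebesgue_measure R).

(** The change of variables produces the Radon-Nikodym derivative, determined only up to null sets;
    it agrees almost everywhere with [normal_pdf] because both have the same integral over every
    measurable set. *)
Lemma ge0_integral_normal_prob m s (f : R -> \bar R) :
  measurable_fun setT f -> (forall x, 0 <= f x)%E ->
  (\int[normal_prob m s]_x f x = \int[mu]_x (f x * (normal_pdf m s x)%:E))%E.
Proof.
move=> mf f0.
rewrite -(Radon_Nikodym_SigmaFinite.change_of_variables (normal_prob_dominates m s))//.
have mpdf : measurable_fun setT (EFin \o @normal_pdf R m s).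
  by apply/measurable_EFinP; exact: measurable_normal_pdf.
have dint := Radon_Nikodym_SigmaFinite.f_integrable (normal_prob_dominates m s).
apply: ge0_ae_eq_integral => //.
- by apply: emeasurable_funM => //; exact: (measurable_int mu).
- exact: emeasurable_funM.
- by move=> x _; rewrite mule_ge0//; apply: Radon_Nikodym_SigmaFinite.f_ge0; exact: normal_prob_dominates.
- by move=> x _; rewrite mule_ge0// lee_fin normal_pdf_ge0.
- apply: ae_eqe_mul2l; apply: integral_ae_eq => //.
  move=> E _ mE; rewrite -Radon_Nikodym_SigmaFinite.f_integral//.
  exact: normal_prob_dominates.
Qed.

(** Completing the square: tilting by [expR (t * z)] moves the mean to [t * s ^+ 2]. *)
Lemma normal_prob_expR s t : 0 < s ->
  (\int[normal_prob 0 s]_z (expR (t * z))%:E = (expR (t ^+ 2 * s ^+ 2 / 2))%:E)%E.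
Proof.
move=> s0; rewrite ge0_integral_normal_prob; last 2 first.
- by apply/measurable_EFinP; apply: measurableT_comp => //; exact: mulrl_measurable.
- by move=> x; rewrite lee_fin expR_ge0.
transitivity (\int[mu]_z ((expR (t ^+ 2 * s ^+ 2 / 2))%:E *
    (normal_pdf (t * s ^+ 2) s z)%:E))%E.
  apply: eq_integral => z _; rewrite -!EFinM !normal_pdfE ?gt_eqF//; congr EFin.
  rewrite mulrCA [RHS]mulrCA; congr (_ * _).
  rewrite /normal_fun -!expRD; congr expR; field; by rewrite gt_eqF.
rewrite ge0_integralZl//.
- by rewrite integral_normal_pdf mule1.
- by apply/measurable_EFinP; exact: measurable_normal_pdf.
- by move=> x _; rewrite lee_fin normal_pdf_ge0.
Qed.

(** The quadratic exponent only changes the standard deviation to [s / Num.sqrt (1 - k)]; the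
    constant is the ratio of the two peaks. *)
Lemma normal_prob_expR_sqr s k : 0 < s -> k < 1 ->
  (\int[normal_prob 0 s]_z (expR (k * (z / s) ^+ 2 / 2))%:E =
   ((Num.sqrt (1 - k))^-1)%:E)%E.
Proof.
move=> s0 k1; rewrite ge0_integral_normal_prob; last 2 first.
- apply/measurable_EFinP; apply: measurableT_comp => //.
  by apply: measurable_funM => //; apply: measurable_funM => //; apply: measurable_funX => //;
    exact: measurable_funM.
- by move=> x; rewrite lee_fin expR_ge0.
have q0 : 0 < Num.sqrt (1 - k) by rewrite sqrtr_gt0 subr_gt0.
have q2 : Num.sqrt (1 - k) ^+ 2 = 1 - k by rewrite sqr_sqrtr// subr_ge0 ltW.
transitivity (\int[mu]_z (((Num.sqrt (1 - k))^-1)%:E *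
    (normal_pdf 0 (s / Num.sqrt (1 - k)) z)%:E))%E.
  apply: eq_integral => z _; rewrite -!EFinM !normal_pdfE ?gt_eqF//; last by rewrite divr_gt0.
  congr EFin; rewrite mulrCA [RHS]mulrA; congr (_ * _).
    rewrite /normal_peak -invfM; congr GRing.inv.
    rewrite expr_div_n q2.
    rewrite (_ : _ *+ 2 = (1 - k) * (s ^+ 2 / (1 - k) * pi *+ 2)).
      by rewrite sqrtrM// subr_ge0 ltW.
    by field; rewrite subr_eq0 gt_eqF.
  rewrite /normal_fun -!expRD; congr expR.
  rewrite !expr_div_n q2; field.
  by rewrite subr_eq0 !gt_eqF.
rewrite ge0_integralZl//.
- by rewrite integral_normal_pdf mule1.
- by apply/measurable_EFinP; exact: measurable_normal_pdf.
- by move=> x _; rewrite lee_fin normal_pdf_ge0.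
Qed.

(** A crude constant is enough. For [y = (z / s) ^+ 2 / 4], the bound [y ^+ 2 / 2 <= expR y] gives
    the factor [32], and the mean of [expR y] is [Num.sqrt 2 <= 2]. *)
Lemma normal_prob_pow4 s : 0 < s ->
  (\int[normal_prob 0 s]_z (z ^+ 4)%:E <= (64 * s ^+ 4)%:E)%E.
Proof.
move=> s0.
apply: (@le_trans _ _ (\int[normal_prob 0 s]_z
    ((32 * s ^+ 4)%:E * (expR (2^-1 * (z / s) ^+ 2 / 2))%:E))%E).
  apply: ge0_le_integral => //.
  - by move=> x _; rewrite lee_fin exprn_even_ge0.
  - by apply/measurable_EFinP; exact: measurable_funX.
  - apply/measurable_EFinP; apply: measurable_funM => //; apply: measurableT_comp => //.
    by apply: measurable_funM => //; apply: measurable_funM => //; apply: measurable_funX => //;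
    exact: measurable_funM.
  - move=> z _; rewrite -EFinM lee_fin.
    have h0 : 0 <= 2^-1 * (z / s) ^+ 2 / 2 by apply: mulr_ge0 => //; apply: mulr_ge0 => //; exact: sqr_ge0.
    have := expR_ge1Dxn 1 h0; rewrite (_ : (2`!)%:R = 2)// => h.
    have -> : z ^+ 4 = 32 * s ^+ 4 * ((2^-1 * (z / s) ^+ 2 / 2) ^+ 2 / 2).
      by field; rewrite gt_eqF.
    rewrite ler_pM2l ?mulr_gt0 ?exprn_gt0//.
    by apply: le_trans h; rewrite lerDr.
rewrite ge0_integralZl//; last 2 first.
  - apply/measurable_EFinP; apply: measurableT_comp => //.
    by apply: measurable_funM => //; apply: measurable_funM => //; apply: measurable_funX => //;
    exact: measurable_funM.
  - by rewrite lee_fin mulr_ge0// exprn_ge0// ltW.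
rewrite normal_prob_expR_sqr//; last by rewrite invf_lt1// ltr1n.
rewrite -EFinM lee_fin (_ : 64 * _ = 32 * s ^+ 4 * 2); last by ring.
rewrite ler_pM2l ?mulr_gt0 ?exprn_gt0// invf_ple ?posrE// ?sqrtr_gt0; last first.
- by rewrite subr_gt0 invf_lt1// ltr1n.
have e : 2^-1 = Num.sqrt (2^-1 ^+ 2) :> R by rewrite sqrtr_sqr ger0_norm.
rewrite [leLHS]e.
by rewrite ler_sqrt; lra.
Qed.

Lemma le_of_le_linear (a b C e0 : R) : 0 < e0 ->
  (forall e, 0 < e -> e <= e0 -> a <= b + C * e) -> a <= b.
Proof.
move=> e0p h; apply/ler_addgt0Pr => e ep.
have C1 : 0 < `|C| + 1 by rewrite ltr_wpDl.
pose e' := Num.min e0 (e / (`|C| + 1)).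
have e'0 : 0 < e' by rewrite /e' lt_min e0p divr_gt0.
apply: (le_trans (h e' e'0 _)); first by rewrite ge_min lexx.
rewrite lerD2l (@le_trans _ _ (`|C| * e'))//; first by rewrite ler_pM2r// ler_norm.
rewrite (@le_trans _ _ (`|C| * (e / (`|C| + 1))))//.
  by rewrite ler_wpM2l// ge_min lexx orbT.
by rewrite mulrA ler_pdivrMr// mulrC ler_pM2l// lerDl.
Qed.

Lemma integrable_normal_prob_pow s i : 0 < s -> (i <= 4)%N ->
  (normal_prob 0 s).-integrable setT (EFin \o (fun z : R => z ^+ i)).
Proof.
move=> s0 i4.
have int4 : (normal_prob 0 s).-integrable setT (EFin \o (fun z : R => z ^+ 4)).
  apply: ge0_integrable_real => //.
  - by move=> x _; exact: exprn_even_ge0.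
  - exact: le_lt_trans (normal_prob_pow4 s0) (ltry _).
apply: (@le_integrable_real _ _ _ (normal_prob 0 s) setT _ (fun z : R => 1 + z ^+ 4)) => //.
- move=> z _ /=; rewrite normrX.
  have -> : z ^+ 4 = `|z| ^+ 4 by rewrite -normrX ger0_norm// exprn_even_ge0.
  have [z1|z1] := leP `|z| 1.
    by rewrite (@le_trans _ _ 1) ?exprn_ile1// lerDl exprn_ge0.
  by rewrite (@le_trans _ _ (`|z| ^+ 4)) ?lerDr// ler_eXn2l.
- apply: integrableD_real => //; exact: finite_measure_integrable_cst.
Qed.

(* Convexity of exp bounds [E exp(t z)] from below by [1 + t E z]; comparing with
   the closed form for small [t] of both signs determines the moment. *)
Lemma normal_prob_mean s : 0 < s -> \int[normal_prob 0 s]_z z ^+ 1 = 0.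
Proof.
move=> s0; set I := Rintegral _ _ _.
have iz := @integrable_normal_prob_pow s 1 s0 isT.
have i1 : (normal_prob 0 s).-integrable setT (EFin \o (fun=> 1 : R)).
  exact: finite_measure_integrable_cst.
have key t : 1 + t * I <= expR (t ^+ 2 * s ^+ 2 / 2).
  have : Rintegral (normal_prob 0 s) setT (fun z => 1 + t * z ^+ 1 + 0 * z ^+ 1) <=
         Rintegral (normal_prob 0 s) setT (fun z => expR (t * z)).
    apply: le_Rintegral => //.
    - exact: integrable_affine.
    - apply: ge0_integrable_real => //.
      + by apply: measurableT_comp => //; exact: mulrl_measurable.
      + by rewrite normal_prob_expR// ltry.
    - by move=> x _; rewrite mul0r addr0; exact: expR_ge1Dx.
  rewrite {2}/Rintegral normal_prob_expR//= Rintegral_affine//.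
  by rewrite mul0r addr0.
have bound x : 0 <= x -> x <= 1/2 -> expR x <= 1 + 2 * x.
  move=> x0 x1; have := expR_ge1Dx (- x); rewrite expRN => h.
  rewrite -(invrK (expR x)) invf_ple ?posrE ?invr_gt0 ?expR_gt0//; last lra.
  apply: le_trans h; rewrite -[leLHS]mul1r ler_pdivrMr; last lra.
  nra.
have key2 t : `|t| <= s^-1 -> t * I <= t ^+ 2 * s ^+ 2.
  move=> ts; have := key t.
  have h : t ^+ 2 * s ^+ 2 <= 1.
    rewrite -exprMn -real_normK ?num_real// exprn_ile1// normrM (gtr0_norm s0).
    by rewrite -ler_pdivlMr// div1r.
  have h0 : 0 <= t ^+ 2 * s ^+ 2 by rewrite mulr_ge0 ?sqr_ge0.
  have := bound (t ^+ 2 * s ^+ 2 / 2); lra.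
have si0 : 0 < s^-1 by rewrite invr_gt0.
apply/eqP; rewrite eq_le; apply/andP; split.
  apply: (@le_of_le_linear _ _ (s ^+ 2) _ si0) => t t0 ts.
  rewrite add0r -(ler_pM2l t0) (le_trans (key2 t _)) ?gtr0_norm//; lra.
apply: (@le_of_le_linear _ _ (s ^+ 2) _ si0) => t t0 ts.
rewrite -(ler_pM2l t0) mulr0; have := key2 (- t); rewrite normrN gtr0_norm// => /(_ ts).
nra.
Qed.

(** Same scheme as for the mean, with exponent [k * (z / s) ^+ 2 / 2]: the closed form
    [(1 - k)^(-1/2)] is [1 + k / 2] up to [k ^+ 2], and small [k] of both signs leave one possible
    value. *)
Lemma normal_prob_var s : 0 < s -> \int[normal_prob 0 s]_z z ^+ 2 = s ^+ 2.
Proof.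
move=> s0; set I := Rintegral _ _ _.
have iz := @integrable_normal_prob_pow s 2 s0 isT.
have i1 : (normal_prob 0 s).-integrable setT (EFin \o (fun=> 1 : R)).
  exact: finite_measure_integrable_cst.
have key k : k < 1 -> 1 + k / (2 * s ^+ 2) * I <= (Num.sqrt (1 - k))^-1.
  move=> k1; have : Rintegral (normal_prob 0 s) setT (fun z => 1 + k / (2 * s ^+ 2) * z ^+ 2 + 0 * z ^+ 2) <=
         Rintegral (normal_prob 0 s) setT (fun z => expR (k * (z / s) ^+ 2 / 2)).
    apply: le_Rintegral => //.
    - exact: integrable_affine.
    - apply: ge0_integrable_real => //.
      + apply: measurableT_comp => //.
        by apply: measurable_funM => //; apply: measurable_funM => //;
          apply: measurable_funX => //; exact: measurable_funM.
      + by rewrite normal_prob_expR_sqr// ltry.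
    - move=> x _; rewrite mul0r addr0; apply: le_trans (expR_ge1Dx _); rewrite lerD2l le_eqVlt; apply/orP; left.
      by apply/eqP; field; rewrite gt_eqF.
  rewrite {2}/Rintegral normal_prob_expR_sqr//= Rintegral_affine//.
  by rewrite mul0r addr0.
have bound (k : R) : `|k| <= 1/2 -> (Num.sqrt (1 - k))^-1 <= 1 + k / 2 + k ^+ 2.
  rewrite ler_norml => /andP[k0 k1].
  have p0 : 0 < 1 + k / 2 + k ^+ 2 by nra.
  have q0 : 0 < 1 - k by lra.
  rewrite invf_ple ?posrE ?sqrtr_gt0// -(ler_pXn2r (n := 2)) ?nnegrE ?invr_ge0 ?sqrtr_ge0 ?(ltW p0)//.
  rewrite sqr_sqrtr ?(ltW q0)// exprVn -[leLHS]mul1r ler_pdivrMr ?exprn_gt0//.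
  have -> : (1 - k) * (1 + k / 2 + k ^+ 2) ^+ 2 =
     1 + k ^+ 2 * (5 / 4 - 5 / 4 * k - k ^+ 3) by field.
  rewrite lerDl mulr_ge0 ?sqr_ge0//.
  have : k ^+ 3 <= 1/8.
    have := sqr_ge0 k; nra.
  lra.
have key2 k : `|k| <= 1/2 -> k * I <= k * s ^+ 2 + 2 * s ^+ 2 * k ^+ 2.
  move=> kh; have k1 : k < 1 by apply: le_lt_trans (ler_norm _) _; lra.
  have := key k k1; have := bound k kh.
  rewrite (_ : k / (2 * s ^+ 2) * I = (k * I) / (2 * s ^+ 2)); last by field; rewrite gt_eqF.
  have s2 : 0 < 2 * s ^+ 2 by rewrite mulr_gt0 ?exprn_gt0.
  move=> h1 h2; have : (k * I) / (2 * s ^+ 2) <= k / 2 + k ^+ 2 by lra.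
  by rewrite ler_pdivrMr// => h; apply: (le_trans h); rewrite le_eqVlt; apply/orP; left;
    apply/eqP; field.
have h0 : (0 : R) < 1/2 by lra.
apply/eqP; rewrite eq_le; apply/andP; split.
  apply: (@le_of_le_linear _ _ (2 * s ^+ 2) _ h0) => t t0 ts.
  rewrite -(ler_pM2l t0) (le_trans (key2 t _)) ?gtr0_norm//; lra.
apply: (@le_of_le_linear _ _ (2 * s ^+ 2) _ h0) => t t0 ts.
rewrite -(ler_pM2l t0); have := key2 (- t); rewrite normrN gtr0_norm// => /(_ ts).
nra.
Qed.

(** Integration kills the linear term, turns [z ^+ 2] into [s ^+ 2], and charges the quartic
    correction at the fourth-moment bound. This plays the role of Taylor's formula in Ito
    calculus. *)
Lemma normal_prob_lower_quadratic s (u : R -> R) (a b g c : R) : 0 < s ->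
  measurable_fun setT u -> (forall z, 0 <= u z) -> 0 <= c ->
  (forall z, a + b * z + g * z ^+ 2 <= u z + c * z ^+ 4) ->
  ((a + g * s ^+ 2)%:E <= \int[normal_prob 0 s]_z (u z)%:E + (64 * c * s ^+ 4)%:E)%E.
Proof.
move=> s0 mu' u0 c0 h.
have iz i := @integrable_normal_prob_pow s i s0.
have iL : (normal_prob 0 s).-integrable setT
    (EFin \o (fun z : R => a + b * z ^+ 1 + g * z ^+ 2)).
  by apply: integrable_affine; exact: iz.
have [hoo|hoo] := eqVneq (\int[normal_prob 0 s]_z (u z)%:E)%E +oo%E.
  by rewrite hoo addye// leey.
have iu : (normal_prob 0 s).-integrable setT (EFin \o u).
  by apply: ge0_integrable_real => //; rewrite ltey.
have := @le_Rintegral _ _ _ (normal_prob 0 s) setT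
   (fun z : R => a + b * z ^+ 1 + g * z ^+ 2) (fun z => u z + c * z ^+ 4) measurableT iL.
move=> /(_ (integrableD_real measurableT iu (integrableZ_real _ measurableT (iz 4%N isT)))).
move=> /(_ (fun z _ => h z)).
rewrite Rintegral_affine; [|exact: iz..].
rewrite (RintegralD measurableT iu (integrableZ_real _ measurableT (iz 4%N isT))).
rewrite RintegralZl//; last exact: iz.
rewrite normal_prob_mean// normal_prob_var// mulr0 addr0.
rewrite -lee_fin => /le_trans; apply; rewrite EFinD {1}/Rintegral fineK; last first.
  by rewrite fin_numE hoo andbT -ltNye (lt_le_trans _ (integral_ge0 _ _))// => x _; rewrite lee_fin.
rewrite leeD2l// lee_fin -mulrA mulrCA ler_wpM2l//.
rewrite -lee_fin /Rintegral fineK ?normal_prob_pow4//.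
exact: integrable_fin_num (iz 4%N isT).
Qed.

Lemma normal_prob_sqrD s x : 0 < s ->
  (\int[normal_prob 0 s]_z ((x + z) ^+ 2)%:E = (x ^+ 2 + s ^+ 2)%:E)%E.
Proof.
move=> s0.
have iz i := @integrable_normal_prob_pow s i s0.
have e z : (x + z) ^+ 2 = x ^+ 2 + (2 * x) * z ^+ 1 + 1 * z ^+ 2 by ring.
have iL : (normal_prob 0 s).-integrable setT
    (EFin \o (fun z : R => x ^+ 2 + (2 * x) * z ^+ 1 + 1 * z ^+ 2)).
  by apply: integrable_affine; exact: iz.
under eq_integral do rewrite e.
rewrite -[LHS]fineK; last exact: integrable_fin_num iL.
congr EFin; rewrite -/(Rintegral _ _ _) Rintegral_affine; [|exact: iz..].
by rewrite normal_prob_mean// normal_prob_var// mulr0 addr0 mul1r.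
Qed.

(** The density is at most its peak and [pi >= 2]. The decay in [s] expresses that Brownian motion
    leaves bounded intervals, which will force [tau] to be finite. *)
Lemma normal_prob_itv s (K : R) : 0 < s -> 0 <= K ->
  (normal_prob 0%R s `[(- K)%R, K]%classic <= (K / s)%:E)%E.
Proof.
move=> s0 K0; rewrite /normal_prob.
apply: (@le_trans _ _ (\int[mu]_(x in `[(- K)%R, K]) (normal_peak s)%:E)%E).
  apply: ge0_le_integral => //.
  - by move=> x _; rewrite lee_fin normal_pdf_ge0.
  - by apply/measurable_EFinP; apply: measurable_funTS; exact: measurable_normal_pdf.
  - by move=> x _; rewrite lee_fin normal_pdf_ub// gt_eqF.
rewrite integral_cst//= lebesgue_measure_itv/=.
have -> : (if (- K)%:E < K%:E then K%:E - (- K)%:E else 0)%E = (2 * K)%:E :> \bar R.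
  rewrite lte_fin; case: ltP => h; first by rewrite -EFinB opprK; congr EFin; ring.
  by congr EFin; lra.
rewrite -EFinM lee_fin (_ : _ * (2 * K) = K * (2 * normal_peak s)); last by ring.
rewrite ler_wpM2l// /normal_peak ler_pdivrMr; last first.
  by rewrite sqrtr_gt0 mulrn_wgt0// mulr_gt0 ?exprn_gt0 ?pi_gt0.
rewrite mulrC ler_pdivlMr//.
have -> : 2 * s = Num.sqrt ((2 * s) ^+ 2) by rewrite sqrtr_sqr ger0_norm// mulr_ge0// ltW.
rewrite ler_sqrt ?mulrn_wge0 ?mulr_ge0 ?sqr_ge0 ?pi_ge0//.
have := @pi_ge2 R; rewrite exprMn -mulrnAr => h.
rewrite [leLHS]mulrC ler_wpM2l ?sqr_ge0//; lra.
all: exact: ltW.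
Qed.

End gaussian_moments.

(** * Filtrations and Brownian increments *)

Section liminf.
Context {R : realType}.
Implicit Types u : nat -> \bar R.

Lemma limn_einf_le u (M : \bar R) : (forall e : R, 0 < e ->
  forall N : nat, exists2 n : nat, (N <= n)%N & (u n <= M + e%:E)%E) -> (limn_einf u <= M)%E.
Proof.
move=> h; rewrite limn_einf_lim; apply: lime_le; first exact: is_cvg_einfs.
apply: nearW => N; apply/lee_addgt0Pr => e e0.
have [n Nn un] := h e e0 N; apply: le_trans un; apply: ereal_inf_lbound.
by exists n.
Qed.

Lemma limn_einf_ge u (l : R) : (forall e : R, 0 < e ->
  exists N : nat, forall n, (N <= n)%N -> (l%:E <= u n + e%:E)%E) -> (l%:E <= limn_einf u)%E.
Proof.
move=> h; rewrite limn_einf_lim; apply/lee_addgt0Pr => e e0.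
have [N hN] := h e e0; rewrite -leeBlDr//.
have cu := @is_cvg_einfs _ u.
apply: (@lime_ge _ _ _ _ _ _ cu); exists N => // m /= Nm.
apply: le_ereal_inf_tmp => _ [n /= mn <-].
rewrite -[leLHS]/(l%:E - e%:E)%E leeBlDr//.
exact: hN (leq_trans Nm mn).
Qed.

Lemma measurable_limn_einf d (T : measurableType d) (D : set T) (f : nat -> T -> \bar R) :
  (forall n, measurable_fun D (f n)) -> measurable_fun D (fun x => limn_einf (f^~ x)).
Proof.
move=> mf; apply: (emeasurable_fun_cvg (fun n x => einfs (f^~ x) n)).
  by move=> n; exact: measurable_fun_einfs.
by move=> x _; rewrite limn_einf_lim; exact: is_cvg_einfs.
Qed.

Lemma limn_einf_mono (u v : nat -> \bar R) : (forall n, u n <= v n)%E ->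
  (limn_einf u <= limn_einf v)%E.
Proof.
move=> uv; rewrite !limn_einf_lim; apply: lee_lim; [exact: is_cvg_einfs..|].
apply: nearW => n; apply: le_ereal_inf_tmp => _ [m /= nm <-].
by apply: le_trans (uv m); apply: ereal_inf_lbound; exists m.
Qed.

Lemma limn_einf_ge0 u : (forall n, 0 <= u n)%E -> (0 <= limn_einf u)%E.
Proof.
move=> u0; apply: limn_einf_ge => e e0; exists 0%N => n _.
by rewrite adde_ge0// lee_fin ltW.
Qed.

(** The form of Fatou's lemma behind most limits below: the integrand need only be dominated by a
    lower limit, and with [limn_einf_le] the integrals need only be bounded along a subsequence. *)
Lemma fatou_le d (T : measurableType d) (mu : {measure set T -> \bar R}) (D : set T)
    (f : nat -> T -> \bar R) (g : T -> \bar R) (M : \bar R) :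
  measurable D -> (forall n, measurable_fun D (f n)) -> (forall n x, 0 <= f n x)%E ->
  measurable_fun D g -> (forall x, D x -> 0 <= g x)%E ->
  {ae mu, forall x, D x -> (g x <= limn_einf (f^~ x))%E} ->
  (limn_einf (fun n => \int[mu]_(x in D) f n x) <= M)%E ->
  (\int[mu]_(x in D) g x <= M)%E.
Proof.
move=> mD mf f0 mg g0 gf hM.
apply: le_trans hM; apply: le_trans (fatou mu mD mf (fun n x _ => f0 n x)).
apply: ae_ge0_le_integral => //.
- by move=> x _; exact: limn_einf_ge0.
- exact: measurable_limn_einf.
Qed.

End liminf.

Section filtration_facts.
Context {R : realType} {d : measure_display} {T : measurableType d}.
Variables (Filt : R -> set (set T)) (hF : filtration Filt).

Lemma filt_measurable t A : 0 <= t -> Filt t A -> measurable A.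
Proof. by move=> t0; apply: (hF.1 t t0).2. Qed.

Lemma filt_mono s t A : 0 <= s -> s <= t -> Filt s A -> Filt t A.
Proof. by move=> s0 st; exact: hF.2. Qed.

Lemma filt_setC t A : 0 <= t -> Filt t A -> Filt t (~` A).
Proof. by move=> t0 fA; have [_ + _] := (hF.1 t t0).1 => /(_ _ fA); rewrite setTD. Qed.

Lemma filt_bigcup t (A : nat -> set T) : 0 <= t -> (forall n, Filt t (A n)) ->
  Filt t (\bigcup_n A n).
Proof. by move=> t0 fA; have [_ _] := (hF.1 t t0).1; apply. Qed.

Lemma filt_set0 t : 0 <= t -> Filt t set0.
Proof. by move=> t0; have [] := (hF.1 t t0).1. Qed.

Lemma filt_setT t : 0 <= t -> Filt t setT.
Proof. by move=> t0; rewrite -setC0; apply: filt_setC => //; exact: filt_set0. Qed.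

Lemma filt_setU t A B : 0 <= t -> Filt t A -> Filt t B -> Filt t (A `|` B).
Proof.
move=> t0 fA fB; rewrite -bigcup2E; apply: filt_bigcup => // -[|[|n]]//=.
exact: filt_set0.
Qed.

Lemma filt_setI t A B : 0 <= t -> Filt t A -> Filt t B -> Filt t (A `&` B).
Proof.
move=> t0 fA fB; rewrite -[A `&` B]setCK setCI; apply: filt_setC => //.
by apply: filt_setU => //; exact: filt_setC.
Qed.

Lemma adapted_measurable (X : R -> T -> R) t : adapted Filt X -> 0 <= t ->
  measurable_fun setT (X t).
Proof.
by move=> aX t0 _ U mU; rewrite setTI; apply: (filt_measurable t0); exact: aX.
Qed.

End filtration_facts.

(** * Independence as a product law *)

Section independence.
Context {R : realType} d d2 (T : measurableType d) (T2 : measurableType d2).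
Variables (P : probability T R) (Q : probability T2 R).

(** The law of the pair agrees with the product measure on rectangles, hence everywhere; Tonelli's
    theorem then integrates out the second coordinate. *)
Lemma ge0_integral_indep d1 (T1 : measurableType d1) (X : T -> T1) (Z : T -> T2) (psi : T1 * T2 -> \bar R) :
  measurable_fun setT X -> measurable_fun setT Z ->
  (forall V U, measurable V -> measurable U ->
    P (X @^-1` V `&` Z @^-1` U) = (P (X @^-1` V) * Q U)%E) ->
  measurable_fun setT psi -> (forall q, 0 <= psi q)%E ->
  (\int[P]_w psi (X w, Z w) = \int[P]_w \int[Q]_z psi (X w, z))%E.
Proof.
move=> mX mZ rect mpsi psi0.
have mXZ : measurable_fun setT (fun w => (X w, Z w)) by exact: measurable_fun_pair.
pose Y1 : {RV P >-> T1} := mfun_Sub (mem_set mX).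
pose Y2 : {RV P >-> (T1 * T2)%type} := mfun_Sub (mem_set mXZ).
transitivity (\int[distribution P Y2]_q psi q)%E.
  by rewrite ge0_integral_distribution.
transitivity (\int[distribution P Y1 \x Q]_q psi q)%E.
  apply: eq_measure_integral => V mV _; apply/esym.
  apply: product_measure_unique => // A C mA mC; exact: rect.
rewrite fubini_tonelli1// ge0_integral_distribution//.
- exact: measurable_fun_fubini_tonelli_F.
- by move=> x; exact: integral_ge0.
Qed.

(* The event is carried along as a boolean coordinate. *)
Lemma ge0_integral_indep_on d1 (T1 : measurableType d1) (A : set T) (X : T -> T1) (Z : T -> T2) (phi : T1 -> T2 -> \bar R) :
  measurable A -> measurable_fun setT X -> measurable_fun setT Z ->
  (forall C V U, C = A \/ C = ~` A -> measurable V -> measurable U ->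
    P ((C `&` X @^-1` V) `&` Z @^-1` U) = (P (C `&` X @^-1` V) * Q U)%E) ->
  measurable_fun setT (fun q => phi q.1 q.2) -> (forall x z, 0 <= phi x z)%E ->
  (\int[P]_(w in A) phi (X w) (Z w) = \int[P]_(w in A) \int[Q]_z phi (X w) z)%E.
Proof.
move=> mA mX mZ rect mphi phi0.
pose X1 w : T1 * bool := (X w, w \in A).
have mX1 : measurable_fun setT X1.
  apply: measurable_fun_pair => //.
  apply: (measurable_fun_bool true); rewrite setTI (_ : _ @^-1` _ = A)//.
  by apply/seteqP; split=> w /=; [exact: set_mem|exact: mem_set].
pose psi (q : (T1 * bool) * T2) : \bar R := if q.1.2 then phi q.1.1 q.2 else 0%E.
have mpsi : measurable_fun setT psi.
  apply: measurable_fun_ifT => //.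
  - by apply: (@measurableT_comp _ _ _ _ _ _ snd) => //; exact: measurable_fst.
  - pose g (q : (T1 * bool) * T2) := (q.1.1, q.2).
    apply: (@measurableT_comp _ _ _ _ _ _ (fun p : T1 * T2 => phi p.1 p.2) _ g) => //.
    apply: measurable_fun_pair; last exact: measurable_snd.
    by apply: (@measurableT_comp _ _ _ _ _ _ fst) => //; exact: measurable_fst.
have psi0 q : (0 <= psi q)%E by rewrite /psi; case: ifP.
(* A measurable set of [T1 * bool] is given by its two sections, one met on [A] and one on the
   complement; hence the factorisation hypothesis for both events. *)
have XE V : X1 @^-1` V = (A `&` (X @^-1` (ysection V true))) `|`
                         (~` A `&` (X @^-1` (ysection V false))).
  apply/seteqP; split=> w /=; rewrite /ysection /= !inE /X1.
    by have [wA|wA] := boolP (w \in A); [left|right]; split=> //;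
      move: wA; rewrite ?inE// notin_setE.
  by case=> -[wA]; [rewrite (mem_set wA)|rewrite (memNset wA)].
have mpre C V : measurable C -> measurable V -> measurable (C `&` X @^-1` V).
  by move=> mC mV; apply: measurableI => //; rewrite -[X @^-1` V]setTI; exact: mX.
have rect1 V U : measurable V -> measurable U ->
    P (X1 @^-1` V `&` Z @^-1` U) = (P (X1 @^-1` V) * Q U)%E.
  move=> mV mU; rewrite XE setIUl.
  have mVt b : measurable (ysection V b) by exact: measurable_ysection.
  have mZU : measurable (Z @^-1` U) by rewrite -[Z @^-1` U]setTI; exact: mZ.
  have mAC : measurable (~` A) by exact: measurableC.
  have h1 := rect A (ysection V true) U (or_introl erefl) (mVt true) mU.
  have h2 := rect (~` A) (ysection V false) U (or_intror erefl) (mVt false) mU.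
  have m1 := mpre _ _ mA (mVt true); have m2 := mpre _ _ mAC (mVt false).
  transitivity (P (A `&` X @^-1` ysection V true) * Q U +
                P (~` A `&` X @^-1` ysection V false) * Q U)%E.
    rewrite measureU//; [by rewrite -h1 -h2|exact: measurableI|exact: measurableI|].
    by apply/seteqP; split=> // w [[[/= wA _] _] [[nwA _] _]]; exact: nwA.
  rewrite -ge0_muleDl ?measure_ge0//; congr (_ * _)%E; apply/esym.
  by apply: measureU => //; apply/seteqP; split=> // w [[/= wA _] [nwA _]]; exact: nwA.
transitivity (\int[P]_w psi (X1 w, Z w))%E.
  by rewrite integral_mkcond; apply: eq_integral => w _; rewrite patchE /psi /=.
rewrite (ge0_integral_indep mX1 mZ rect1 mpsi psi0) [RHS]integral_mkcond.
apply: eq_integral => w _; rewrite patchE /psi /=; case: ifP => //= _.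
by rewrite integral0.
Qed.

End independence.

(** * Expectations across one Brownian increment *)

Section increments.
Context {R : realType} {d : measure_display} {T : measurableType d}.
Variables (P : probability T R) (Filt : R -> set (set T)) (B : R -> T -> R).
Hypothesis hB : brownian_motion P Filt B.

Let hF : filtration Filt. Proof. by case: hB. Qed.
Let aB : adapted Filt B. Proof. by case: hB. Qed.

Lemma bm_measurable (t : R) : 0 <= t -> measurable_fun setT (B t).
Proof. exact: (adapted_measurable hF aB). Qed.

(** The freezing property: given the past, the increment is an independent centred Gaussian of
    variance [h], while [B u] acts as a parameter. *)
Lemma integral_increment (u h : R) (A : set T) (phi : R -> R -> \bar R) :
  0 <= u -> 0 < h -> Filt u A ->
  measurable_fun setT (fun p : R * R => phi p.1 p.2) -> (forall x z, 0 <= phi x z)%E ->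
  (\int[P]_(w in A) phi (B u w) (B (u + h) w - B u w)%R =
   \int[P]_(w in A) \int[normal_prob 0 (Num.sqrt h)]_z phi (B u w) z)%E.
Proof.
move=> u0 h0 fA mphi phi0.
have mA : measurable A by exact: (filt_measurable hF u0).
have uh0 : 0 <= u + h by rewrite addr_ge0// ltW.
pose Z w := B (u + h) w - B u w.
have mZ : measurable_fun setT Z by apply: measurable_funB; exact: bm_measurable.
apply: (@ge0_integral_indep_on R _ _ T (measurableTypeR R) P
  (normal_prob 0 (Num.sqrt h)) _ (measurableTypeR R) A (B u) Z phi) => //.
- exact: bm_measurable.
- move=> C V U CA mV mU; have [_ _ _ _] := hB.
  move=> /(_ u (u + h) u0); rewrite ltrDl => /(_ h0 (C `&` B u @^-1` V)).
  rewrite [u + h - u]addrAC subrr add0r; apply => //.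
  apply: (filt_setI hF) => //; last exact: aB.
  by case: CA => ->//; exact: (filt_setC hF).
Qed.

(** One step of a one-sided Ito formula, with [g] in the role of half the second derivative. The
    loss is of order [h ^+ 2], so it stays negligible over a full grid. *)
Lemma bm_step_lower (u h : R) (A : set T) (f p : R -> R) (g : R -> R) (c : R) :
  0 <= u -> 0 < h -> Filt u A ->
  measurable_fun setT f -> measurable_fun setT g ->
  (forall x, 0 <= f x) -> (forall x, 0 <= g x) -> 0 <= c ->
  (forall x z, f x + p x * z + g x * z ^+ 2 <= f (x + z) + c * z ^+ 4) ->
  (\int[P]_(w in A) (f (B u w) + h * g (B u w))%:E <=
   \int[P]_(w in A) (f (B (u + h) w))%:E + (64 * c * h ^+ 2)%:E)%E.
Proof.
move=> u0 h0 fA mf mg f0 g0 c0 hf.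
have mA : measurable A by exact: (filt_measurable hF u0).
have uh0 : 0 <= u + h by rewrite addr_ge0// ltW.
have mBu := bm_measurable u0; have mBuh := bm_measurable uh0.
have s0 : 0 < Num.sqrt h by rewrite sqrtr_gt0.
have s2 : Num.sqrt h ^+ 2 = h by rewrite sqr_sqrtr// ltW.
have s4 : Num.sqrt h ^+ 4 = h ^+ 2 by rewrite (exprM _ 2 2) s2.
have mfxz : measurable_fun setT (fun q : R * R => (f (q.1 + q.2))%:E).
  by apply/measurable_EFinP; apply: measurableT_comp => //; exact: measurable_funD.
have -> : (\int[P]_(w in A) (f (B (u + h) w))%:E =
   \int[P]_(w in A) \int[normal_prob 0 (Num.sqrt h)]_z (f (B u w + z))%:E)%E.
  rewrite -(integral_increment (phi := fun x z => (f (x + z))%:E) u0 h0 fA mfxz);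
    last by move=> x z; rewrite lee_fin.
  by apply: eq_integral => w _; rewrite subrKC.
have mF : measurable_fun A (fun w =>
    (\int[normal_prob 0 (Num.sqrt h)]_z (f (B u w + z))%:E))%E.
  apply: measurable_funTS.
  apply: (@measurableT_comp _ _ _ _ _ _ (fun x : R =>
    (\int[normal_prob 0 (Num.sqrt h)]_z (f (x + z))%:E))%E _ (B u)) => //.
  apply: (@measurable_fun_fubini_tonelli_F _ _ _ _ _ (normal_prob 0 (Num.sqrt h))
    (fun q : R * R => (f (q.1 + q.2))%:E)) => //.
  by move=> q; rewrite lee_fin.
apply: (@le_trans _ _ (\int[P]_(w in A) (\int[normal_prob 0 (Num.sqrt h)]_z (f (B u w + z))%:E
     + (64 * c * h ^+ 2)%:E))%E).
  apply: ge0_le_integral => //.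
  - by move=> w _; rewrite lee_fin addr_ge0// mulr_ge0// ltW.
  - apply/measurable_EFinP; apply: measurable_funTS; apply: measurable_funD.
      exact: measurableT_comp.
    by apply: measurable_funM => //; exact: measurableT_comp.
  - exact: emeasurable_funD.
  - move=> w _.
    have mfx : measurable_fun setT (fun z => f (B u w + z)).
      by apply: measurableT_comp => //; exact: measurable_funD.
    have := @normal_prob_lower_quadratic R _ (fun z => f (B u w + z)) (f (B u w))
       (p (B u w)) (g (B u w)) c s0 mfx (fun=> f0 _) c0 (hf (B u w)).
    by rewrite s2 s4 [g _ * h]mulrC.
rewrite ge0_integralD//; first last.
- by move=> w _; rewrite lee_fin mulr_ge0 ?sqr_ge0// mulr_ge0.
- by move=> w _; apply: integral_ge0 => z _; rewrite lee_fin.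
rewrite leeD2l// integral_cst// -[leRHS]mule1 lee_wpmul2l ?lee_fin ?mulr_ge0 ?sqr_ge0 ?(ltW h0)//.
exact: probability_le1.
Qed.

Lemma bm_step_sqr (u h : R) (A : set T) : 0 <= u -> 0 < h -> Filt u A ->
  (\int[P]_(w in A) (B (u + h) w ^+ 2)%:E <=
   \int[P]_(w in A) (B u w ^+ 2)%:E + h%:E)%E.
Proof.
move=> u0 h0 fA.
have mA : measurable A by exact: (filt_measurable hF u0).
have mBu := bm_measurable u0.
have s0 : 0 < Num.sqrt h by rewrite sqrtr_gt0.
have s2 : Num.sqrt h ^+ 2 = h by rewrite sqr_sqrtr// ltW.
have mfxz : measurable_fun setT (fun q : R * R => ((q.1 + q.2) ^+ 2)%:E).
  by apply/measurable_EFinP; apply: measurable_funX; exact: measurable_funD.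
have -> : (\int[P]_(w in A) (B (u + h) w ^+ 2)%:E =
   \int[P]_(w in A) \int[normal_prob 0 (Num.sqrt h)]_z ((B u w + z) ^+ 2)%:E)%E.
  rewrite -(integral_increment (phi := fun x z => ((x + z) ^+ 2)%:E) u0 h0 fA mfxz);
    last by move=> x z; rewrite lee_fin sqr_ge0.
  by apply: eq_integral => w _; rewrite subrKC.
under eq_integral do rewrite normal_prob_sqrD// s2 EFinD.
rewrite ge0_integralD//; first last.
- by move=> w _; rewrite lee_fin ltW.
- by apply/measurable_EFinP; apply: measurable_funTS; exact: measurable_funX.
- by move=> w _; rewrite lee_fin sqr_ge0.
rewrite leeD2l// integral_cst// -[leRHS]mule1 lee_wpmul2l ?lee_fin ?(ltW h0)//.
exact: probability_le1.
Qed.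

End increments.

(** * Smoothing and grids *)

Section smoothed_positive_part.
Context {R : realType}.
Implicit Types (r e x y z : R).

(* Convex [C^1] approximation of the positive part, quadratic on [[-r, r]]. *)
Definition smooth_pos r x : R :=
  if x <= - r then 0 else if x <= r then (x + r) ^+ 2 / (4 * r) else x.

(** The derivative of [smooth_pos r]. *)
Definition smooth_pos_slope r x : R :=
  if x <= - r then 0 else if x <= r then (x + r) / (2 * r) else 1.

Lemma smooth_pos_ge0 r x : 0 < r -> 0 <= smooth_pos r x.
Proof.
move=> r0; rewrite /smooth_pos; case: ifP => // _; case: ifP => [_|/negbT].
  by rewrite divr_ge0 ?sqr_ge0// mulr_ge0// ltW.
by rewrite -ltNge => h; rewrite ltW// (lt_trans r0).
Qed.

Lemma smooth_pos_ge r x : 0 < r -> Num.max x 0 <= smooth_pos r x.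
Proof.
move=> r0; rewrite ge_max smooth_pos_ge0// andbT /smooth_pos.
have [h|h] := leP x (- r); first by lra.
have [h'|h'] := leP x r => //.
rewrite ler_pdivlMr ?mulr_gt0//; have := sqr_ge0 (x - r); nra.
Qed.

Lemma smooth_pos_le r x : 0 < r -> smooth_pos r x <= Num.max x 0 + r.
Proof.
move=> r0; have hm : 0 <= Num.max x 0 by rewrite le_max lexx orbT.
have hx : x <= Num.max x 0 by rewrite le_max lexx.
rewrite /smooth_pos.
have [h|h] := leP x (- r); first by lra.
have [h'|h'] := leP x r; last by lra.
rewrite ler_pdivrMr ?mulr_gt0//.
have [x0|x0] := leP x 0; nra.
Qed.

Lemma smooth_pos_slope_itv r x : 0 < r -> 0 <= smooth_pos_slope r x <= 1.
Proof.
move=> r0; rewrite /smooth_pos_slope.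
have [h|h] := leP x (- r); first by rewrite lexx ler01.
have [h'|h'] := leP x r; last by rewrite lexx ler01.
by rewrite divr_ge0 ?ler_pdivrMr ?mulr_gt0//=; lra.
Qed.

Lemma smooth_pos_convex r x y : 0 < r ->
  smooth_pos r x + smooth_pos_slope r x * (y - x) <= smooth_pos r y.
Proof.
move=> r0.
have r4 : 0 < 4 * r by rewrite mulr_gt0.
(* Multiplying by [4 * r] clears the denominators, so that each combination of the three zones is a
   polynomial inequality that follows from a few squares. *)
rewrite -(ler_pM2l r4) mulrDr.
have e1 : 4 * r * smooth_pos r x = if x <= - r then 0 else if x <= r then (x + r) ^+ 2 else 4 * r * x.
  rewrite /smooth_pos; case: ifP => _; first by rewrite mulr0.
  by case: ifP => // _; field; rewrite gt_eqF.
have e2 : 4 * r * smooth_pos r y = if y <= - r then 0 else if y <= r then (y + r) ^+ 2 else 4 * r * y.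
  rewrite /smooth_pos; case: ifP => _; first by rewrite mulr0.
  by case: ifP => // _; field; rewrite gt_eqF.
have e3 : 4 * r * (smooth_pos_slope r x * (y - x)) =
    (if x <= - r then 0 else if x <= r then 2 * (x + r) else 4 * r) * (y - x).
  rewrite mulrA; congr (_ * _).
  rewrite /smooth_pos_slope; case: ifP => _; first by rewrite mulr0.
  by case: ifP => // _; [field; rewrite gt_eqF|rewrite mulr1].
rewrite e1 e2 e3.
have s1 := sqr_ge0 (y - x); have s2 := sqr_ge0 (y + r); have s3 := sqr_ge0 (y - r).
have [h|h] := leP x (- r); have [k|k] := leP y (- r); try lra.
- have [k'|k'] := leP y r; nra.
- have [h'|h'] := leP x r; nra.
- have [h'|h'] := leP x r; have [k'|k'] := leP y r; nra.
Qed.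

Lemma smooth_pos_lipschitz r x y : 0 < r -> smooth_pos r y <= smooth_pos r x + `|y - x|.
Proof.
move=> r0; have := smooth_pos_convex y x r0.
have /andP[s0 s1] := smooth_pos_slope_itv y r0.
have h : smooth_pos_slope r y * (x - y) >= - `|y - x|.
  rewrite -lerN2 opprK -mulrN opprB.
  apply: (@le_trans _ _ (smooth_pos_slope r y * `|y - x|)).
    by rewrite ler_wpM2l// ler_norm.
  by rewrite -[leRHS]mul1r ler_wpM2r.
lra.
Qed.

Lemma measurable_smooth_pos r : measurable_fun setT (smooth_pos r).
Proof.
apply: measurable_fun_ifT => //; first exact: measurable_fun_ler.
apply: measurable_fun_ifT => //; first exact: measurable_fun_ler.
by apply: measurable_funM => //; apply: measurable_funX; exact: measurable_funD.
Qed.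

(** Half the second derivative of [smooth_pos r], cut down to the narrower window where
    [|x| < e]. *)
Definition near0_weight e r x : R := if `|x| < e then (4 * r)^-1 else 0.

Lemma near0_weight_ge0 e r x : 0 < r -> 0 <= near0_weight e r x.
Proof. by move=> r0; rewrite /near0_weight; case: ifP => // _; rewrite invr_ge0 mulr_ge0// ltW. Qed.

Lemma measurable_near0_weight e r : measurable_fun setT (near0_weight e r).
Proof. by apply: measurable_fun_ifT => //; apply: measurable_fun_ltr => //; exact: measurableT_comp. Qed.

(** If [|x| < e] and [|z| < r - e], both [x] and [x + z] lie in the quadratic zone and Taylor's
    formula is exact. For larger [z], [(z / (r - e)) ^+ 2 >= 1] lets the quartic term pay for the
    quadratic one, and convexity does the rest. *)
Lemma smooth_pos_quadratic e r x z : 0 < e -> e < r ->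
  smooth_pos r x + smooth_pos_slope r x * z + near0_weight e r x * z ^+ 2 <=
  smooth_pos r (x + z) + (4 * r * (r - e) ^+ 2)^-1 * z ^+ 4.
Proof.
move=> e0 er; have r0 : 0 < r by rewrite (lt_trans e0).
have re : 0 < r - e by rewrite subr_gt0.
have c0 : 0 < (4 * r * (r - e) ^+ 2)^-1 by rewrite invr_gt0 !mulr_gt0.
have cz : 0 <= (4 * r * (r - e) ^+ 2)^-1 * z ^+ 4 by rewrite mulr_ge0 ?(ltW c0)// exprn_even_ge0.
have cvx := smooth_pos_convex x (x + z) r0; rewrite addrAC subrr add0r in cvx.
rewrite /near0_weight; case: ifP => [|_]; last by rewrite mul0r addr0; lra.
rewrite ltr_norml => /andP[xe1 xe2].
have [zr|zr] := ltP `|z| (r - e).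
  move: zr; rewrite ltr_norml => /andP[z1 z2].
  apply: (@le_trans _ _ (smooth_pos r (x + z))); last by rewrite lerDl.
  rewrite /smooth_pos /smooth_pos_slope.
  have -> : (x <= - r) = false by apply/negbTE; rewrite -ltNge; lra.
  have -> : (x <= r) = true by lra.
  have -> : (x + z <= - r) = false by apply/negbTE; rewrite -ltNge; lra.
  have -> : (x + z <= r) = true by lra.
  by rewrite le_eqVlt; apply/orP; left; apply/eqP; field; rewrite gt_eqF.
apply: lerD => //.
have -> : (4 * r * (r - e) ^+ 2)^-1 * z ^+ 4 = (4 * r)^-1 * (z ^+ 2 * (z / (r - e)) ^+ 2).
  by field; rewrite !gt_eqF.
rewrite ler_pM2l ?invr_gt0 ?mulr_gt0// -[leLHS]mulr1 ler_wpM2l ?sqr_ge0//.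
rewrite -[leRHS]real_normK ?num_real// -[leLHS](expr1n _ 2) lerXn2r ?nnegrE//.
by rewrite normrM normfV (gtr0_norm re) ler_pdivlMr// mul1r.
Qed.

End smoothed_positive_part.

(** * Continuity on the half-line and fine grids *)

Section continuity_halfline.
Context {R : realType}.
Implicit Types (f : R -> R).

Lemma halfline_continuous_eps f (m e : R) : {within `[0, +oo[, continuous f} -> 0 <= m -> 0 < e ->
  exists2 dl : R, 0 < dl & forall x, 0 <= x -> `|x - m| < dl -> `|f x - f m| < e.
Proof.
move=> /subspace_continuousP cf m0 e0.
have mi : `[0, +oo[%classic m by rewrite /= in_itv/= m0.
have /cvgrPdist_lt /(_ e e0) := cf m mi.
move=> /nbhs_ballP[dl /= dl0 h]; exists dl => // x x0 xm.
rewrite distrC; apply: h; first by rewrite /ball /= distrC.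
by rewrite /= in_itv/= x0.
Qed.

Lemma halfline_continuous_ext f : {within `[0, +oo[, continuous f} ->
  continuous (fun x : R => f (Num.max x 0)).
Proof.
move=> cf x; apply/cvgrPdist_lt => e e0.
have m0 : 0 <= Num.max x 0 by rewrite le_max lexx orbT.
have [dl dl0 h] := halfline_continuous_eps cf m0 e0.
near=> y; rewrite distrC; apply: h; first by rewrite le_max lexx orbT.
have : `|x - y| < dl by near: y; exact: (@nbhsx_ballx _ _ x dl dl0).
rewrite distrC; apply: le_lt_trans.
by rewrite /Num.max; case: (ltP y 0); case: (ltP x 0) => x0 y0; rewrite ?subr0 ?sub0r;
  (rewrite ler_norml; apply/andP; split); have := ler_norm (y - x);
  have := ler_norm (- (y - x)); rewrite normrN; lra.
Unshelve. all: by end_near. Qed.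

End continuity_halfline.

Section partition_sums.
Context {R : realType}.

Lemma telescope_grid (V : R -> R) (s h : R) (n : nat) :
  \sum_(i < n) (V (s + i.+1%:R * h) - V (s + i%:R * h)) = V (s + n%:R * h) - V s.
Proof.
elim: n => [|n IH]; first by rewrite big_ord0 mul0r addr0 subrr.
by rewrite big_ord_recr /= IH; ring.
Qed.

Lemma continuous_uniform_itv (f : R -> R) (a b e : R) : continuous f -> 0 < e ->
  exists2 dl : R, 0 < dl & forall x y, a <= x <= b -> `|x - y| < dl -> `|f x - f y| < e.
Proof.
move=> cf e0.
have e20 : 0 < e / 2 by rewrite divr_gt0.
have /compact_near_coveringP := @segment_compact R a b.
move=> /(_ R (0 : R)^'+ (fun dl x => forall y, `|x - y| < dl -> `|f x - f y| < e) _).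
have H : forall x : R, `[a, b]%classic x ->
    \forall x' \near x & i \near (0 : R)^'+, forall y, `|x' - y| < i -> `|f x' - f y| < e.
  move=> x _; have /cvgrPdist_lt /(_ _ e20) /nbhs_ballP[dl /= dl0 h] := cf x.
  exists (ball x (dl / 2), [set i | i < dl / 2]).
    split => /=; first by apply: nbhsx_ballx; rewrite divr_gt0.
    by apply: nbhs_right_lt; rewrite divr_gt0.
  move=> [x' i] [/= xx' id] y x'y.
  have h1 : `|f x - f x'| < e / 2.
    by apply: h; rewrite /ball /= (lt_le_trans xx')// ler_piMr ?ltW// invf_lt1// ltr1n.
  have h2 : `|f x - f y| < e / 2.
    apply: h; rewrite /ball /= -(subrKA x') (le_lt_trans (ler_normD _ _))//.
    by rewrite [ltRHS](splitr dl) ltrD// (lt_trans x'y).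
  rewrite -(subrKA (f x)) (le_lt_trans (ler_normD _ _))// [ltRHS](splitr e) ltrD//.
  by rewrite distrC.
move=> /(_ H) [dl /= dl0 h].
exists (dl / 2); first by rewrite divr_gt0.
move=> x y xab xy.
apply: (h (dl / 2)) => //=.
- by rewrite sub0r normrN gtr0_norm ?divr_gt0// ltr_pdivrMr// ltr_pMr// ltr1n.
- by rewrite divr_gt0.
Qed.

(** On a fine grid [W] varies by less than [e] over each cell, while the increments of [V] are
    nonnegative and telescope. This makes all discretisation errors below vanish. *)
Lemma grid_product_small (V W : R -> R) (T e : R) : 0 < T -> 0 < e ->
  (forall x y, 0 <= x -> x <= y -> y <= T -> V x <= V y) ->
  {within `[0, +oo[, continuous W} ->
  exists N0 : nat, forall N, (N0 <= N)%N ->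
    \sum_(i < N.+1) (V (0 + i.+1%:R * (T / N.+1%:R)) - V (0 + i%:R * (T / N.+1%:R))) *
      (W (0 + i.+1%:R * (T / N.+1%:R)) - W (0 + i%:R * (T / N.+1%:R))) <= e * (V T - V 0).
Proof.
move=> T0 e0 ndV cW.
have [dl dl0 hdl] := continuous_uniform_itv 0 T (halfline_continuous_ext cW) e0.
(* Since [T / dl < (Num.truncn (T / dl)).+1 <= N.+1], the mesh [T / N.+1%:R] is below [dl]. *)
exists (Num.truncn (T / dl)) => N hN.
have N0 : 0 < N.+1%:R :> R by rewrite ltr0n.
set h := T / N.+1%:R.
have h0 : 0 < h by rewrite divr_gt0.
have hd : h < dl.
  rewrite /h ltr_pdivrMr// mulrC -ltr_pdivrMr//.
  have /andP[_ /lt_le_trans] := truncn_itv (ltW (divr_gt0 T0 dl0)); apply.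
  by rewrite ler_nat.
have e1 : N.+1%:R * h = T by rewrite /h mulrCA divff ?mulr1// gt_eqF.
have grid0 i : 0 <= i%:R * h by rewrite mulr_ge0// ltW.
have gridT i : (i <= N.+1)%N -> i%:R * h <= T by move=> ?; rewrite -[leRHS]e1 ler_pM2r// ler_nat.
apply: (@le_trans _ _ (\sum_(i < N.+1) e * (V (0 + i.+1%:R * h) - V (0 + i%:R * h)))).
  apply: ler_sum => i _; rewrite !add0r mulrC ler_wpM2r//.
    by rewrite subr_ge0 ndV// ?gridT// ler_pM2r// ler_nat.
  have := hdl (i%:R * h) (i.+1%:R * h).
  rewrite grid0 gridT ?(ltnW (ltn_ord i))//= !max_l// => /(_ isT).
  rewrite distrC -mulrBl -natrB// subSnn mul1r gtr0_norm// => /(_ hd).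
  rewrite distrC => /ltW; apply: le_trans; exact: ler_norm.
by rewrite -big_distrr /= telescope_grid add0r e1.
Qed.

End partition_sums.

Section clipping.
Context {R : realType}.
Implicit Types (z : \bar R) (s t : R).

(** The real-valued minimum of a stopping time and a fixed time: [stopped X tau t w] is
    [X (clip (tau w) t) w] by conversion. *)
Definition clip z t : R := fine (Order.min z t%:E).

Lemma clip_lt z t : (t%:E < z)%E -> clip z t = t.
Proof. by move=> h; rewrite /clip min_r// ltW. Qed.

Lemma clip_ge z t : (0 <= z)%E -> (z <= t%:E)%E -> z = (clip z t)%:E.
Proof.
move=> z0 zt; rewrite /clip min_l// fineK//.
by rewrite fin_numE; apply/andP; split; [rewrite -ltNye (lt_le_trans _ z0)|rewrite -ltey (le_lt_trans zt)// ltry].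
Qed.

Lemma clip_ge0 z t : (0 <= z)%E -> 0 <= t -> 0 <= clip z t.
Proof. by move=> z0 t0; rewrite /clip fine_ge0// le_min z0 lee_fin. Qed.

Lemma clip_le_id z t : (0 <= z)%E -> clip z t <= t.
Proof.
move=> z0; have [h|h] := ltP t%:E z; first by rewrite clip_lt.
by rewrite -lee_fin -clip_ge.
Qed.

Lemma clip_mono z s t : (0 <= z)%E -> s <= t -> clip z s <= clip z t.
Proof.
move=> z0 st; have [h|h] := ltP s%:E z.
  rewrite (clip_lt h); have [k|k] := ltP t%:E z; first by rewrite clip_lt.
  by rewrite -lee_fin -clip_ge// ltW.
by rewrite -lee_fin -!clip_ge// (le_trans h)// lee_fin.
Qed.

Lemma clip_fine z t : (0 <= z)%E -> (z <= t%:E)%E -> clip z t = fine z.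
Proof. by move=> z0 zt; rewrite {2}(clip_ge z0 zt). Qed.

End clipping.

Section split_integral.
Context {R : realType} d (T : measurableType d) (mu : {measure set T -> \bar R}).

Lemma ge0_integral_splitI (A E : set T) (f : T -> \bar R) :
  measurable A -> measurable E -> measurable_fun A f -> (forall x, A x -> 0 <= f x)%E ->
  (\int[mu]_(x in A) f x = \int[mu]_(x in A `&` E) f x + \int[mu]_(x in A `&` ~` E) f x)%E.
Proof.
move=> mA mE mf f0; rewrite -[in LHS](setIT A) -(setUv E) setIUr ge0_integral_setU//.
- exact: measurableI.
- by apply: measurableI => //; exact: measurableC.
- by rewrite -setIUr setUv setIT.
- by move=> x; rewrite -setIUr setUv setIT; exact: f0.
- by apply/disj_setPS => x [[_ /= xE] [_ nxE]].
Qed.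

End split_integral.

(** * The stopped Brownian motion on a grid *)

Section stopped_grid.
Context {R : realType} {d : measure_display} {T : measurableType d}.
Variables (P : probability T R) (Filt : R -> set (set T)) (B : R -> T -> R).
Variable tau : T -> \bar R.
Hypothesis hB : brownian_motion P Filt B.
Hypothesis hT : stopping_time Filt tau.
Hypothesis aX : adapted Filt (stopped B tau).

Let hF : filtration Filt. Proof. by case: hB. Qed.
Let tau0 w : (0 <= tau w)%E. Proof. exact: hT.1. Qed.

Lemma filt_tau_gt (t : R) : 0 <= t -> Filt t [set w | (t%:E < tau w)%E].
Proof.
move=> t0; rewrite (_ : [set _ | _] = ~` [set w | (tau w <= t%:E)%E]).
  by apply: (filt_setC hF) => //; exact: hT.2.
by apply/seteqP; split=> w /=; rewrite ltNge => /negP.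
Qed.

Lemma measurable_tau_gt (t : R) : 0 <= t -> measurable_fun setT (fun w => (t%:E < tau w)%E).
Proof.
move=> t0; apply: (measurable_fun_bool true); rewrite setTI.
exact: (filt_measurable hF t0 (filt_tau_gt t0)).
Qed.

Let mX (t : R) : 0 <= t -> measurable_fun setT (stopped B tau t).
Proof. exact: (adapted_measurable hF aX). Qed.

(* The process stopped at the first grid time after [tau]. *)
Fixpoint grid_proc (s h : R) (i : nat) (w : T) : R :=
  if i is j.+1 then
    if ((s + j%:R * h)%:E < tau w)%E then B (s + j.+1%:R * h) w else grid_proc s h j w
  else stopped B tau s w.

Section fixed_grid.
Variables (s h : R).
Hypotheses (s0 : 0 <= s) (h0 : 0 < h).
Local Notation tt i := (s + i%:R * h).

Let tt0 i : 0 <= tt i. Proof. by rewrite addr_ge0// mulr_ge0// ltW. Qed.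
Let ttS i : tt i.+1 = tt i + h. Proof. by rewrite -natr1 mulrDl mul1r addrA. Qed.

Lemma grid_proc_lt i w : ((tt i)%:E < tau w)%E -> grid_proc s h i w = B (tt i) w.
Proof.
case: i => [|i] /= hi.
  by move: hi; rewrite mul0r addr0 => hi; rewrite /stopped -/(clip _ _) clip_lt.
rewrite (lt_trans _ hi)// lte_fin ttS ltrDl//.
Qed.

Lemma measurable_grid_proc i : measurable_fun setT (grid_proc s h i).
Proof.
elim: i => [|i IH] /=; first exact: mX.
by apply: measurable_fun_ifT => //; [exact: measurable_tau_gt|exact: (bm_measurable hB)].
Qed.

(** Stopping on the grid overshoots [tau] by at most one mesh, so continuity of the path gives
    convergence to the stopped process. *)
Lemma grid_proc_time i w : exists th : R,
  [/\ 0 <= th, grid_proc s h i w = B th w & `|th - clip (tau w) (tt i)| <= h].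
Proof.
elim: i => [|i [th [th0 e hth]]] /=.
  exists (clip (tau w) s); split=> //; first exact: clip_ge0.
  by rewrite mul0r addr0 subrr normr0 ltW.
case: ifPn => hi.
  exists (tt i.+1); split=> //; have h1 := clip_le_id (tt i.+1) (tau0 w).
  have : tt i <= clip (tau w) (tt i.+1).
    by rewrite -{1}(clip_lt hi) clip_mono// ttS lerDl ltW.
  by rewrite ger0_norm ?subr_ge0//; move: h1; rewrite ttS; lra.
exists th; split=> //.
rewrite -leNgt in hi.
suff -> : clip (tau w) (tt i.+1) = clip (tau w) (tt i) by [].
by rewrite !clip_fine// (le_trans hi)// lee_fin ttS lerDl ltW.
Qed.

(** Induction on [n]. The event that the [n]-th grid time precedes [tau] belongs to the past of that
    time, so on it a full Brownian step applies, and off it the process stays put. Stopping at [tau]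
    itself would cut steps short and destroy the independence. *)
Lemma grid_lower (A : set T) (f p g : R -> R) (c : R) n : Filt s A ->
  measurable_fun setT f -> measurable_fun setT g ->
  (forall x, 0 <= f x) -> (forall x, 0 <= g x) -> 0 <= c ->
  (forall x z, f x + p x * z + g x * z ^+ 2 <= f (x + z) + c * z ^+ 4) ->
  (\int[P]_(w in A) (f (stopped B tau s w) +
      \sum_(i < n) h * (if ((tt i)%:E < tau w)%E then g (B (tt i) w) else 0))%:E <=
   \int[P]_(w in A) (f (grid_proc s h n w))%:E + (n%:R * (64 * c * h ^+ 2))%:E)%E.
Proof.
move=> fA mf mg f0 g0 c0 hf.
have mA : measurable A by exact: (filt_measurable hF s0).
pose G i w : R := if ((tt i)%:E < tau w)%E then g (B (tt i) w) else 0.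
have G0 i w : 0 <= G i w by rewrite /G; case: ifP.
have mG i : measurable_fun setT (G i).
  apply: measurable_fun_ifT => //; first exact: measurable_tau_gt.
  by apply: measurableT_comp => //; exact: (bm_measurable hB).
have mfX i : measurable_fun A (EFin \o (fun w => f (grid_proc s h i w))).
  apply/measurable_EFinP; apply: measurable_funTS; apply: measurableT_comp => //.
  exact: measurable_grid_proc.
elim: n => [|n IH].
  by rewrite mul0r adde0; under eq_integral do rewrite big_ord0 addr0.
under eq_integral do rewrite big_ord_recr /= addrA EFinD.
rewrite ge0_integralD//; last first.
- apply/measurable_EFinP; apply: measurable_funTS; apply: measurable_funM => //; exact: mG.
- by move=> w _; rewrite lee_fin mulr_ge0 ?(ltW h0)//; exact: G0.
- apply/measurable_EFinP; apply: measurable_funTS; apply: measurable_funD.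
    by apply: measurableT_comp => //; exact: mX.
  by apply: measurable_sum => i; apply: measurable_funM => //; exact: mG.
- move=> w _; rewrite lee_fin addr_ge0// sumr_ge0// => i _.
  by rewrite mulr_ge0 ?(ltW h0)//; exact: G0.
apply: (le_trans (leeD2r _ IH)).
rewrite -addeA [((n%:R * _)%:E + _)%E]addeC addeA.
have -> : n.+1%:R * (64 * c * h ^+ 2) = 64 * c * h ^+ 2 + n%:R * (64 * c * h ^+ 2).
  by rewrite -natr1 mulrDl mul1r addrC.
rewrite [(64 * c * h ^+ 2 + _)%:E]EFinD [in leRHS]addeA.
rewrite leeD2r// -ge0_integralD//; first last.
- apply/measurable_EFinP; apply: measurable_funTS; apply: measurable_funM => //; exact: mG.
- by move=> w _; rewrite lee_fin mulr_ge0 ?(ltW h0)//; exact: G0.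
- exact: mfX.
- by move=> w _; rewrite lee_fin.
pose E := [set w | ((tt n)%:E < tau w)%E].
have fE : Filt (tt n) E by exact: filt_tau_gt.
have mE : measurable E by exact: (filt_measurable hF (tt0 n)).
have fAE : Filt (tt n) (A `&` E).
  by apply: (filt_setI hF) => //; apply: (filt_mono hF s0 _ fA); rewrite lerDl mulr_ge0// ltW.
rewrite (ge0_integral_splitI _ mA mE); last 2 first.
- apply: emeasurable_funD; first exact: mfX.
  by apply/measurable_EFinP; apply: measurable_funTS; apply: measurable_funM => //; exact: mG.
- by move=> w _; rewrite -EFinD lee_fin addr_ge0// mulr_ge0 ?(ltW h0)//; exact: G0.
rewrite [in leRHS](ge0_integral_splitI _ mA mE)//; last by move=> w _; rewrite lee_fin.
have -> : (\int[P]_(x in A `&` ~` E) ((f (grid_proc s h n x))%:E + (h * G n x)%:E) =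
           \int[P]_(x in A `&` ~` E) (f (grid_proc s h n.+1 x))%:E)%E.
  apply: eq_integral => w; rewrite inE => -[_ /= /negP/negbTE nE].
  by rewrite /G /= nE mulr0 adde0.
rewrite [leRHS]addeAC leeD2r//.
have -> : (\int[P]_(x in A `&` E) ((f (grid_proc s h n x))%:E + (h * G n x)%:E) =
           \int[P]_(x in A `&` E) (f (B (tt n) x) + h * g (B (tt n) x))%:E)%E.
  by apply: eq_integral => w; rewrite inE => -[_ /= wE]; rewrite grid_proc_lt// /G wE -EFinD.
have -> : (\int[P]_(x in A `&` E) (f (grid_proc s h n.+1 x))%:E =
           \int[P]_(x in A `&` E) (f (B (tt n + h) x))%:E)%E.
  by apply: eq_integral => w; rewrite inE => -[_ /= wE]; rewrite wE -natr1 mulrDl mul1r addrA.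
exact: (bm_step_lower hB).
all: exact: mfX.
Qed.

Lemma grid_sqr n :
  (\int[P]_w (grid_proc s h n w ^+ 2)%:E <=
   \int[P]_w (stopped B tau s w ^+ 2)%:E + (n%:R * h)%:E)%E.
Proof.
have mq i : measurable_fun setT (EFin \o (fun w => grid_proc s h i w ^+ 2)).
  by apply/measurable_EFinP; apply: measurable_funX; exact: measurable_grid_proc.
elim: n => [|n IH]; first by rewrite mul0r adde0.
pose E := [set w | ((tt n)%:E < tau w)%E].
have fE : Filt (tt n) E by exact: filt_tau_gt.
have mE : measurable E by exact: (filt_measurable hF (tt0 n)).
rewrite -natr1 mulrDl mul1r EFinD addeA.
apply: le_trans (leeD2r _ IH).
rewrite (ge0_integral_splitI _ measurableT mE)//; last by move=> w _; rewrite lee_fin sqr_ge0.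
rewrite [in leRHS](ge0_integral_splitI _ measurableT mE)//; last by move=> w _; rewrite lee_fin sqr_ge0.
rewrite !setTI [leRHS]addeAC.
have -> : (\int[P]_(x in ~` E) (grid_proc s h n x ^+ 2)%:E =
           \int[P]_(x in ~` E) (grid_proc s h n.+1 x ^+ 2)%:E)%E.
  by apply: eq_integral => w; rewrite inE /= => /negP/negbTE ->.
rewrite leeD2r//.
have -> : (\int[P]_(x in E) (grid_proc s h n x ^+ 2)%:E =
           \int[P]_(x in E) (B (tt n) x ^+ 2)%:E)%E.
  by apply: eq_integral => w; rewrite inE => wE; rewrite grid_proc_lt.
have -> : (\int[P]_(x in E) (grid_proc s h n.+1 x ^+ 2)%:E =
           \int[P]_(x in E) (B (tt n + h) x ^+ 2)%:E)%E.
  by apply: eq_integral => w; rewrite inE /= => wE; rewrite wE -natr1 mulrDl mul1r addrA.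
exact: (bm_step_sqr hB).
all: exact: mq.
Qed.

End fixed_grid.

Lemma grid_proc_cvg (s t e : R) w : 0 <= s -> s < t -> 0 < e ->
  exists N0 : nat, forall N, (N0 <= N)%N ->
    `|grid_proc s ((t - s) / N.+1%:R) N.+1 w - stopped B tau t w| < e.
Proof.
move=> s0 st e0; have ts0 : 0 < t - s by rewrite subr_gt0.
have t0 : 0 <= t by lra.
have cB : {within `[0, +oo[, continuous (fun t => B t w)} by case: hB.
have [dl dl0 hdl] := halfline_continuous_eps cB (clip_ge0 (tau0 w) t0) e0.
exists (Num.truncn ((t - s) / dl)) => N hN.
have N0 : 0 < N.+1%:R :> R by rewrite ltr0n.
set h := (t - s) / N.+1%:R.
have h0 : 0 < h by rewrite divr_gt0.
have hd : h < dl.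
  rewrite /h ltr_pdivrMr// mulrC -ltr_pdivrMr//.
  have /andP[_ /lt_le_trans] := truncn_itv (ltW (divr_gt0 ts0 dl0)); apply.
  by rewrite ler_nat.
have e1 : s + N.+1%:R * h = t by rewrite /h mulrCA divff ?mulr1 ?gt_eqF// addrC subrK.
have [th [th0 ->]] := grid_proc_time s0 h0 N.+1 w; rewrite e1 => hth.
by apply: hdl => //; exact: le_lt_trans hth hd.
Qed.

(** The second moment grows by at most [h] per grid step; Fatou's lemma carries the bound to the
    stopped process. It supplies the integrability for the convergence in mean of the grid
    processes. *)
Lemma stopped_sqr_le (t : R) : 0 <= t ->
  (\int[P]_w (stopped B tau t w ^+ 2)%:E <= t%:E)%E.
Proof.
have X0 w : stopped B tau 0 w = 0.
  have -> : stopped B tau 0 w = B (clip (tau w) 0) w by [].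
  have -> : clip (tau w) 0 = 0.
    by apply/eqP; rewrite eq_le clip_le_id// clip_ge0.
  by case: hB.
rewrite le_eqVlt => /predU1P[<-|t0].
  by rewrite integral0_eq// => w _; rewrite X0 expr0n.
have h0 N : 0 < (t - 0) / N.+1%:R by rewrite subr0 divr_gt0.
apply: (@fatou_le _ _ _ _ _ (fun N w => (grid_proc 0 ((t - 0) / N.+1%:R) N.+1 w ^+ 2)%:E)) => //.
- by move=> N; apply/measurable_EFinP; apply: measurable_funX; exact: measurable_grid_proc.
- by move=> N w; rewrite lee_fin sqr_ge0.
- by apply/measurable_EFinP; apply: measurable_funX; apply: mX; exact: ltW.
- by move=> w _; rewrite lee_fin sqr_ge0.
- apply: aeW => w _; apply: limn_einf_ge => e e0.
  set x := stopped B tau t w.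
  (* The difference [x ^+ 2 - y ^+ 2] is at most [2 * |x| * |y - x|], because the square of [y - x]
     enters with a minus sign; the added [1] keeps the divisor positive. *)
  have k0 : 0 < Num.min 1 (e / (2 * `|x| + 1)) by rewrite lt_min ltr01 divr_gt0// ltr_wpDl// mulr_ge0.
  have [N0 hN] := grid_proc_cvg w (lexx 0) t0 k0; exists N0 => N N0N.
  rewrite -EFinD lee_fin; have := hN N N0N; rewrite -/x; set y := grid_proc _ _ _ _.
  rewrite lt_min => /andP[y1 y2].
  have : x ^+ 2 - y ^+ 2 <= 2 * `|x| * `|y - x|.
    have -> : x ^+ 2 - y ^+ 2 = (- (y - x)) * (2 * x) - (y - x) ^+ 2 by ring.
    have := sqr_ge0 (y - x).
    have : (- (y - x)) * (2 * x) <= 2 * `|x| * `|y - x|.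
      rewrite (le_trans (ler_norm _))// normrM normrN normrM (ger0_norm (_ : 0 <= 2))//.
      by rewrite mulrC.
    by lra.
  have p1 : 0 < 2 * `|x| + 1 by rewrite ltr_wpDl// mulr_ge0.
  have : 2 * `|x| * `|y - x| <= e.
    apply: (@le_trans _ _ ((2 * `|x| + 1) * `|y - x|)).
      by rewrite ler_wpM2r// lerDl.
    by rewrite mulrC -ler_pdivlMr// ltW.
  by lra.
- apply: limn_einf_le => e e0 N; exists N => //.
  apply: (le_trans (grid_sqr (lexx 0) (h0 N) N.+1)).
  rewrite integral0_eq ?add0e; last by move=> w _; rewrite X0 expr0n.
  rewrite subr0 mulrCA divff ?mulr1 ?pnatr_eq0//.
  by rewrite leeDl// lee_fin ltW.
Qed.

End stopped_grid.

Lemma le_measure_sub d (T : measurableType d) (R : realType) (m : {measure set T -> \bar R})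
  (A E : set T) : measurable A -> measurable E -> A `<=` E -> (m A <= m E)%E.
Proof. by move=> mA mE AE; apply: le_measure => //; rewrite inE. Qed.

Lemma le_measure_cover_null d (T : measurableType d) (R : realType)
    (m : {measure set T -> \bar R}) (A Q N O : set T) :
  measurable A -> measurable Q -> measurable N -> measurable O -> m N = 0%E ->
  A `<=` (Q `|` N) `|` O -> (m A <= m Q + m O)%E.
Proof.
move=> mA mQ mN mO N0 AE.
apply: (@le_trans _ _ (m ((Q `|` N) `|` O))).
  by apply: le_measure_sub => //; apply: measurableU => //; exact: measurableU.
apply: (le_trans (measureU2 _ (measurableU _ _ mQ mN) mO)); rewrite leeD2r//.
by apply: (le_trans (measureU2 m mQ mN)); rewrite [X in (_ + X)%E](_ : _ = 0%E) ?adde0.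
Qed.

(** * Occupation times and Tanaka's inequality *)

Section occupation_riemann.
Context {R : realType}.
Notation mu := (@lebesgue_measure R).

(** [occupation] for a single path, to which it is convertible; the comparison with Riemann sums is
    then deterministic. *)
Definition path_occupation (b : R -> R) (e u : R) : R :=
  fine (mu [set x | 0 <= x <= u /\ `|b x| < e]).

(** If [|b x| < e] and [x < z], then on fine grids the left endpoint of the cell of [x] has both
    properties, by continuity. So the step functions eventually dominate the weighted indicator, and
    Fatou's lemma for Lebesgue measure concludes. *)
Lemma occupation_le_liminf (b : R -> R) (z : \bar R) (s t e r : R) :
  {within `[0, +oo[, continuous b} -> (0 <= z)%E -> 0 <= s -> s < t -> 0 < e -> 0 < r ->
  (((4 * r)^-1 * (path_occupation b e (clip z t) - path_occupation b e (clip z s)))%:E <=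
   limn_einf (fun N : nat => (\sum_(i < N.+1) ((t - s) / N.+1%:R) *
     (if ((s + i%:R * ((t - s) / N.+1%:R))%:E < z)%E
      then near0_weight e r (b (s + i%:R * ((t - s) / N.+1%:R))) else 0))%:E))%E.
Proof.
move=> cb z0 s0 st e0 r0.
have t0 : 0 <= t by lra.
have ts0 : 0 < t - s by rewrite subr_gt0.
set s' := clip z s; set t' := clip z t.
have s'0 : 0 <= s' by exact: clip_ge0.
have t'0 : 0 <= t' by exact: clip_ge0.
have st' : s' <= t' by apply: clip_mono => //; exact: ltW.
have tt' : t' <= t by exact: clip_le_id.
pose bb (x : R) := b (Num.max x 0).
have mbb : measurable [set x | `|bb x| < e].
  have mb : measurable_fun setT (fun x => `|bb x|).
    by apply: measurableT_comp => //; apply: continuous_measurable_fun; exact: halfline_continuous_ext.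
  have := @measurable_fun_ltr _ _ R setT (fun x => `|bb x|) (cst e) mb (measurable_cst _).
  by move=> /(_ measurableT [set true]) /(_ I); rewrite setTI; apply.
have OE u : [set x | 0 <= x <= u /\ `|b x| < e] = `[0, u]%classic `&` [set x | `|bb x| < e].
  apply/seteqP; split=> x /=; rewrite in_itv/= => -[/andP[x0 xu]].
    by rewrite /bb max_l// x0 xu.
  by rewrite /bb max_l// x0 xu.
have mO u : measurable [set x | 0 <= x <= u /\ `|b x| < e].
  by rewrite OE; exact: measurableI.
have finO u : 0 <= u -> (mu [set x | 0 <= x <= u /\ `|b x| < e] \is a fin_num).
  move=> u0; rewrite ge0_fin_numE//; apply: (@le_lt_trans _ _ (mu `[0, u]%classic)).
    by apply: le_measure_sub; [exact: mO|exact: measurable_itv|rewrite OE; exact: subIsetl].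
  by rewrite lebesgue_measure_itv/=; case: ifP => _; rewrite ?ltry// -EFinB ltry.
(* Half-open on the right so that every point of [Q] is strictly before [z]; the lost endpoint [t']
   is a null set. *)
pose Q := `[s', t'[%classic `&` [set x | `|bb x| < e].
have mQ : measurable Q by exact: measurableI.
have finQ : mu Q \is a fin_num.
  rewrite ge0_fin_numE//; apply: (@le_lt_trans _ _ (mu `[s', t'[%classic)).
    by apply: le_measure_sub; [exact: mQ|exact: measurable_itv|exact: subIsetl].
  by rewrite lebesgue_measure_itv/=; case: ifP => _; rewrite ?ltry// -EFinB ltry.
have occQ : path_occupation b e t' - path_occupation b e s' <= fine (mu Q).
  rewrite lerBlDr -lee_fin EFinD /path_occupation !fineK ?finO//.
  apply: (@le_measure_cover_null _ (measurableTypeR R) R mu _ Q [set t'] _);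
    [exact: mO|exact: mQ|exact: measurable_set1|exact: mO|exact: lebesgue_measure_set1|].
  move=> x [/andP[x0 xt'] bx]; have [xs'|xs'] := leP x s'.
    by right; rewrite /= x0 xs'.
  left; move: xt'; rewrite le_eqVlt => /predU1P[->|xt']; first by right.
  by left; split; rewrite /= ?in_itv/= ?xt' ?andbT ?(ltW xs')// /bb max_l.
have r4 : 0 < (4 * r)^-1 by rewrite invr_gt0 mulr_gt0.
apply: (@le_trans _ _ ((4 * r)^-1 * fine (mu Q))%:E); first by rewrite lee_fin ler_pM2l.
pose h (N : nat) := (t - s) / N.+1%:R.
have h0 N : 0 < h N by rewrite divr_gt0.
pose tt N i := s + i%:R * h N.
pose c N i := if ((tt N i)%:E < z)%E then near0_weight e r (b (tt N i)) else 0.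
have c0 N i : 0 <= c N i by rewrite /c; case: ifP => // _; exact: near0_weight_ge0.
pose J N i : set R := `[tt N i, tt N i.+1[%classic.
have mJ N i : measurable (J N i) by exact: measurable_itv.
have ttS N i : tt N i.+1 = tt N i + h N by rewrite /tt -natr1 mulrDl mul1r addrA.
have muJ N i : mu (J N i) = (h N)%:E.
  rewrite lebesgue_measure_itv/= lte_fin ttS ltrDl h0 -EFinB; congr EFin; ring.
have -> : ((4 * r)^-1 * fine (mu Q))%:E = (\int[mu]_x ((4 * r)^-1 * \1_Q x)%:E)%E.
  under eq_integral do rewrite EFinM.
  rewrite ge0_integralZl//; last 2 first.
  - by apply/measurable_EFinP; exact: measurable_indic.
  - by rewrite lee_fin ltW.
  by rewrite integral_indic// setIT EFinM fineK.
have pt (x : R) : (((4 * r)^-1 * \1_Q x)%:E <=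
    limn_einf (fun N => (\sum_(i < N.+1) c N i * \1_(J N i) x)%:E))%E.
  have [xQ|xQ] := boolP (x \in Q); last first.
    rewrite indicE (negbTE xQ) mulr0; apply: limn_einf_ge0 => N.
    by rewrite lee_fin sumr_ge0// => i _; rewrite mulr_ge0.
  rewrite indicE xQ mulr1; apply: limn_einf_ge => e1 e10.
  move: xQ; rewrite inE => -[]; rewrite /= in_itv/= => /andP[s'x xt'].
  have x0 : 0 <= x by exact: le_trans s'0 s'x.
  rewrite /bb max_l// => bx.
  have eb : 0 < e - `|b x| by rewrite subr_gt0.
  have [dl dl0 hdl] := halfline_continuous_eps cb x0 eb.
  have xz : (x%:E < z)%E.
    have [tz|tz] := ltP t%:E z.
      by rewrite (lt_trans _ tz)// lte_fin (lt_le_trans xt').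
    by rewrite (clip_ge z0 tz) lte_fin.
  have sx : s <= x.
    have [sz|sz] := ltP s%:E z; first by rewrite -(clip_lt sz).
    exfalso; move: xz; rewrite (clip_ge z0 sz) lte_fin -/s'; lra.
  have xt : x < t by exact: lt_le_trans xt' tt'.
  exists (Num.truncn ((t - s) / dl)) => N hN.
  have N0 : 0 < N.+1%:R :> R by rewrite ltr0n.
  have hd : h N < dl.
    rewrite /h ltr_pdivrMr// mulrC -ltr_pdivrMr//.
    have /andP[_ /lt_le_trans] := truncn_itv (ltW (divr_gt0 ts0 dl0)); apply.
    by rewrite ler_nat.
  have xs0 : 0 <= (x - s) / h N by rewrite divr_ge0 ?subr_ge0// ltW.
  set i := Num.truncn ((x - s) / h N).
  have /andP[i1 i2] := truncn_itv xs0; rewrite -/i in i1 i2.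
  have {}i1 : tt N i <= x by move: i1; rewrite ler_pdivlMr// /tt; lra.
  have {}i2 : x < tt N i.+1 by move: i2; rewrite ltr_pdivrMr// /tt; lra.
  have iN : (i < N.+1)%N.
    rewrite -(ltr_nat R) -(ltr_pM2r (h0 N)).
    have -> : N.+1%:R * h N = t - s by rewrite /h mulrCA divff ?mulr1// gt_eqF.
    by move: i1; rewrite /tt; lra.
  rewrite -EFinD lee_fin (bigD1 (Ordinal iN))//= -addrA.
  have -> : \1_(J N i) x = 1 :> R.
    by rewrite indicE mem_set// /J /= in_itv/= i1 i2.
  have tt0 : 0 <= tt N i by rewrite addr_ge0// mulr_ge0// ltW.
  have -> : c N i = (4 * r)^-1.
    rewrite /c (le_lt_trans _ xz) ?lee_fin//.
    rewrite /near0_weight ifT//.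
    have : `|b (tt N i) - b x| < e - `|b x|.
      apply: hdl => //; rewrite distrC ger0_norm ?subr_ge0//.
      by apply: lt_trans hd; move: i2; rewrite ttS; lra.
    by have := ler_normD (b (tt N i) - b x) (b x); rewrite subrK; lra.
  rewrite mulr1 lerDl addr_ge0 ?(ltW e10)// sumr_ge0// => j _.
  by rewrite mulr_ge0.
apply: (@fatou_le R _ (measurableTypeR R) mu setT
  (fun N (x : R) => (\sum_(i < N.+1) c N i * \1_(J N i) x)%:E)) => //.
- move=> N; apply/measurable_EFinP; apply: measurable_sum => i.
  by apply: measurable_funM => //; apply: measurable_indic; exact: mJ.
- by move=> N x; rewrite lee_fin sumr_ge0// => i _; rewrite mulr_ge0.
- by apply/measurable_EFinP; apply: measurable_funM => //; exact: measurable_indic.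
- by move=> x _; rewrite lee_fin mulr_ge0// ltW.
- by apply: aeW => x _; exact: pt.
- apply: limn_einf_mono => N; rewrite -/(h N).
  under eq_integral do rewrite -sumEFin.
  rewrite ge0_integral_sum//; last 2 first.
  - move=> i; apply/measurable_EFinP.
    by apply: measurable_funM => //; apply: measurable_indic; exact: mJ.
  - by move=> i x _; rewrite lee_fin mulr_ge0.
  rewrite -sumEFin; apply: lee_sum => i _.
  under eq_integral do rewrite EFinM.
  rewrite ge0_integralZl//; last 2 first.
  - by apply/measurable_EFinP; apply: measurable_indic; exact: mJ.
  - by rewrite lee_fin.
  rewrite integral_indic//; last exact: mJ.
  rewrite setIT; apply: (@le_trans _ _ ((c N i)%:E * (h N)%:E)%E); last by rewrite -EFinM mulrC.
  by apply: lee_wpmul2l; [rewrite lee_fin|rewrite -(muJ N i)].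
Qed.

End occupation_riemann.

Section tanaka.
Context {R : realType} {d : measure_display} {T : measurableType d}.
Variables (P : probability T R) (Filt : R -> set (set T)) (B L : R -> T -> R).
Variable tau : T -> \bar R.
Hypothesis hB : brownian_motion P Filt B.
Hypothesis hL : local_time_at0 P Filt B L.
Hypothesis hT : stopping_time Filt tau.
Hypothesis aX : adapted Filt (stopped B tau).

Let hF : filtration Filt. Proof. by case: hB. Qed.
Let tau0 w : (0 <= tau w)%E. Proof. exact: hT.1. Qed.
Let mX (t : R) : 0 <= t -> measurable_fun setT (stopped B tau t).
Proof. exact: (adapted_measurable hF aX). Qed.

Let gridN (s t : R) (N : nat) := grid_proc B tau s ((t - s) / N.+1%:R) N.+1.

(** Pointwise convergence becomes convergence in mean: [|D|] is at most [Num.min |D| K], which is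
    handled by dominated convergence, plus [D ^+ 2 / K], whose mean is at most [4 * t / K]. *)
Lemma grid_proc_L1 (s t e : R) : 0 <= s -> s < t -> 0 < e ->
  exists N0 : nat, forall N, (N0 <= N)%N ->
    (\int[P]_w (`|gridN s t N w - stopped B tau t w|)%:E <= e%:E)%E.
Proof.
move=> s0 st e0; have t0 : 0 < t by lra.
(* Chosen so that [4 * t / K <= e / 2]. *)
pose K := 8 * t / e + 1.
have K0 : 0 < K by rewrite /K ltr_wpDl// divr_ge0 ?mulr_ge0// ltW.
have h0 N : 0 < (t - s) / N.+1%:R by rewrite divr_gt0// subr_gt0.
pose D N w := gridN s t N w - stopped B tau t w.
have mG N : measurable_fun setT (gridN s t N) by exact: (measurable_grid_proc hB hT aX).
have mXt := mX (ltW t0).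
have mD N : measurable_fun setT (D N) by exact: measurable_funB.
pose M N w : R := Num.min `|D N w| K.
have mM N : measurable_fun setT (M N).
  by apply: measurable_minr => //; exact: measurableT_comp.
have M0 N w : 0 <= M N w by rewrite le_min normr_ge0 ltW.
have sqrle N : (\int[P]_w (D N w ^+ 2)%:E <= (4 * t)%:E)%E.
  apply: (@le_trans _ _ (\int[P]_w (2%:E * ((gridN s t N w ^+ 2)%:E + (stopped B tau t w ^+ 2)%:E)))%E).
    apply: ge0_le_integral => //.
    - by move=> w _; rewrite lee_fin sqr_ge0.
    - by apply/measurable_EFinP; exact: measurable_funX.
    - apply: emeasurable_funM => //; apply: emeasurable_funD; apply/measurable_EFinP; exact: measurable_funX.
    - move=> w _; rewrite -EFinD -EFinM lee_fin /D.
      by have := sqr_ge0 (gridN s t N w + stopped B tau t w); nra.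
  rewrite ge0_integralZl//; last 2 first.
  - by apply: emeasurable_funD; apply/measurable_EFinP; exact: measurable_funX.
  - by move=> w _; rewrite -EFinD lee_fin addr_ge0 ?sqr_ge0.
  rewrite ge0_integralD//; last 4 first.
  - by move=> w _; rewrite lee_fin sqr_ge0.
  - by apply/measurable_EFinP; exact: measurable_funX.
  - by move=> w _; rewrite lee_fin sqr_ge0.
  - by apply/measurable_EFinP; exact: measurable_funX.
  have h1 := stopped_sqr_le hB hT aX (ltW t0).
  have h2 : (\int[P]_w (gridN s t N w ^+ 2)%:E <= t%:E)%E.
    apply: (le_trans (grid_sqr hB hT aX s0 (h0 N) N.+1)).
    rewrite mulrCA divff ?mulr1 ?pnatr_eq0//.
    by apply: (le_trans (leeD2r _ (stopped_sqr_le hB hT aX s0))); rewrite -EFinD lee_fin; lra.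
  apply: (le_trans (lee_wpmul2l _ (leeD h2 h1))) => //.
  by rewrite -EFinD -EFinM lee_fin; lra.
have cvgM : (\int[P]_w (M N w)%:E @[N --> \oo] --> \int[P]_w (0 : R)%:E)%E.
  apply: (@dominated_cvg _ _ _ P setT measurableT (fun N w => (M N w)%:E) (cst 0%E) (cst K%:E)) => //.
  - by move=> N; apply/measurable_EFinP.
  - move=> w _; apply/fine_cvgP; split; first exact: nearW.
    apply/cvgrPdist_lt => ep ep0.
    have [N0 hN] := grid_proc_cvg hB hT w s0 st ep0; exists N0 => // N /= N0N.
    rewrite sub0r normrN ger0_norm//; apply: (le_lt_trans _ (hN N N0N)).
    by rewrite /M ge_min lexx.
  - exact: finite_measure_integrable_cst.
  - by move=> N w _; rewrite /= lee_fin ger0_norm// /M ge_min lexx orbT.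
rewrite integral0 in cvgM.
have /fine_cvgP[fM /cvgrPdist_lt/(_ (e / 2))] := cvgM.
rewrite divr_gt0// => /(_ isT) [N1 _ hN1].
have [N2 _ hN2] := fM.
exists (maxn N1 N2) => N; rewrite geq_max => /andP[NN1 NN2].
apply: (@le_trans _ _ (\int[P]_w ((M N w)%:E + K^-1%:E * (D N w ^+ 2)%:E))%E).
  apply: ge0_le_integral => //.
  - by apply/measurable_EFinP; apply: measurableT_comp => //; exact: mD.
  - apply: emeasurable_funD; first exact/measurable_EFinP.
    by apply: emeasurable_funM => //; apply/measurable_EFinP; exact: measurable_funX.
  - move=> w _; rewrite -EFinM -EFinD lee_fin -/(D N w) /M.
    have [DK|DK] := leP `|D N w| K.
      by rewrite lerDl mulr_ge0 ?sqr_ge0// invr_ge0 ltW.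
    apply: (@le_trans _ _ (K^-1 * D N w ^+ 2)); last by rewrite lerDr ltW.
    rewrite mulrC ler_pdivlMr// -[D N w ^+ 2]real_normK ?num_real// expr2.
    by rewrite ler_wpM2l// ltW.
rewrite ge0_integralD//; last 4 first.
- by move=> w _; rewrite lee_fin.
- exact/measurable_EFinP.
- by move=> w _; rewrite -EFinM lee_fin mulr_ge0 ?sqr_ge0// invr_ge0 ltW.
- by apply: emeasurable_funM => //; apply/measurable_EFinP; exact: measurable_funX.
rewrite ge0_integralZl//; last 3 first.
- by apply/measurable_EFinP; exact: measurable_funX.
- by move=> w _; rewrite lee_fin sqr_ge0.
- by rewrite lee_fin invr_ge0 ltW.
have K10 : (0 <= K^-1%:E)%E by rewrite lee_fin invr_ge0 ltW.
apply: (le_trans (leeD2l _ (lee_wpmul2l K10 (sqrle N)))).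
have := hN1 N NN1; have fN := hN2 N NN2; rewrite /= sub0r normrN => h.
rewrite -(fineK fN) -EFinM -EFinD lee_fin.
have : K^-1 * (4 * t) <= e / 2.
  rewrite mulrC ler_pdivrMr// /K.
  have -> : e / 2 * (8 * t / e + 1) = 4 * t + e / 2 by field; rewrite gt_eqF.
  by rewrite lerDl divr_ge0// ltW.
have := ler_norm (fine (\int[P]_w (M N w)%:E)%E); lra.
Qed.

End tanaka.

(** * Adaptedness of a stopped increasing process *)

Section stopped_monotone.
Context {R : realType} {d : measure_display} {T : measurableType d}.
Variables (Filt : R -> set (set T)) (tau : T -> \bar R).
Hypothesis hF : filtration Filt.
Hypothesis hT : stopping_time Filt tau.

(** [Filt t] is a bare family of sets, so the passage from rays to Borel sets uses minimality of the
    generated sigma-algebra directly. *)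
Lemma filt_preimage_rays (t : R) (f : T -> R) : 0 <= t ->
  (forall c, Filt t [set w | c < f w]) -> forall U, measurable U -> Filt t (f @^-1` U).
Proof.
move=> t0 hc U mU'.
have mU1 : (RGenOInfty.G (R:=R)).-sigma.-measurable U.
  by rewrite -RGenOInfty.measurableE; exact: mU'.
have mU : smallest (sigma_algebra setT) (@RGenOInfty.G R) U := mU1.
apply: (mU [set U | Filt t (f @^-1` U)]); split.
- split => /=.
  + by rewrite preimage_set0; exact: (filt_set0 hF).
  + by move=> A fA; rewrite setTD preimage_setC; exact: (filt_setC hF).
  + by move=> A fA; rewrite preimage_bigcup; exact: (filt_bigcup hF).
- move=> _ [c ->] /=; rewrite (_ : _ @^-1` _ = [set w | c < f w])//.
  by apply/seteqP; split=> w /=; rewrite in_itv/= andbT.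
Qed.

(** For continuous increasing [Y], the stopped value exceeds [c] iff [Y] does so at [0], or at [t]
    with [t < tau], or at some rational time of [[0, t]] before [tau]. This is a countable union of
    events known at time [t]. *)
Lemma stopped_adapted (Y : R -> T -> R) :
  adapted Filt Y -> (forall w, {within `[0, +oo[, continuous (fun t => Y t w)}) ->
  (forall w, {in `[0, +oo[ &, {homo (fun t => Y t w) : x y / x <= y}}) ->
  adapted Filt (stopped Y tau).
Proof.
move=> aY cY ndY t t0; apply: (filt_preimage_rays t0) => c.
have tau0 w : (0 <= tau w)%E by exact: hT.1.
have nd w x y : 0 <= x -> x <= y -> Y x w <= Y y w.
  by move=> x0 xy; apply: ndY => //; rewrite in_itv/= ?x0 ?(le_trans x0).
have fY q : 0 <= q -> q <= t -> Filt t [set w | c < Y q w].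
  move=> q0 qt; apply: (filt_mono hF q0 qt).
  have := aY q q0 `]c, +oo[%classic (measurable_itv _).
  by rewrite (_ : _ @^-1` _ = [set w | c < Y q w])//; apply/seteqP; split=> w /=; rewrite in_itv/= andbT.
have fE q : 0 <= q -> q <= t -> Filt t ([set w | (q%:E < tau w)%E] `&` [set w | c < Y q w]).
  move=> q0 qt; apply: (filt_setI hF) => //; last exact: fY.
  apply: (filt_mono hF q0 qt).
  rewrite (_ : [set _ | _] = ~` [set w | (tau w <= q%:E)%E]).
    by apply: (filt_setC hF) => //; exact: hT.2.
  by apply/seteqP; split=> w /=; rewrite ltNge => /negP.
(* An enumeration of the rationals; codes of no rational give the admissible value [0]. *)
pose q n : R := ratr (odflt 0 (unpickle n) : rat).
pose En n := if (0 <= q n) && (q n <= t) then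
  [set w | ((q n)%:E < tau w)%E] `&` [set w | c < Y (q n) w] else set0.
have -> : [set w | c < stopped Y tau t w] =
   ([set w | c < Y 0 w] `|` ([set w | (t%:E < tau w)%E] `&` [set w | c < Y t w])) `|` \bigcup_n En n.
  apply/seteqP; split => w /=.
    rewrite /stopped -/(clip _ _) => hw.
    have [ttau|ttau] := ltP t%:E (tau w).
      by left; right; rewrite clip_lt in hw.
    have te := clip_ge (tau0 w) ttau; set u := clip (tau w) t in te hw.
    have u0 : 0 <= u by exact: clip_ge0.
    move: (u0); rewrite le_eqVlt => /predU1P[u00|u1]; first by left; left; rewrite u00.
    have ec : 0 < Y u w - c by rewrite subr_gt0.
    have [dl dl0 hdl] := halfline_continuous_eps (cY w) u0 ec.
    have mlt : Num.max 0 (u - dl) < u by rewrite gt_max u1 gtrBl.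
    have [x] := rat_in_itvoo mlt; rewrite in_itv/= gt_max => /andP[/andP[x0 xdl] xu].
    right; exists (pickle x) => //.
    have qx : q (pickle x) = ratr x by rewrite /q pickleK.
    have ut : u <= t by exact: clip_le_id.
    rewrite /En qx (ltW x0) (ltW (lt_le_trans xu ut)); split => /=.
      by rewrite te lte_fin.
    have := hdl (ratr x) (ltW x0); rewrite distrC gtr0_norm ?subr_gt0//.
    have h : u - ratr x < dl by lra.
    by move=> /(_ h); rewrite ltr_norml; lra.
  rewrite /stopped -/(clip _ _).
  move=> [[h|[h1 h2]]|[n _]].
  - by apply: lt_le_trans h _; apply: nd => //; exact: clip_ge0.
  - by rewrite clip_lt.
  - rewrite /En; case: ifP => // /andP[q0 qt] [/= h1 h2].
    apply: lt_le_trans h2 _; apply: nd => //.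
    by rewrite -[leLHS](clip_lt h1); exact: clip_mono.
apply: (filt_setU hF) => //.
  by apply: (filt_setU hF) => //; [exact: fY|exact: fE].
apply: (filt_bigcup hF) => // n; rewrite /En; case: ifP => [/andP[q0 qt]|_].
  exact: fE.
exact: (filt_set0 hF).
Qed.

End stopped_monotone.

(** * Tanaka's inequality for the stopped process *)

Section tanaka.
Context {R : realType} {d : measure_display} {T : measurableType d}.
Variables (P : probability T R) (Filt : R -> set (set T)) (B L : R -> T -> R).
Variable tau : T -> \bar R.
Hypothesis hB : brownian_motion P Filt B.
Hypothesis hL : local_time_at0 P Filt B L.
Hypothesis hT : stopping_time Filt tau.
Hypothesis aX : adapted Filt (stopped B tau).

Let hF : filtration Filt. Proof. by case: hB. Qed.
Let tau0 w : (0 <= tau w)%E. Proof. exact: hT.1. Qed.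
Let mX (t : R) : 0 <= t -> measurable_fun setT (stopped B tau t).
Proof. exact: (adapted_measurable hF aX). Qed.

Lemma stopped_local_time_adapted : adapted Filt (stopped L tau).
Proof. by case: hL => aL _ cL ndL _; exact: (stopped_adapted hF hT). Qed.

Lemma measurable_stopped_local_time (t : R) : 0 <= t -> measurable_fun setT (stopped L tau t).
Proof. exact: (adapted_measurable hF stopped_local_time_adapted). Qed.

Lemma local_time_mono w (x y : R) : 0 <= x -> x <= y -> L x w <= L y w.
Proof.
case: hL => _ _ _ ndL _ x0 xy; apply: ndL => //.
  by rewrite in_itv/= x0.
by rewrite in_itv/= (le_trans x0 xy).
Qed.

Lemma stopped_local_time_mono w (s t : R) : 0 <= s -> s <= t ->
  stopped L tau s w <= stopped L tau t w.
Proof.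
by move=> s0 st; apply: local_time_mono; [exact: clip_ge0|exact: clip_mono].
Qed.

Lemma stopped_local_time_ge0 w (t : R) : 0 <= t -> 0 <= stopped L tau t w.
Proof.
move=> t0; case: (hL) => _ L0 _ _ _; rewrite -(L0 w).
by apply: local_time_mono => //; exact: clip_ge0.
Qed.

Let weight_sum (s t e r : R) (N : nat) (w : T) : R :=
  \sum_(i < N.+1) ((t - s) / N.+1%:R) *
     (if ((s + i%:R * ((t - s) / N.+1%:R))%:E < tau w)%E
      then near0_weight e r (B (s + i%:R * ((t - s) / N.+1%:R)) w) else 0).

Let measurable_weight_sum (s t e r : R) N : 0 <= s -> s < t ->
  measurable_fun setT (weight_sum s t e r N).
Proof.
move=> s0 st; apply: measurable_sum => i; apply: measurable_funM => //.
have tt0 : 0 <= s + i%:R * ((t - s) / N.+1%:R).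
  by rewrite addr_ge0// mulr_ge0// divr_ge0// subr_ge0 ltW.
apply: measurable_fun_ifT => //; first exact: (measurable_tau_gt hB hT).
apply: measurableT_comp; first exact: measurable_near0_weight.
exact: (bm_measurable hB).
Qed.

Let weight_sum_ge0 (s t e r : R) N w : 0 < r -> s < t -> 0 <= weight_sum s t e r N w.
Proof.
move=> r0 st; apply: sumr_ge0 => i _; apply: mulr_ge0.
  by rewrite divr_ge0// subr_ge0 ltW.
by case: ifP => // _; exact: near0_weight_ge0.
Qed.

(** With [k ^+ 2 = 1] this is the positive part for [k = 1] and the negative part for [k = -1], so
    both are treated at once. *)
Let pos (k x : R) : R := Num.max (k * x) 0.
Let pos_ge0 k x : 0 <= pos k x. Proof. by rewrite le_max lexx orbT. Qed.
Let measurable_pos k : measurable_fun setT (pos k).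
Proof. by apply: measurable_maxr => //; exact: mulrl_measurable. Qed.

(** Fatou's lemma as the mesh vanishes: the left side keeps the lower limit of the occupation sums,
    and on the right convergence in mean replaces the grid process. The term [r] is the distance
    between [smooth_pos r] and the positive part. *)
Lemma tanaka_smooth (s t e r k : R) (A : set T) : 0 <= s -> s < t -> 0 < e -> e < r ->
  k ^+ 2 = 1 -> Filt s A ->
  (\int[P]_(w in A) ((pos k (stopped B tau s w))%:E +
      limn_einf (fun N => (weight_sum s t e r N w)%:E)) <=
   \int[P]_(w in A) (pos k (stopped B tau t w))%:E + r%:E)%E.
Proof.
move=> s0 st e0 er k2 fA.
have r0 : 0 < r by exact: lt_trans er.
have t0 : 0 <= t by lra.
have ts0 : 0 < t - s by rewrite subr_gt0.
have mA : measurable A by exact: (filt_measurable hF s0).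
pose f x := smooth_pos r (k * x).
pose c := (4 * r * (r - e) ^+ 2)^-1.
have c0 : 0 <= c.
  by rewrite invr_ge0; apply: mulr_ge0; [apply: mulr_ge0 => //; exact: ltW|exact: sqr_ge0].
have mf : measurable_fun setT f.
  by apply: measurableT_comp; [exact: measurable_smooth_pos|exact: mulrl_measurable].
have hf x z : f x + (k * smooth_pos_slope r (k * x)) * z + near0_weight e r x * z ^+ 2 <=
    f (x + z) + c * z ^+ 4.
  have := smooth_pos_quadratic (k * x) (k * z) e0 er; rewrite -/c.
  have -> : near0_weight e r (k * x) = near0_weight e r x.
    rewrite /near0_weight normrM; have -> : `|k| = 1; last by rewrite mul1r.
    by apply/eqP; rewrite -(@eqrXn2 _ 2)// ?expr1n ?real_normK ?num_real// k2.
  have -> : (k * z) ^+ 4 = z ^+ 4 by rewrite exprMn (exprM k 2 2) k2 expr1n mul1r.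
  have -> : (k * z) ^+ 2 = z ^+ 2 by rewrite exprMn k2 mul1r.
  by rewrite /f mulrDr [k * smooth_pos_slope _ _]mulrC -mulrA.
have f0 x : 0 <= f x by exact: smooth_pos_ge0.
have mgrid N : measurable_fun setT (grid_proc B tau s ((t - s) / N.+1%:R) N.+1).
  apply: (measurable_grid_proc hB hT aX) => //.
  by rewrite divr_gt0.
have mXt := mX t0; have mXs := mX s0.
pose D N w : R := `|grid_proc B tau s ((t - s) / N.+1%:R) N.+1 w - stopped B tau t w|.
have D0 N w : 0 <= D N w by exact: normr_ge0.
have mD N : measurable_fun setT (D N).
  by apply: measurableT_comp => //; exact: measurable_funB.
have mliminf : measurable_fun A (fun w => limn_einf (fun N => (weight_sum s t e r N w)%:E)).
  apply: measurable_limn_einf => N; apply/measurable_EFinP; apply: measurable_funTS.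
  exact: measurable_weight_sum.
apply: (@fatou_le _ _ _ _ _ (fun N w => (f (stopped B tau s w) + weight_sum s t e r N w)%:E)) => //.
- move=> N; apply/measurable_EFinP; apply: measurable_funTS; apply: measurable_funD.
    exact: measurableT_comp.
  exact: measurable_weight_sum.
- by move=> N w; rewrite lee_fin addr_ge0// weight_sum_ge0.
- apply: emeasurable_funD => //; apply/measurable_EFinP; apply: measurable_funTS.
  exact: measurableT_comp.
- move=> w _; rewrite adde_ge0 ?lee_fin//; apply: limn_einf_ge0 => N.
  by rewrite lee_fin weight_sum_ge0.
- apply: aeW => w _; rewrite -limn_einf_shift//; apply: limn_einf_mono => N.
  rewrite -EFinD lee_fin lerD2r; exact: smooth_pos_ge.
- apply: limn_einf_le => e1 e10 N0.
  have e20 : 0 < e1 / 2 by rewrite divr_gt0.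
  have [N1 hN1] := grid_proc_L1 hB hT aX s0 st e20.
  (* The [N.+1] steps together lose [K / N.+1%:R]. *)
  pose K := 64 * c * (t - s) ^+ 2.
  have K0 : 0 <= K by apply: mulr_ge0; [exact: mulr_ge0|exact: sqr_ge0].
  pose N2 := Num.truncn (K / (e1 / 2)).
  exists (maxn N0 (maxn N1 N2)); first exact: leq_maxl.
  set N := maxn N0 _.
  have NN1 : (N1 <= N)%N by rewrite !leq_max leqnn orbT.
  have NN2 : (N2 <= N)%N by rewrite !leq_max leqnn !orbT.
  have h0 : 0 < (t - s) / N.+1%:R by rewrite divr_gt0.
  have N0' : 0 < N.+1%:R :> R by rewrite ltr0n.
  apply: (le_trans (grid_lower hB hT aX s0 h0 N.+1 fA mf
    (measurable_near0_weight e r) f0 (fun x => near0_weight_ge0 e x r0) c0 hf)).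
  have -> : N.+1%:R * (64 * c * ((t - s) / N.+1%:R) ^+ 2) = K / N.+1%:R.
    by rewrite /K; field; rewrite gt_eqF// addrC natr1.
  have KN : K / N.+1%:R <= e1 / 2.
    rewrite ler_pdivrMr// mulrC -ler_pdivrMr//.
    have /andP[_ h] := truncn_itv (divr_ge0 K0 (ltW e20)).
    by apply: (le_trans (ltW h)); rewrite ler_nat.
  apply: (@le_trans _ _ (\int[P]_(w in A) ((pos k (stopped B tau t w))%:E + (r%:E + (D N w)%:E))
     + (e1 / 2)%:E)%E).
    apply: leeD; last by rewrite lee_fin.
    apply: ge0_le_integral => //.
    - by move=> w _; rewrite lee_fin.
    - by apply/measurable_EFinP; apply: measurable_funTS; exact: measurableT_comp.
    - apply: emeasurable_funD.
        by apply/measurable_EFinP; apply: measurable_funTS; exact: measurableT_comp.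
      by apply: emeasurable_funD => //; apply/measurable_EFinP; exact: measurable_funTS.
    - move=> w _; rewrite -!EFinD lee_fin.
      set y := grid_proc _ _ _ _ _ _.
      have h1 := smooth_pos_lipschitz (k * stopped B tau t w) (k * y) r0.
      have h2 := smooth_pos_le (k * stopped B tau t w) r0.
      have h3 : `|k * y - k * stopped B tau t w| = D N w.
        rewrite -mulrBr normrM; have -> : `|k| = 1; last by rewrite mul1r.
        by apply/eqP; rewrite -(@eqrXn2 _ 2)// ?expr1n ?real_normK ?num_real// k2.
      by rewrite h3 in h1; rewrite /f /pos; lra.
  rewrite ge0_integralD//; last 4 first.
  - by move=> w _; rewrite lee_fin.
  - by apply/measurable_EFinP; apply: measurable_funTS; exact: measurableT_comp.
  - by move=> w _; rewrite -EFinD lee_fin addr_ge0// ?D0// ltW.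
  - by apply: emeasurable_funD => //; apply/measurable_EFinP; exact: measurable_funTS.
  rewrite -[leLHS]addeA -[leRHS]addeA; apply: leeD2l.
  rewrite (@ge0_integralD _ _ _ P A mA (cst r%:E) (fun w => (D N w)%:E))//; last 3 first.
  - by move=> w _; rewrite lee_fin; exact: ltW.
  - by move=> w _; rewrite lee_fin; exact: D0.
  - by apply/measurable_EFinP; exact: measurable_funTS.
  rewrite -[leLHS]addeA; apply: leeD.
    rewrite integral_cst// -[leRHS]mule1 lee_wpmul2l ?lee_fin ?(ltW r0)//.
    exact: probability_le1.
  rewrite [e1 in leRHS](splitr e1) EFinD leeD2r//.
  apply: le_trans (hN1 N NN1); apply: ge0_subset_integral => //.
  by apply/measurable_EFinP; exact: mD.
by move=> w _; rewrite lee_fin; exact: D0.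
Qed.

(** With [r = e * (1 + e)], the factor [(4 * r)^-1] is [2^-1 * (1 + e)^-1] times the normalisation
    [(2 * e)^-1] of the local time. Hence the occupation term tends to half the increase of [L], and
    the error [r] vanishes. *)
Lemma tanaka_le (s t k : R) (A : set T) : 0 <= s -> s < t -> k ^+ 2 = 1 -> Filt s A ->
  (\int[P]_(w in A) (Num.max (k * stopped B tau s w) 0 +
      2^-1 * (stopped L tau t w - stopped L tau s w))%:E <=
   \int[P]_(w in A) (Num.max (k * stopped B tau t w) 0)%:E)%E.
Proof.
move=> s0 st k2 fA.
have t0 : 0 <= t by lra.
have mA : measurable A by exact: (filt_measurable hF s0).
pose e (n : nat) : R := n.+1%:R^-1.
have e0 n : 0 < e n by rewrite invr_gt0.
have e1 n : e n <= 1 by rewrite invf_le1// ler1n.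
pose r n := e n * (1 + e n).
have er n : e n < r n by rewrite /r ltr_pMr// ltrDl.
have r0 n : 0 < r n by exact: lt_trans (er n).
have small (x : R) : 0 < x -> exists N0 : nat, forall n, (N0 <= n)%N -> e n < x.
  move=> x0; exists (Num.truncn x^-1) => n hn.
  have xV : 0 < x^-1 by rewrite invr_gt0.
  have /andP[_ h] := truncn_itv (ltW xV).
  rewrite /e invf_plt ?posrE//; apply: (lt_le_trans h); by rewrite ler_nat.
have mliminf n : measurable_fun A (fun w => limn_einf (fun N => (weight_sum s t (e n) (r n) N w)%:E)).
  apply: measurable_limn_einf => N; apply/measurable_EFinP; apply: measurable_funTS.
  exact: measurable_weight_sum.
have mXs := mX s0.
have liminf0 n w : (0 <= limn_einf (fun N => (weight_sum s t (e n) (r n) N w)%:E))%E.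
  by apply: limn_einf_ge0 => N; rewrite lee_fin weight_sum_ge0.
apply: (@fatou_le _ _ _ _ _ (fun n w => ((pos k (stopped B tau s w))%:E +
      limn_einf (fun N => (weight_sum s t (e n) (r n) N w)%:E))%E)) => //.
- move=> n; apply: emeasurable_funD => //; apply/measurable_EFinP; apply: measurable_funTS.
  exact: measurableT_comp.
- by move=> n w; rewrite adde_ge0// lee_fin.
- apply/measurable_EFinP; apply: measurable_funTS; apply: measurable_funD.
    exact: (measurableT_comp (measurable_pos k)).
  apply: measurable_funM => //; apply: measurable_funB; exact: measurable_stopped_local_time.
- move=> w _; rewrite lee_fin addr_ge0//; first exact: pos_ge0.
  by rewrite mulr_ge0// subr_ge0 stopped_local_time_mono// ltW.
(* The exceptional null set does not depend on the time, so the occupation limit may be taken at the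
   random times [tp] and [sp]. *)
- case: (hL) => _ _ _ _; apply: filterS => w hw _.
  apply: limn_einf_ge => ep ep0.
  set tp := clip (tau w) t; set sp := clip (tau w) s.
  have tp0 : 0 <= tp by exact: clip_ge0.
  have sp0 : 0 <= sp by exact: clip_ge0.
  have ep2 : 0 < ep / 2 by rewrite divr_gt0.
  have /cvgrPdist_lt /(_ _ ep2) [d1 /= d10 hd1] := hw tp tp0.
  have /cvgrPdist_lt /(_ _ ep2) [d2 /= d20 hd2] := hw sp sp0.
  set Dl := L tp w - L sp w.
  have Dl0 : 0 <= Dl by rewrite subr_ge0 local_time_mono// clip_mono// ltW.
  (* The last bound gives [e n * Dl <= ep], so that division by [1 + e n] costs no more than another
     [ep]. *)
  have x0 : 0 < Num.min (Num.min d1 d2) (ep / (Dl + 1)).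
    by rewrite !lt_min d10 d20 divr_gt0// ltr_wpDl.
  have [N0 hN0] := small _ x0; exists N0 => n /hN0; rewrite !lt_min => /andP[/andP[ed1 ed2] edl].
  have := hd1 (e n); rewrite /= sub0r normrN gtr0_norm// => /(_ ed1 (e0 n)) h1.
  have := hd2 (e n); rewrite /= sub0r normrN gtr0_norm// => /(_ ed2 (e0 n)) h2.
  have cB : {within `[0, +oo[, continuous (fun t => B t w)} by case: hB.
  have := occupation_le_liminf cB (tau0 w) s0 st (e0 n) (r0 n).
  rewrite -/tp -/sp => h3.
  rewrite -addeA EFinD -/(pos k _) leeD2l//.
  apply: le_trans (leeD2r _ h3); rewrite -EFinD lee_fin.
  change (2^-1 * Dl <= (4 * r n)^-1 *
    (occupation B tp w (e n) - occupation B sp w (e n)) + ep).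
  set a := (2 * e n)^-1 * occupation B tp w (e n) in h1.
  set b := (2 * e n)^-1 * occupation B sp w (e n) in h2.
  have -> : (4 * r n)^-1 * (occupation B tp w (e n) - occupation B sp w (e n)) =
     2^-1 * ((1 + e n)^-1 * (a - b)).
    by rewrite /a /b /r; field; rewrite !gt_eqF// ltr_wpDl// ltW.
  have e1p : 0 < 1 + e n by rewrite ltr_wpDl// ltW.
  have ab : Dl - ep <= a - b.
    by move: h1 h2; rewrite !ltr_norml /Dl => /andP[? ?] /andP[? ?]; lra.
  have eD : e n * Dl <= ep.
    have Dl1 : 0 < Dl + 1 by rewrite ltr_wpDl.
    move: edl; rewrite ltr_pdivlMr// mulrDr mulr1 => h; have := e0 n; lra.
  have : (1 + e n)^-1 * (a - b) >= Dl - 2 * ep.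
    rewrite [leRHS]mulrC ler_pdivlMr//; have := mulr_ge0 (ltW (e0 n)) (ltW ep0); nra.
  by lra.
- apply: limn_einf_le => ep ep0 N.
  have ep2 : 0 < ep / 2 by rewrite divr_gt0.
  have [N0 hN0] := small _ ep2; exists (maxn N N0); first exact: leq_maxl.
  set n := maxn N N0; have en : e n < ep / 2 by apply: hN0; exact: leq_maxr.
  apply: (le_trans (tanaka_smooth s0 st (e0 n) (er n) k2 fA)).
  rewrite leeD2l// lee_fin /r; have := e1 n; have := e0 n; nra.
Qed.

End tanaka.

(** * Weighted Tanaka inequality *)

Section layer_cake.
Context {R : realType} {d : measure_display} {T : measurableType d}.
Variable P : probability T R.
Notation mu := (@lebesgue_measure R).

(** Tonelli's theorem after writing [xi w] as the length of [[0, xi w[]; the guard [0 <= c] is there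
    because [c] runs over the whole line. *)
Lemma ge0_integral_layer (xi U : T -> R) : measurable_fun setT xi -> measurable_fun setT U ->
  (forall w, 0 <= xi w) -> (forall w, 0 <= U w) ->
  (\int[P]_w (xi w * U w)%:E =
   \int[mu]_c if (0 <= c)%R then \int[P]_(w in [set w | (c < xi w)%R]) (U w)%:E else 0)%E.
Proof.
move=> mxi mU xi0 U0.
pose phi (q : T * measurableTypeR R) : \bar R :=
  if (0 <= q.2) && (q.2 < xi q.1) then (U q.1)%:E else 0%E.
have mphi : measurable_fun setT phi.
  apply: measurable_fun_ifT => //.
  - apply: measurable_and.
      by apply: measurable_fun_ler => //; exact: measurable_snd.
    apply: measurable_fun_ltr; first exact: measurable_snd.
    by apply: (measurableT_comp mxi); exact: measurable_fst.
  - by apply/measurable_EFinP; apply: (measurableT_comp mU); exact: measurable_fst.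
have phi0 q : (0 <= phi q)%E by rewrite /phi; case: ifP => // _; rewrite lee_fin.
transitivity (\int[P]_w \int[mu]_c phi (w, c))%E; last first.
  rewrite (@fubini_tonelli _ _ _ _ _ P mu phi mphi phi0).
  apply: eq_integral => c _; rewrite /phi /=; case: ifP => c0 /=; last by rewrite integral0.
  rewrite [RHS]integral_mkcond; apply: eq_integral => w _; rewrite patchE.
  by case: ifPn => h; [rewrite mem_set|rewrite memNset//; exact/negP].
apply: eq_integral => w _; rewrite /phi /=.
transitivity (\int[mu]_c ((U w)%:E * (\1_(`[0%R, xi w[%classic : set R) c)%:E))%E; last first.
  apply: eq_integral => c _; rewrite indicE.
  case: ifPn => [/andP[c0 cx]|nc].
    by rewrite mem_set ?mule1//= in_itv/= c0.
  by rewrite memNset ?mule0//= in_itv/=; exact/negP.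
rewrite ge0_integralZl//; last by rewrite lee_fin.
rewrite integral_indic//= setIT.
have -> : mu (`[0%R, xi w[%classic : set R) = (xi w)%:E.
  rewrite lebesgue_measure_itv/= lte_fin; case: ltP => h; first by rewrite -EFinB subr0.
  by congr EFin; apply/eqP; rewrite eq_le h xi0.
by rewrite -EFinM mulrC.
by apply/measurable_EFinP; exact: measurable_indic.
Qed.

(** A nonnegative weight is a mixture of indicators of the sets where [c < xi]. For [xi] known at
    time [s] these are past events, on which Tanaka's inequality is available. *)
Lemma ge0_integral_weight_le (xi U V : T -> R) : measurable_fun setT xi ->
  measurable_fun setT U -> measurable_fun setT V ->
  (forall w, 0 <= xi w) -> (forall w, 0 <= U w) -> (forall w, 0 <= V w) ->
  (forall c : R, (0 <= c)%R -> \int[P]_(w in [set w | (c < xi w)%R]) (U w)%:E <=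
                 \int[P]_(w in [set w | (c < xi w)%R]) (V w)%:E)%E ->
  (\int[P]_w (xi w * U w)%:E <= \int[P]_w (xi w * V w)%:E)%E.
Proof.
move=> mxi mU mV xi0 U0 V0 h.
have meas (W : T -> R) : measurable_fun setT W -> (forall w, 0 <= W w) ->
  measurable_fun setT (fun c : measurableTypeR R => if (0 <= c)%R then
    (\int[P]_(w in [set w | (c < xi w)%R]) (W w)%:E)%E else 0%E).
  move=> mW W0; apply: measurable_fun_ifT => //; first exact: measurable_fun_ler.
  pose phi (q : T * measurableTypeR R) : \bar R :=
    if (q.2 < xi q.1) then (W q.1)%:E else 0%E.
  have mphi : measurable_fun setT phi.
    apply: measurable_fun_ifT => //.
    - apply: measurable_fun_ltr; first exact: measurable_snd.
      by apply: (measurableT_comp mxi); exact: measurable_fst.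
    - by apply/measurable_EFinP; apply: (measurableT_comp mW); exact: measurable_fst.
  have phi0 q : (0 <= phi q)%E by rewrite /phi; case: ifP => // _; rewrite lee_fin.
  rewrite (_ : (fun c => _) = fubini_G P phi).
    exact: measurable_fun_fubini_tonelli_G.
  apply/funext => c; rewrite /fubini_G [LHS]integral_mkcond; apply: eq_integral => w _.
  by rewrite patchE /phi /=; case: ifPn => hc;
    [rewrite ifT//; exact: set_mem hc|rewrite ifF//; apply/negP => hc'; move/negP: hc; apply; exact: mem_set].
rewrite !ge0_integral_layer//; apply: ge0_le_integral => //.
- by move=> c _; case: ifP => // _; apply: integral_ge0 => w _; rewrite lee_fin.
- exact: meas.
- exact: meas.
- by move=> c _; case: ifP => // c0; exact: h.
Qed.

End layer_cake.

Section discrete_bound.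
Context {R : realType} {d : measure_display} {T : measurableType d}.
Variables (P : probability T R) (Filt : R -> set (set T)) (B L : R -> T -> R).
Variable tau : T -> \bar R.
Hypothesis hB : brownian_motion P Filt B.
Hypothesis hL : local_time_at0 P Filt B L.
Hypothesis hT : stopping_time Filt tau.
Hypothesis aX : adapted Filt (stopped B tau).

Let hF : filtration Filt. Proof. by case: hB. Qed.
Let tau0 w : (0 <= tau w)%E. Proof. exact: hT.1. Qed.
Let mX (t : R) : 0 <= t -> measurable_fun setT (stopped B tau t).
Proof. exact: (adapted_measurable hF aX). Qed.
Let X := stopped B tau.
Let l := stopped L tau.
Let ml (t : R) : 0 <= t -> measurable_fun setT (l t).
Proof. exact: (measurable_stopped_local_time hB hL hT). Qed.
Let al : adapted Filt l. Proof. exact: (stopped_local_time_adapted hB hL hT). Qed.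
Let pos (k x : R) : R := Num.max (k * x) 0.
Let pos_ge0 k x : 0 <= pos k x. Proof. by rewrite le_max lexx orbT. Qed.
Let measurable_posX k (t : R) : 0 <= t -> measurable_fun setT (fun w => pos k (X t w)).
Proof.
move=> t0; apply: (@measurableT_comp _ _ _ _ _ _ (pos k)); last exact: mX.
by apply: measurable_maxr => //; exact: mulrl_measurable.
Qed.

Section weight.
Variable a : R -> R.
Hypotheses (nda : {homo a : x y / x <= y}) (a0 : forall x, 0 <= a x).

Let mal (t : R) : 0 <= t -> measurable_fun setT (fun w => a (l t w)).
Proof. by move=> t0; apply: measurableT_comp (ml t0); exact: nondecreasing_measurable. Qed.

Lemma weighted_tanaka_le (s t k : R) : 0 <= s -> s < t -> k ^+ 2 = 1 ->
  (\int[P]_w (a (l s w) * (pos k (X s w) + 2^-1 * (l t w - l s w)))%:E <=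
   \int[P]_w (a (l s w) * pos k (X t w))%:E)%E.
Proof.
move=> s0 st k2; have t0 : 0 <= t by lra.
apply: ge0_integral_weight_le => //.
- exact: mal.
- apply: measurable_funD; first exact: measurable_posX.
  by apply: measurable_funM => //; apply: measurable_funB; exact: ml.
- exact: measurable_posX.
- move=> w; rewrite addr_ge0// mulr_ge0// subr_ge0.
  by apply: (stopped_local_time_mono hL hT) => //; exact: ltW.
- move=> c _; apply: (tanaka_le hB hL hT aX) => //.
  have : measurable [set x | c < a x].
    have ma : measurable_fun setT a by exact: nondecreasing_measurable.
    have := @measurable_fun_ltr _ _ R setT (cst c) a (measurable_cst _) ma.
    by move=> /(_ measurableT [set true]) /(_ I); rewrite setTI; apply.
  exact: (al s0).
Qed.

Lemma weighted_submartingale (s t k : R) : 0 <= s -> s < t -> k ^+ 2 = 1 ->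
  (\int[P]_w (a (l s w) * pos k (X s w))%:E <= \int[P]_w (a (l s w) * pos k (X t w))%:E)%E.
Proof.
move=> s0 st k2; have t0 : 0 <= t by lra.
apply: le_trans (weighted_tanaka_le s0 st k2).
have D0 w : 0 <= 2^-1 * (l t w - l s w).
  by rewrite mulr_ge0// subr_ge0; apply: (stopped_local_time_mono hL hT) => //; exact: ltW.
apply: ge0_le_integral => //.
- by move=> w _; rewrite lee_fin mulr_ge0.
- apply/measurable_EFinP; apply: measurable_funM; [exact: mal|exact: measurable_posX].
- apply/measurable_EFinP; apply: measurable_funM; first exact: mal.
  apply: measurable_funD; first exact: measurable_posX.
  by apply: measurable_funM => //; apply: measurable_funB; exact: ml.
- by move=> w _; rewrite lee_fin ler_wpM2l// lerDl.
Qed.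

(** Summation by parts in the favourable direction: after each step the weight is raised to its
    value at the next grid time, which can only increase the right side. *)
Lemma grid_local_time_le (h k : R) n : 0 < h -> k ^+ 2 = 1 ->
  (\int[P]_w (\sum_(i < n) a (l (0 + i%:R * h) w) * (2^-1 * (l (0 + i.+1%:R * h) w - l (0 + i%:R * h) w)))%:E <=
   \int[P]_w (a (l (0 + n%:R * h) w) * pos k (X (0 + n%:R * h) w))%:E)%E.
Proof.
move=> h0 k2; set g := fun i : nat => 0 + i%:R * h.
have g0 i : 0 <= g i by rewrite /g add0r mulr_ge0// ltW.
have gS i : g i < g i.+1 by rewrite /g !add0r ltr_pM2r// ltr_nat.
have D0 i w : 0 <= 2^-1 * (l (g i.+1) w - l (g i) w).
  by rewrite mulr_ge0// subr_ge0; apply: (stopped_local_time_mono hL hT) => //; exact: ltW.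
have mD i : measurable_fun setT (fun w => a (l (g i) w) * (2^-1 * (l (g i.+1) w - l (g i) w))).
  apply: measurable_funM; first exact: mal.
  by apply: measurable_funM => //; apply: measurable_funB; exact: ml.
have mP i j : measurable_fun setT (fun w => a (l (g i) w) * pos k (X (g j) w)).
  by apply: measurable_funM; [exact: mal|exact: measurable_posX].
elim: n => [|n IH].
  under eq_integral do rewrite big_ord0.
  by rewrite integral0; apply: integral_ge0 => w _; rewrite lee_fin mulr_ge0.
under eq_integral do rewrite big_ord_recr /= EFinD.
rewrite ge0_integralD//; last 4 first.
- by move=> w _; rewrite lee_fin sumr_ge0// => i _; rewrite mulr_ge0//; exact: D0.
- by apply/measurable_EFinP; apply: measurable_sum => i; exact: mD.
- by move=> w _; rewrite lee_fin mulr_ge0//; exact: D0.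
- by apply/measurable_EFinP; exact: mD.
apply: (le_trans (leeD2r _ IH)).
rewrite -ge0_integralD//; last 4 first.
- by move=> w _; rewrite lee_fin mulr_ge0.
- by apply/measurable_EFinP; exact: mP.
- by move=> w _; rewrite lee_fin mulr_ge0//; exact: D0.
- by apply/measurable_EFinP; exact: mD.
under eq_integral do rewrite -EFinD -mulrDr.
apply: (le_trans (weighted_tanaka_le (g0 n) (gS n) k2)).
apply: ge0_le_integral => //.
- by move=> w _; rewrite lee_fin mulr_ge0.
- by apply/measurable_EFinP; exact: mP.
- by apply/measurable_EFinP; exact: mP.
- move=> w _; rewrite lee_fin ler_wpM2r//; apply: nda.
  by apply: (stopped_local_time_mono hL hT) => //; exact: ltW.
Qed.

End weight.

Lemma stopped_local_time_continuous w : {within `[0, +oo[, continuous (fun t => l t w)}.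
Proof.
have cL : {within `[0, +oo[, continuous (fun t => L t w)} by case: hL.
apply/subspace_continuousP => t; rewrite /= in_itv/= andbT => t0.
apply/cvgrPdist_lt => e e0.
have [dl dl0 h] := halfline_continuous_eps cL (clip_ge0 (tau0 w) t0) e0.
apply/nbhs_ballP; exists dl => //= x; rewrite /ball/= => tx; rewrite in_itv/= andbT => x0.
rewrite distrC; apply: h; first exact: clip_ge0.
apply: le_lt_trans tx; rewrite distrC -/(clip _ _) -/(clip _ _).
wlog xt : x t t0 x0 / x <= t.
  move=> W; have [xt|xt] := leP x t; first exact: W.
  by rewrite distrC [leRHS]distrC; apply: W => //; exact: ltW.
have h1 := clip_mono (tau0 w) xt; rewrite !ger0_norm ?subr_ge0//.
have [a|a] := ltP x%:E (tau w).
  by rewrite (clip_lt a); have := clip_le_id t (tau0 w); lra.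
have -> : clip (tau w) t = clip (tau w) x by rewrite !clip_fine// (le_trans a)// lee_fin.
lra.
Qed.

(** [Psi] of the local time telescopes over the grid and is dominated by left Riemann sums of
    [(a + b) / 2]. The errors are increments of [V (l)] times increments of [l], negligible because
    [l] is continuous. Two times occur since [t] stays tied to the truncation level while [m] later
    tends to infinity. *)
Lemma riemann_bound (a b Psi V : R -> R) (t m : R) :
  {homo a : x y / x <= y} -> (forall x, 0 <= a x) ->
  {homo b : x y / x <= y} -> (forall x, 0 <= b x) ->
  {homo V : x y / x <= y} -> measurable_fun setT Psi -> Psi 0 = 0 -> (forall x, 0 <= Psi x) ->
  (forall x y : R, 0 <= x -> x <= y ->
     Psi y - Psi x <= 2^-1 * (a x + b x) * (y - x) + (V y - V x) * (y - x)) ->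
  0 < t -> t < m ->
  (\int[P]_w (Psi (l t w))%:E <=
   \int[P]_w (a (l t w) * pos 1 (X m w) + b (l t w) * pos (-1) (X m w))%:E)%E.
Proof.
move=> nda a0 ndb b0 ndV mPsi Psi0 Psip hPsi t0 tm.
have m0 : 0 <= m by lra.
have l0 (s : R) w : 0 <= s -> 0 <= l s w by exact: (stopped_local_time_ge0 hL hT).
have lm w (s s' : R) : 0 <= s -> s <= s' -> l s w <= l s' w.
  by exact: (stopped_local_time_mono hL hT).
have l00 w : l 0 w = 0.
  rewrite /l /stopped -/(clip _ _).
  have -> : clip (tau w) 0 = 0 by apply/eqP; rewrite eq_le clip_le_id// clip_ge0.
  by case: hL.
have mab (c : R -> R) (s : R) : {homo c : x y / x <= y} -> 0 <= s -> measurable_fun setT (fun w => c (l s w)).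
  by move=> ndc s0; apply: measurableT_comp (ml s0); exact: nondecreasing_measurable.
pose S (c : R -> R) N w : R := \sum_(i < N.+1) c (l (0 + i%:R * (t / N.+1%:R)) w) *
   (2^-1 * (l (0 + i.+1%:R * (t / N.+1%:R)) w - l (0 + i%:R * (t / N.+1%:R)) w)).
have h0 N : 0 < t / N.+1%:R by rewrite divr_gt0.
have g0 N i : 0 <= 0 + i%:R * (t / N.+1%:R) by rewrite add0r mulr_ge0// ltW.
have gT N : 0 + N.+1%:R * (t / N.+1%:R) = t.
  by rewrite add0r mulrCA divff ?mulr1// pnatr_eq0.
have D0 N i w : 0 <= 2^-1 * (l (0 + i.+1%:R * (t / N.+1%:R)) w - l (0 + i%:R * (t / N.+1%:R)) w).
  by rewrite mulr_ge0// subr_ge0; apply: lm => //; rewrite !add0r ler_pM2r// ler_nat.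
have S0 (c : R -> R) N w : (forall x, 0 <= c x) -> 0 <= S c N w.
  by move=> c0; apply: sumr_ge0 => i _; rewrite mulr_ge0//; exact: D0.
have mS (c : R -> R) N : {homo c : x y / x <= y} -> measurable_fun setT (S c N).
  move=> ndc; apply: measurable_sum => i; apply: measurable_funM; first exact: mab.
  by apply: measurable_funM => //; apply: measurable_funB; exact: ml.
have mP (c : R -> R) (k s s' : R) : {homo c : x y / x <= y} -> 0 <= s -> 0 <= s' ->
    measurable_fun setT (fun w => c (l s w) * pos k (X s' w)).
  by move=> ndc s0 s0'; apply: measurable_funM; [exact: mab|exact: measurable_posX].
have bound (c : R -> R) (k : R) N : {homo c : x y / x <= y} -> (forall x, 0 <= c x) -> k ^+ 2 = 1 ->
   (\int[P]_w (S c N w)%:E <= \int[P]_w (c (l t w) * pos k (X m w))%:E)%E.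
  move=> ndc c0 k2; have := grid_local_time_le ndc c0 N.+1 (h0 N) k2; rewrite gT.
  by move=> /le_trans; apply; exact: (weighted_submartingale ndc c0 (ltW t0) tm k2).
apply: (@fatou_le _ _ _ _ _ (fun N w => (S a N w + S b N w)%:E)) => //.
- by move=> N; apply/measurable_EFinP; apply: measurable_funD; exact: mS.
- by move=> N w; rewrite lee_fin addr_ge0// S0.
- by apply/measurable_EFinP; apply: measurableT_comp (ml (ltW t0)).
- by move=> w _; rewrite lee_fin.
- apply: aeW => w _; apply: limn_einf_ge => e e0.
  have ndVl x y : 0 <= x -> x <= y -> y <= t -> V (l x w) <= V (l y w).
    by move=> x0 xy _; apply: ndV; exact: lm.
  have q0 : 0 < V (l t w) - V (l 0 w) + 1.
    by rewrite ltr_wpDl// subr_ge0; apply: ndV; apply: lm => //; exact: ltW.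
  have e'0 : 0 < e / (V (l t w) - V (l 0 w) + 1) by rewrite divr_gt0.
  have [N0 hN0] := grid_product_small t0 e'0 ndVl (@stopped_local_time_continuous w).
  exists N0 => N /hN0; set h := t / N.+1%:R => hq.
  rewrite -EFinD lee_fin.
  have := telescope_grid (fun s => Psi (l s w)) 0 h N.+1.
  rewrite gT l00 Psi0 subr0 => <-.
  apply: (@le_trans _ _ (\sum_(i < N.+1)
    (2^-1 * (a (l (0 + i%:R * h) w) + b (l (0 + i%:R * h) w)) * (l (0 + i.+1%:R * h) w - l (0 + i%:R * h) w) +
     (V (l (0 + i.+1%:R * h) w) - V (l (0 + i%:R * h) w)) * (l (0 + i.+1%:R * h) w - l (0 + i%:R * h) w)))).
    apply: ler_sum => i _; apply: hPsi; first by apply: l0; exact: g0.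
    by apply: lm; [exact: g0|rewrite !add0r ler_pM2r ?ler_nat//; exact: h0].
  rewrite big_split /=; apply: lerD.
    rewrite /S -big_split /=; apply: ler_sum => i _.
    by rewrite le_eqVlt; apply/orP; left; apply/eqP; rewrite -/h; ring.
  apply: (le_trans hq).
  rewrite mulrAC ler_pdivrMr// ler_pM2l//; lra.
- apply: limn_einf_le => e e0 N; exists N => //.
  apply: (@le_trans _ _ (\int[P]_w (S a N w + S b N w)%:E)%E) => //.
  under eq_integral do rewrite EFinD.
  rewrite ge0_integralD//; last 4 first.
  - by move=> w _; rewrite lee_fin S0.
  - by apply/measurable_EFinP; exact: mS.
  - by move=> w _; rewrite lee_fin S0.
  - by apply/measurable_EFinP; exact: mS.
  have h1 := bound a 1 N nda a0 (expr1n _ _).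
  have h2 := bound b (-1) N ndb b0 (sqrr_sign _ 1).
  apply: (le_trans (leeD h1 h2)).
  rewrite -ge0_integralD//; last 4 first.
  - by move=> w _; rewrite lee_fin mulr_ge0.
  - by apply/measurable_EFinP; apply: mP => //; exact: ltW.
  - by move=> w _; rewrite lee_fin mulr_ge0.
  - by apply/measurable_EFinP; apply: mP => //; exact: ltW.
  by rewrite leeDl// lee_fin ltW.
Qed.

End discrete_bound.

(** * Derivatives of convex functions *)

Section almost_everywhere.
Context {R : realType}.

Lemma countable_negligible d (T : measurableType d) (m : {measure set T -> \bar R}) (C : set T) :
  countable C -> (forall x, C x -> m.-negligible [set x]) -> m.-negligible C.
Proof.
move=> /countable_injP[f finj] Cx.
apply: (@negligibleS _ _ _ _ (\bigcup_n [set x | C x /\ f x = n])).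
  by move=> x Cx'; exists (f x).
apply: negligible_bigcup => n.
have [[x0 [Cx0 fx0]]|nx] := pselect (exists x, C x /\ f x = n).
  apply: negligibleS (Cx x0 Cx0) => x [Cx' fx] /=.
  by apply: finj; rewrite ?inE// fx fx0.
apply: (@negligibleS _ _ _ _ set0); last exact: negligible_set0.
by move=> x hx; apply: nx; exists x.
Qed.

Lemma Rintegral_ae_eq d (T : measurableType d) (m : {measure set T -> \bar R}) (D N : set T)
    (f g : T -> R) :
  measurable D -> measurable_fun D f -> measurable_fun D g -> m.-negligible N ->
  (forall x, D x -> ~ N x -> f x = g x) -> Rintegral m D f = Rintegral m D g.
Proof.
move=> mD mf mg nN fg; congr fine; apply: ae_eq_integral => //; try exact/measurable_EFinP.
apply: negligibleS nN => x /= h; apply: contrapT => nx; apply: h => Dx.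
by rewrite fg.
Qed.

Lemma integrable_ae_eq d (T : measurableType d) (m : {measure set T -> \bar R}) (D N : set T)
    (f g : T -> R) :
  measurable D -> measurable_fun D g -> m.-negligible N ->
  (forall x, D x -> ~ N x -> f x = g x) -> m.-integrable D (EFin \o f) ->
  m.-integrable D (EFin \o g).
Proof.
move=> mD mg nN fg /integrableP[mf lf]; apply/integrableP; split; first exact/measurable_EFinP.
apply: le_lt_trans lf; rewrite le_eqVlt; apply/orP; left; apply/eqP.
apply: ge0_ae_eq_integral => //.
- by apply: measurableT_comp => //; exact/measurable_EFinP.
- exact: measurableT_comp.
apply: negligibleS nN => x /= h; apply: contrapT => nx; apply: h => Dx.
by rewrite fg.
Qed.

End almost_everywhere.

Section right_derivative.
Context {R : realType}.
Variable G : R -> R.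
Hypothesis ndG : {homo G : x y / x <= y}.
Hypothesis cvxG : forall x y z, x <= y -> y <= z ->
  (z - x) * G y <= (z - y) * G x + (y - x) * G z.

(** The right derivative: for convex [G] the slopes from [x] decrease as [y] comes down to [x], so
    their limit is this infimum. It is defined everywhere, without any differentiability. *)
Definition rderiv (x : R) : R := inf [set (G y - G x) / (y - x) | y in [set y | x < y]].

Let slopes_lb x : has_lbound [set (G y - G x) / (y - x) | y in [set y | x < y]].
Proof.
by exists 0 => _ [y /= xy <-]; rewrite divr_ge0 ?subr_ge0 ?ndG// ltW.
Qed.

Let slopes_ne x : [set (G y - G x) / (y - x) | y in [set y | x < y]] !=set0.
Proof. by exists ((G (x + 1) - G x) / (x + 1 - x)), (x + 1) => //=; rewrite ltrDl. Qed.

Lemma rderiv_ge0 x : 0 <= rderiv x.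
Proof.
apply: lb_le_inf; first exact: slopes_ne.
by move=> _ [y /= xy <-]; rewrite divr_ge0 ?subr_ge0 ?ndG// ltW.
Qed.

Lemma rderiv_le_slope x y : x <= y -> rderiv x * (y - x) <= G y - G x.
Proof.
rewrite le_eqVlt => /predU1P[->|xy]; first by rewrite !subrr mulr0.
rewrite -ler_pdivlMr ?subr_gt0//; apply: ge_inf; first exact: slopes_lb.
by exists y.
Qed.

Lemma slope_le_rderiv x y : x <= y -> G y - G x <= rderiv y * (y - x).
Proof.
rewrite le_eqVlt => /predU1P[->|xy]; first by rewrite !subrr mulr0.
rewrite -ler_pdivrMr ?subr_gt0//; apply: lb_le_inf; first exact: slopes_ne.
move=> _ [z /= yz <-]; rewrite ler_pdivrMr ?subr_gt0// mulrAC ler_pdivlMr ?subr_gt0//.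
have := cvxG (ltW xy) (ltW yz); lra.
Qed.

Lemma rderiv_nd : {homo rderiv : x y / x <= y}.
Proof.
move=> x y; rewrite le_eqVlt => /predU1P[->//|xy].
have h1 := rderiv_le_slope (ltW xy); have h2 := slope_le_rderiv (ltW xy).
by have := le_trans h1 h2; rewrite ler_pM2r ?subr_gt0.
Qed.

(** The one-sided limits of the monotone function [rderiv]; [G] is differentiable where they
    agree. *)
Let lft x := sup [set rderiv y | y in [set y | y < x]].
Let rgt x := inf [set rderiv y | y in [set y | x < y]].

Let lft_ub x : has_ubound [set rderiv y | y in [set y | y < x]].
Proof. by exists (rderiv x) => _ [y /= yx <-]; apply: rderiv_nd; exact: ltW. Qed.
Let lft_ne x : [set rderiv y | y in [set y | y < x]] !=set0.
Proof. by exists (rderiv (x - 1)), (x - 1) => //=; rewrite gtrBl. Qed.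
Let rgt_lb x : has_lbound [set rderiv y | y in [set y | x < y]].
Proof. by exists (rderiv x) => _ [y /= yx <-]; apply: rderiv_nd; exact: ltW. Qed.
Let rgt_ne x : [set rderiv y | y in [set y | x < y]] !=set0.
Proof. by exists (rderiv (x + 1)), (x + 1) => //=; rewrite ltrDl. Qed.

Lemma rderiv_jumps_countable : countable [set x | lft x < rgt x].
Proof.
(* The jump intervals are open, nonempty and pairwise disjoint. At indices without a jump the family
   is padded to the whole line, to be open and nonempty there too. *)
apply: (@separated_open_countable R R (fun x => `]lft x, rgt x[%classic
   `|` [set y | ~ (lft x < rgt x)])) => [x|x|].
- have [h|h] := pselect (lft x < rgt x).
    rewrite (_ : [set y : R | ~ (lft x < rgt x)] = set0) ?setU0; first exact: interval_open.
    by apply/seteqP; split.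
  rewrite (_ : [set y : R | ~ (lft x < rgt x)] = setT) ?setUT; first exact: openT.
  by apply/seteqP; split.
- have [h|h] := pselect (lft x < rgt x); last by exists 0; right.
  by exists ((lft x + rgt x) / 2); left; rewrite /= in_itv/=; apply/andP; split; lra.
- move=> x y /= hx hy [z [[zx|]//]]; move=> [zy|]//.
  move: zx zy; rewrite /= !in_itv/= => /andP[x1 x2] /andP[y1 y2].
  have sep u v : u < v -> rgt u <= lft v.
    move=> uv; pose c := (u + v) / 2.
    have uc : u < c by rewrite /c; lra.
    have cv : c < v by rewrite /c; lra.
    apply: (@le_trans _ _ (rderiv c)).
      by apply: ge_inf; [exact: rgt_lb|exists c].
    by apply: ub_le_sup; [exact: lft_ub|exists c].
  case: (ltgtP x y) => // xy.
    by have := sep _ _ xy; lra.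
  by have := sep _ _ xy; lra.
Qed.

(** The difference quotient at [x] lies between [rderiv x] and [rderiv (h + x)], and both are within
    [e] of the common one-sided limit. *)
Lemma rderiv_derive1 (F : R -> R) x : 0 < x -> (forall y, 0 <= y -> F y = G y) ->
  ~ lft x < rgt x -> (F^`())%classic x = rderiv x.
Proof.
move=> x0 FG /negP; rewrite -leNgt => rl.
have l1 : lft x <= rderiv x.
  apply: ge_sup; first exact: lft_ne.
  by move=> _ [y /= yx <-]; apply: rderiv_nd; exact: ltW.
have r1 : rderiv x <= rgt x.
  apply: lb_le_inf; first exact: rgt_ne.
  by move=> _ [y /= yx <-]; apply: rderiv_nd; exact: ltW.
rewrite /derive1; apply: cvg_lim => //; apply/cvgrPdist_lt => e e0.
have [_ [z0 /= xz0 <-] hz0] : exists2 u, [set rderiv y | y in [set y | x < y]] u & u < rgt x + e.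
  by apply: inf_adherent.
have [_ [y0 /= y0x <-] hy0] : exists2 u, [set rderiv y | y in [set y | y < x]] u & lft x - e < u.
  by apply: sup_adherent.
(* The bound by [x] keeps [h + x] in the half-line where [F] and [G] agree; the other two keep it
   between [y0] and [z0]. *)
have dl0 : 0 < Num.min x (Num.min (z0 - x) (x - y0)).
  by rewrite !lt_min x0 !subr_gt0 xz0 y0x.
exists (Num.min x (Num.min (z0 - x) (x - y0))) => // h /=; rewrite sub0r normrN.
rewrite !lt_min => /andP[hx /andP[hz hy]] hn0.
have xh0 : 0 <= h + x by move: hx; rewrite ltr_norml => /andP[? ?]; lra.
rewrite !FG//; last exact: ltW.
change (`|rderiv x - h^-1 * (G (h + x) - G x)| < e).
case: (ltgtP h 0) hn0 => // hh _.
  have h1 := slope_le_rderiv (_ : h + x <= x); have h2 := rderiv_le_slope (_ : h + x <= x).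
  have hle : h + x <= x by lra.
  have {}h1 := h1 hle; have {}h2 := h2 hle.
  have : rderiv y0 <= rderiv (h + x).
    by apply: rderiv_nd; move: hy; rewrite ltr_norml => /andP[? ?]; lra.
  have e1 : x - (h + x) = - h by ring.
  rewrite e1 in h1 h2.
  have nh : 0 < - h by lra.
  have -> : h^-1 * (G (h + x) - G x) = (G x - G (h + x)) / (- h).
    by rewrite invrN mulrN -mulNr opprB mulrC.
  rewrite -ler_pdivrMr// in h1; rewrite -ler_pdivlMr// in h2; move=> h3.
  by rewrite ltr_norml; apply/andP; split; lra.
have h1 := rderiv_le_slope (_ : x <= h + x); have h2 := slope_le_rderiv (_ : x <= h + x).
have hle : x <= h + x by lra.
have {}h1 := h1 hle; have {}h2 := h2 hle.
have : rderiv (h + x) <= rderiv z0.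
  by apply: rderiv_nd; move: hz; rewrite ltr_norml => /andP[? ?]; lra.
have e1 : h + x - x = h by ring.
rewrite e1 in h1 h2.
rewrite -ler_pdivlMr// in h1; rewrite -ler_pdivrMr// in h2; rewrite [_^-1 * _]mulrC => h3.
by rewrite ltr_norml; apply/andP; split; lra.
Qed.

Lemma derive1_eq_rderiv_off_countable (F : R -> R) : (forall y, 0 <= y -> F y = G y) ->
  exists2 C : set R, countable C & forall x, 0 < x -> ~ C x -> (F^`())%classic x = rderiv x.
Proof.
move=> FG; exists [set x | lft x < rgt x]; first exact: rderiv_jumps_countable.
by move=> x x0 nC; exact: rderiv_derive1.
Qed.

End right_derivative.

Section convex_extension.
Context {R : realType}.
Variable F : R -> R.
Hypothesis cvxF : convex_function (`[0, +oo[%classic : set R) F.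
Hypothesis ndF : {in `[0, +oo[ &, {homo F : x y / x <= y}}.

(** Extension by a constant to the left: since [F] is increasing the result is still convex, so
    right derivatives can be studied on the whole line. *)
Definition halfline_ext (x : R) : R := F (Num.max x 0).

Lemma halfline_extE x : 0 <= x -> F x = halfline_ext x.
Proof. by move=> x0; rewrite /halfline_ext max_l. Qed.

Let nd x y : 0 <= x -> x <= y -> F x <= F y.
Proof. by move=> x0 xy; apply: ndF => //; rewrite in_itv/= ?x0 ?(le_trans x0). Qed.

Lemma halfline_ext_nd : {homo halfline_ext : x y / x <= y}.
Proof.
by move=> x y xy; apply: nd; [rewrite le_max lexx orbT|rewrite ge_max !le_max xy lexx !orbT].
Qed.

Let cvx3 x y z : 0 <= x -> x <= y -> y <= z -> (z - x) * F y <= (z - y) * F x + (y - x) * F z.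
Proof.
move=> x0 xy yz.
have [xz|xz] := eqVneq x z.
  have -> : y = x by apply/eqP; rewrite eq_le; apply/andP; split=> //; rewrite xz.
  by rewrite xz subrr !mul0r addr0.
have zx : 0 < z - x by rewrite subr_gt0 lt_neqAle xz (le_trans xy yz).
pose t := (z - y) / (z - x).
have t0 : 0 <= t by apply: divr_ge0; [rewrite subr_ge0|exact: ltW].
have t1 : t <= 1 by rewrite ler_pdivrMr// mul1r; lra.
have hx : x \in (`[0, +oo[%classic : set R) by rewrite inE /= in_itv/= x0.
have hz : z \in (`[0, +oo[%classic : set R).
  by rewrite inE /= in_itv/= (le_trans x0 (le_trans xy yz)).
have := cvxF (Itv01 t0 t1) hx hz; rewrite !convRE /=.
have e : t * x + (1 - t) * z = y by rewrite /t; field; rewrite gt_eqF.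
move=> h'; have h : F y <= t * F x + (1 - t) * F z by rewrite -[in leLHS]e; exact: h'.
have := ler_wpM2l (ltW zx) h.
have -> : (z - x) * (t * F x + (1 - t) * F z) = (z - y) * F x + (y - x) * F z.
  by rewrite /t; field; rewrite gt_eqF.
by [].
Qed.

Lemma halfline_ext_cvx x y z : x <= y -> y <= z ->
  (z - x) * halfline_ext y <= (z - y) * halfline_ext x + (y - x) * halfline_ext z.
Proof.
move=> xy yz; rewrite /halfline_ext.
have [y0|y0] := leP y 0.
  have x0 : x <= 0 by exact: le_trans y0.
  rewrite (max_r x0).
  have h : F 0 <= F (Num.max z 0) by apply: nd => //; rewrite le_max lexx orbT.
  have := ler_wpM2l (_ : 0 <= y - x) h; rewrite subr_ge0 => /(_ xy); lra.
have z0 : 0 <= z by lra.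
rewrite (max_l z0).
have [x0|x0] := leP x 0.
  have h1 := cvx3 (lexx 0) (ltW y0) yz.
  have h2 : F y <= F z by apply: nd => //; exact: ltW.
  have := ler_wpM2l (_ : 0 <= - x) h2; rewrite oppr_ge0 => /(_ x0); lra.
by apply: cvx3 => //; exact: ltW.
Qed.

End convex_extension.

(** * The dual functions *)

Section interval_integrals.
Context {R : realType}.
Notation mu := (@lebesgue_measure R).

Lemma Rintegral_between d (T : measurableType d) (m : {measure set T -> \bar R}) (D : set T)
    (f : T -> R) (lo hi : R) :
  measurable D -> (m D < +oo)%E -> m.-integrable D (EFin \o f) ->
  (forall x, D x -> lo <= f x <= hi) ->
  lo * fine (m D) <= Rintegral m D f <= hi * fine (m D).
Proof.
move=> mD fD If h.
have Ic (c : R) : m.-integrable D (EFin \o (fun=> c)).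
  apply/integrableP; split; first exact: measurable_cst.
  by rewrite integral_cst//= lte_mul_pinfty// lee_fin.
by rewrite -!Rintegral_cst//; apply/andP; split; apply: le_Rintegral => // x Dx;
  have /andP[] := h x Dx.
Qed.

Lemma Rintegral_itv0B (f : R -> R) (x y : R) : 0 <= x -> x <= y ->
  mu.-integrable `[0, y] (EFin \o f) ->
  Rintegral mu `[0, y] f - Rintegral mu `[0, x] f = Rintegral mu `]x, y] f.
Proof.
move=> x0 xy If; rewrite (@Rintegral_itvB R f (BLeft 0) (BRight y) x)//.
Qed.

Lemma Rintegral_lebesgue_between (f : R -> R) (x y lo hi : R) : x <= y ->
  mu.-integrable `]x, y] (EFin \o f) -> (forall z, x < z <= y -> lo <= f z <= hi) ->
  lo * (y - x) <= Rintegral mu `]x, y] f <= hi * (y - x).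
Proof.
move=> xy If h.
have e : mu `]x, y]%classic = (y - x)%:E.
  rewrite lebesgue_measure_itv/= lte_fin; case: ltP => // yx.
  by congr EFin; lra.
have fin : (mu `]x, y]%classic < +oo)%E by rewrite e ltry.
have hh z : `]x, y]%classic z -> lo <= f z <= hi by rewrite /= in_itv/= => hz; exact: h.
have := @Rintegral_between _ (measurableTypeR R) mu `]x, y]%classic f lo hi (measurable_itv _) fin If hh.
by rewrite [X in fine X]e.
Qed.

Lemma integrable_itvS (f : R -> R) (x y : R) : 0 <= x ->
  mu.-integrable `[0, y] (EFin \o f) -> mu.-integrable `]x, y] (EFin \o f).
Proof.
move=> x0; apply: integrableS => //.
by move=> z /=; rewrite !in_itv/= => /andP[xz ->]; rewrite andbT ltW// (le_lt_trans x0).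
Qed.

Lemma halfline_continuous_integral (f : R -> R) :
  (forall b, 0 <= b -> mu.-integrable `[0, b] (EFin \o f)) ->
  {within `[0, +oo[, continuous (fun x => Rintegral mu `[0, x] f)}.
Proof.
move=> If; apply/subspace_continuousP => x; rewrite /= in_itv/= andbT => x0.
have x10 : 0 <= x + 1 by lra.
have /subspace_continuousP/(_ x) := parameterized_integral_continuous x10 (If _ x10).
have hx : `[0, x + 1]%classic x by rewrite /= in_itv/= x0 /=; lra.
move=> /(_ hx) /cvgrPdist_lt h; apply/cvgrPdist_lt => e e0.
have /nbhs_ballP[dl /= dl0 hdl] := h e e0.
apply/nbhs_ballP; exists (Num.min dl 1) => /=; first by rewrite lt_min dl0 ltr01.
move=> y; rewrite /ball /= lt_min => /andP[xy1 xy2]; rewrite in_itv/= andbT => y0.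
apply: hdl => //=; rewrite in_itv/= y0 /=.
by move: xy2; rewrite ltr_norml => /andP[? ?]; lra.
Qed.

Lemma RintegralD_lebesgue (f g : R -> R) (i : interval R) :
  mu.-integrable [set` i] (EFin \o f) -> mu.-integrable [set` i] (EFin \o g) ->
  Rintegral mu [set` i] (fun x => f x + g x) = Rintegral mu [set` i] f + Rintegral mu [set` i] g.
Proof. by move=> If Ig; rewrite RintegralD//; exact: measurable_itv. Qed.

Lemma RintegralZl_lebesgue (f : R -> R) (k : R) (i : interval R) :
  mu.-integrable [set` i] (EFin \o f) ->
  Rintegral mu [set` i] (fun x => k * f x) = k * Rintegral mu [set` i] f.
Proof. by move=> If; rewrite RintegralZl//; exact: measurable_itv. Qed.

End interval_integrals.

Section grid_comparison.
Context {R : realType}.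

(** Takes the place of integrating a differential inequality: the increments are summed over a grid
    and the cross terms vanish with the mesh. *)
Lemma le_of_grid_increments (S G V W : R -> R) (T : R) : 0 <= T ->
  (forall x y, 0 <= x -> x <= y -> V x <= V y) -> {within `[0, +oo[, continuous W} ->
  (forall x y, 0 <= x -> x <= y ->
     S y - S x <= G y - G x + (V y - V x) * (W y - W x)) ->
  S T - S 0 <= G T - G 0.
Proof.
rewrite le_eqVlt => /predU1P[<-|T0] ndV cW h; first by rewrite !subrr.
apply: (@le_of_le_linear R _ _ (V T - V 0) 1 ltr01) => e e0 _.
have [N hN] := grid_product_small T0 e0 (fun x y x0 xy _ => ndV x y x0 xy) cW.
have {hN} := hN N (leqnn _).
have N0 : 0 < N.+1%:R :> R by rewrite ltr0n.
set k := T / N.+1%:R.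
have k0 : 0 < k by rewrite divr_gt0.
have e1 : N.+1%:R * k = T by rewrite /k mulrC mulfVK// gt_eqF.
have eS : \sum_(i < N.+1) (S (0 + i.+1%:R * k) - S (0 + i%:R * k)) = S T - S 0.
  by rewrite telescope_grid add0r e1.
have eG : \sum_(i < N.+1) (G (0 + i.+1%:R * k) - G (0 + i%:R * k)) = G T - G 0.
  by rewrite telescope_grid add0r e1.
move=> hV; rewrite -eS -eG [X in _ <= _ + X]mulrC.
apply: le_trans (lerD (lexx _) hV).
rewrite -big_split /=; apply: ler_sum => i _; apply: h.
  by rewrite add0r mulr_ge0// ltW.
by rewrite !add0r ler_pM2r// ler_nat.
Qed.

End grid_comparison.

Section ratio_steps.
Context {R : realType}.
(* [px] and [py] stand for the tail masses of [nu] at two points, [a] and [b] for the values of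
   [Sigma] there, and [j] for the integral of [F'] against [nu] in between. *)
Implicit Types px py a b j D E : R.

(** The discrete form of [dSigma = (Sigma - F') dDelta]: in the limit [px - py] becomes [p dDelta]
    and [j] becomes [F' p dDelta]. *)
Let step_eq px py a b j : px * a = j + py * b -> px * (b - a) = (px - py) * b - j.
Proof. by move=> h; rewrite mulrBr h; ring. Qed.

Lemma ratio_step_ge0 px py a b j D : 0 < px -> px * a = j + py * b ->
  0 <= px - py -> D <= b -> j <= D * (px - py) -> a <= b.
Proof.
move=> p0 h h1 h2 h3; rewrite -subr_ge0 -(pmulr_rge0 _ p0) (step_eq h).
by have := ler_wpM2l h1 h2; lra.
Qed.

Lemma ratio_step_le px py a b j D E : 0 < px -> px * a = j + py * b ->
  0 <= b - D -> px - py <= px * E -> D * (px - py) <= j -> b - a <= (b - D) * E.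
Proof.
move=> p0 h h1 h2 h3; rewrite -(ler_pM2l p0) (step_eq h).
by have := ler_wpM2l h1 h2; lra.
Qed.

(** The upper bound on [Sigma] and the lower bound on the integral take opposite endpoints; the
    discrepancy is the increment of [Sigma + F'] times that of [Delta], a product that fine grids
    absorb. *)
Lemma ratio_increment_le (Sx Sy Dx Dy W dG : R) : Sy - Sx <= (Sy - Dx) * W -> (Sx - Dy) * W <= dG ->
  Sy - Sx <= dG + (Sy + Dy - (Sx + Dx)) * W.
Proof. by lra. Qed.

Lemma drift_increment_le (M M' S Dx Dy dF dC h : R) : 0 <= h -> S <= M' -> dF <= Dy * h ->
  dC <= (S - Dx) * h -> dF + dC <= M * h + (M' + Dy - (M + Dx)) * h.
Proof. by move=> h0 /(ler_wpM2r h0); lra. Qed.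

End ratio_steps.

(** * Monotonicity and increments of [Sigma], [A_+], [A_-] and [C] *)

Section analytic_facts.
Context {R : realType}.
Variables (phip phim F : R -> R) (nu : {measure set R -> \bar R}).
Hypothesis phip0 : {in `[0, +oo[, forall m, 0 <= phip m}.
Hypothesis ndp : {in `[0, +oo[ &, {homo phip : x y / x <= y}}.
Hypothesis phim0 : {in `[0, +oo[, forall m, phim m <= 0}.
Hypothesis nim : {in `[0, +oo[ &, {homo phim : x y / x <= y >-> y <= x}}.
Hypothesis cvxF : convex_function (`[0, +oo[%classic : set R) F.
Hypothesis ndF : {in `[0, +oo[ &, {homo F : x y / x <= y}}.
Hypothesis Dfin : forall l, 0 < l -> (DeltaE phip phim l < +oo)%E.
Hypothesis nuE : forall l, 0 <= l -> nu `[l, +oo[%classic = (expR (- Delta phip phim l))%:E.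
Hypothesis nuF : nu.-integrable `[0, +oo[%classic (EFin \o (F^`())%classic).
Notation mu := (@lebesgue_measure R).
Local Notation Dl := (Delta phip phim).
Local Notation Sg := (Sigma nu F).

Let in0 (x : R) : 0 <= x -> x \in `[0, +oo[. Proof. by move=> x0; rewrite in_itv/= x0. Qed.

Let recip_half_ge0 (x : R) : (0 <= recip_half x)%E.
Proof. by rewrite /recip_half; case: ifP => // _; rewrite lee_fin invr_ge0 mulr_ge0. Qed.

Let recip_half_gt0 (x : R) : x != 0 -> recip_half x = ((2 * `|x|)^-1)%:E.
Proof. by rewrite /recip_half => /negbTE ->. Qed.

Let Delta_infinite (m : R) : 0 < m ->
  (forall x, 0 <= x <= m -> (recip_half (phip x) + recip_half (phim x) = +oo)%E) -> False.
Proof.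
move=> m0 h; have := Dfin m0; rewrite /DeltaE.
rewrite (eq_integral (cst +oo%E)); last first.
  by move=> x; rewrite inE /= in_itv/= => /h ->.
rewrite integral_cst//= lebesgue_measure_itv/= lte_fin m0 -EFinB subr0.
by rewrite gt0_mulye ?ltxx// lte_fin.
Qed.

(** A zero at [m] would spread to all of [[0, m]] by monotonicity and make [DeltaE] infinite
    there. *)
Let phip_gt0 (m : R) : 0 < m -> 0 < phip m.
Proof.
move=> m0; rewrite lt_neqAle phip0 ?in0 ?(ltW m0)// andbT eq_sym; apply/eqP => e.
apply: (@Delta_infinite m m0) => x /andP[x0 xm].
have -> : phip x = 0.
  by apply/eqP; rewrite eq_le phip0 ?in0// -e ndp ?in0// ltW.
rewrite {1}/recip_half eqxx addye//.
by rewrite -ltNye (lt_le_trans _ (recip_half_ge0 _))//.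
Qed.

Let phim_lt0 (m : R) : 0 < m -> phim m < 0.
Proof.
move=> m0; rewrite lt_neqAle phim0 ?in0 ?(ltW m0)// andbT; apply/eqP => e.
apply: (@Delta_infinite m m0) => x /andP[x0 xm].
have -> : phim x = 0.
  by apply/eqP; rewrite eq_le phim0 ?in0//= -e nim ?in0// ltW.
rewrite {2}/recip_half eqxx addey//.
by rewrite -ltNye (lt_le_trans _ (recip_half_ge0 _))//.
Qed.

(** Real-valued reciprocals, with [rr] the density of [Delta]. At [0], where [phip] or [phim] may
    vanish, the inverse is [0] instead of [+oo]; that is a single null point. *)
Let vp (x : R) : R := (phip x)^-1.
Let vm (x : R) : R := `|phim x|^-1.
Let rr (x : R) : R := 2^-1 * (vp x + vm x).

Let vp_ge0 (x : R) : 0 <= x -> 0 <= vp x. Proof. by move=> x0; rewrite invr_ge0 phip0// in0. Qed.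
Let vm_ge0 (x : R) : 0 <= vm x. Proof. by rewrite invr_ge0. Qed.
Let rr_ge0 (x : R) : 0 <= x -> 0 <= rr x.
Proof. by move=> x0; rewrite mulr_ge0// addr_ge0// ?vp_ge0 ?vm_ge0. Qed.

Let rrE (x : R) : 0 < x -> (recip_half (phip x) + recip_half (phim x))%E = (rr x)%:E.
Proof.
move=> x0; have px := phip_gt0 x0; have mx := phim_lt0 x0.
have e1 : phip x != 0 by rewrite gt_eqF.
have e2 : phim x != 0 by rewrite lt_eqF.
rewrite (recip_half_gt0 e1) (recip_half_gt0 e2) -EFinD; congr EFin.
by rewrite /rr /vp /vm (gtr0_norm px) !invfM mulrDr.
Qed.

(* [x^-1 = exp (- ln x)] gives measurability of the reciprocals. *)
Let measurable_inv_nd (f : R -> R) (D : set R) : measurable D -> D `<=` `[0, +oo[%classic ->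
  (forall x y, 0 <= x -> x <= y -> f x <= f y) -> (forall x, 0 < x -> 0 < f x) ->
  measurable_fun D (fun x => (f x)^-1).
Proof.
move=> mD D0 ndf fpos.
pose fe (x : R) := f (Num.max x 0).
have mfe : measurable_fun setT fe.
  apply: nondecreasing_measurable => // x y xy; apply: ndf.
    by rewrite le_max lexx orbT.
  by rewrite ge_max !le_max xy lexx !orbT.
pose g (x : R) : R := if 0 < x then expR (- ln (fe x)) else (f 0)^-1.
have mg : measurable_fun setT g.
  apply: measurable_fun_ifT => //; first exact: measurable_fun_ltr.
  apply: measurableT_comp => //; apply: measurableT_comp => //.
  by apply: measurableT_comp mfe; exact: measurable_ln.
apply: (eq_measurable_fun g); last exact: measurable_funTS.
move=> x; rewrite inE => /D0; rewrite /= in_itv/= andbT => x0.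
rewrite /g; case: ltP => [xp|xn].
  by rewrite expRN lnK /fe ?max_l// posrE fpos.
by have -> : x = 0 by apply/eqP; rewrite eq_le x0 xn.
Qed.

Let mvp (l : R) : measurable_fun `[0, l]%classic vp.
Proof.
apply: measurable_inv_nd => //.
- by move=> x /=; rewrite !in_itv/= => /andP[-> _].
- by move=> x y x0 xy; apply: ndp => //; apply: in0 => //; exact: le_trans xy.
Qed.

Let mvm (l : R) : measurable_fun `[0, l]%classic vm.
Proof.
apply: (@measurable_inv_nd (fun x => `|phim x|)) => //.
- by move=> x /=; rewrite !in_itv/= => /andP[-> _].
- move=> x y x0 xy; have y0 : 0 <= y by exact: le_trans xy.
  by rewrite !ler0_norm ?phim0 ?in0// lerN2 nim ?in0.
- by move=> x x0; rewrite normr_gt0 lt_eqF// phim_lt0.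
Qed.

Let mrr (l : R) : measurable_fun `[0, l]%classic rr.
Proof. by apply: measurable_funM => //; apply: measurable_funD; [exact: mvp|exact: mvm]. Qed.

Let sub_oc (l : R) : `]0, l]%classic `<=` (`[0, l]%classic : set R).
Proof. by move=> x /=; rewrite !in_itv/= => /andP[/ltW -> ->]. Qed.

Let DeltaE_rr (l : R) : (DeltaE phip phim l = \int[mu]_(x in `[0%R, l]) (rr x)%:E)%E.
Proof.
have mr : measurable_fun (`]0, l]%classic : set R) rr.
  by have := @mrr l; apply: measurable_funS; [exact: measurable_itv|exact: sub_oc].
have e x : x \in `]0, l]%classic -> (recip_half (phip x) + recip_half (phim x))%E = (rr x)%:E.
  by rewrite inE /= in_itv/= => /andP[x0 _]; exact: rrE.
rewrite /DeltaE -[LHS]integral_itv_obnd_cbnd; last first.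
  by apply: (eq_measurable_fun (EFin \o rr)); [move=> x /e ->|exact/measurable_EFinP].
rewrite -[RHS]integral_itv_obnd_cbnd; last exact/measurable_EFinP.
exact: eq_integral.
Qed.

Let int_rr (l : R) : mu.-integrable `[0, l] (EFin \o rr).
Proof.
apply: ge0_integrable_real; first exact: mrr.
  by move=> x /=; rewrite in_itv/= => /andP[x0 _]; exact: rr_ge0.
rewrite -DeltaE_rr; have [l0|l0] := ltP 0 l; first exact: Dfin.
apply: le_lt_trans (@Dfin 1 ltr01); rewrite /DeltaE.
have [->|l1] := eqVneq l 0; first by rewrite set_itv1 integral_set1 integral_ge0// => x _; rewrite adde_ge0.
rewrite set_itv_ge ?integral_set0 ?integral_ge0// => [x _|]; first by rewrite adde_ge0.
by rewrite bnd_simp -ltNge lt_neqAle l1 l0.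
Qed.

Let DlE (l : R) : Dl l = Rintegral mu `[0, l] rr.
Proof. by rewrite /Delta DeltaE_rr. Qed.

Let Dl_incr (x y : R) : 0 <= x -> x <= y -> Dl y - Dl x = Rintegral mu `]x, y] rr.
Proof. by move=> x0 xy; rewrite !DlE; apply: Rintegral_itv0B. Qed.

Let Dl_nd (x y : R) : 0 <= x -> x <= y -> Dl x <= Dl y.
Proof.
move=> x0 xy; rewrite -subr_ge0 Dl_incr//; apply: Rintegral_ge0 => z /=.
by rewrite in_itv/= => /andP[xz _]; apply: rr_ge0; rewrite ltW// (le_lt_trans x0).
Qed.

Let Dl_cont : {within `[0, +oo[, continuous Dl}.
Proof.
have -> : Dl = (fun l => Rintegral mu `[0, l] rr) by apply/funext => l; exact: DlE.
by apply: halfline_continuous_integral => b _; exact: int_rr.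
Qed.

Let p (x : R) : R := expR (- Dl x).
Let p_gt0 x : 0 < p x. Proof. exact: expR_gt0. Qed.

Let itv_split (x y : R) : x <= y ->
  (`[x, +oo[%classic : set R) = `[x, y[%classic `|` `[y, +oo[%classic.
Proof.
move=> xy; apply/seteqP; split=> z /=; rewrite !in_itv/= !andbT.
  by move=> xz; have [zy|zy] := ltP z y; [left; rewrite xz|right].
by move=> [/andP[]//|]; exact: le_trans.
Qed.

Let itv_disj (x y : R) : (`[x, y[%classic : set R) `&` `[y, +oo[%classic = set0.
Proof. by apply/seteqP; split=> z //= [] /=; rewrite !in_itv/= andbT; lra. Qed.

Let nu_itv (x y : R) : 0 <= x -> x <= y -> nu `[x, y[%classic = (p x - p y)%:E.
Proof.
move=> x0 xy; have y0 : 0 <= y by exact: le_trans xy.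
have h : nu `[x, +oo[%classic = (nu `[x, y[%classic + nu `[y, +oo[%classic)%E.
  by rewrite (itv_split xy) measureU//; exact: itv_disj.
move: h; rewrite !nuE// -/(p x) -/(p y) => h.
by rewrite EFinB h -EFinN addeK.
Qed.

Let p_diff (x y : R) : 0 <= x -> x <= y -> p x - p y <= p x * (Dl y - Dl x).
Proof.
move=> x0 xy; have -> : p y = p x * expR (- (Dl y - Dl x)).
  by rewrite /p -expRD; congr expR; ring.
rewrite -[X in X - _]mulr1 -mulrBr ler_pM2l//.
have := expR_ge1Dx (- (Dl y - Dl x)); lra.
Qed.

(** [Delta], hence the tail of [nu], is continuous, so [nu] has no atoms on the half-line. Countable
    exceptional sets of [F'] are thus negligible for [nu] as well. *)
Let nu_set1 (x : R) : 0 <= x -> nu.-negligible [set x].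
Proof.
move=> x0; apply/negligibleP => //; apply/eqP; rewrite eq_le measure_ge0 andbT.
apply/lee_addgt0Pr => e e0; rewrite add0e.
have [dl dl0 h] := halfline_continuous_eps Dl_cont x0 e0.
pose y := x + dl / 2.
have xy : x <= y by rewrite /y lerDl divr_ge0// ltW.
have y0 : 0 <= y by exact: le_trans xy.
apply: (@le_trans _ _ (nu `[x, y[%classic)).
  apply: le_measure_sub => // z /= ->; rewrite in_itv/= lexx /=.
  by rewrite /y ltrDl divr_gt0.
rewrite nu_itv// lee_fin; apply: (le_trans (p_diff x0 xy)).
have : Dl y - Dl x < e.
  have := h y y0; rewrite /y addrAC subrr add0r gtr0_norm ?divr_gt0//.
  have h2 : dl / 2 < dl by lra.
  by move=> /(_ h2); apply: le_lt_trans; exact: ler_norm.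
have p1 : p x <= 1.
  rewrite /p -expR0 ler_expR oppr_le0 DlE; apply: Rintegral_ge0 => z /=.
  by rewrite in_itv/= => /andP[z0 _]; exact: rr_ge0.
have D0 : 0 <= Dl y - Dl x by rewrite subr_ge0 Dl_nd.
have := ler_wpM2r D0 p1; lra.
Qed.

Definition rderivF : R -> R := rderiv (halfline_ext F).
Local Notation Dp := rderivF.
Let Dp_nd : {homo Dp : x y / x <= y}.
Proof. by apply: rderiv_nd; [exact: halfline_ext_nd|exact: halfline_ext_cvx]. Qed.
Let Dp_ge0 x : 0 <= Dp x. Proof. by apply: rderiv_ge0; exact: halfline_ext_nd. Qed.
Let mDp D : measurable D -> measurable_fun D Dp.
Proof. by move=> mD; exact: nondecreasing_measurable. Qed.

(** One exceptional set for both measures. The point [0] is included because the two-sided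
    derivative there also involves [F] on the negative axis, and the jump set is cut to the
    half-line because only there are points known to be [nu]-null. *)
Let bad : exists2 C : set R, nu.-negligible C /\ mu.-negligible C &
  forall x, 0 <= x -> ~ C x -> (F^`())%classic x = Dp x.
Proof.
have [C cC hC] := derive1_eq_rderiv_off_countable (halfline_ext_nd ndF) (halfline_ext_cvx cvxF ndF)
  (fun y y0 => halfline_extE F y0).
pose D : set R := C `&` `[0, +oo[%classic.
have cD : countable D by apply: sub_countable cC; apply: subset_card_le; exact: subIsetl.
exists (D `|` [set 0]); first split.
- apply: negligibleU; last exact: nu_set1.
  by apply: countable_negligible cD _ => x [_]; rewrite /= in_itv/= andbT; exact: nu_set1.
- have n1 (x : R) : mu.-negligible [set x].
    by apply/negligibleP => //; exact: lebesgue_measure_set1.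
  apply: negligibleU; last exact: n1.
  exact: (@countable_negligible R _ (measurableTypeR R) mu _ cD).
- move=> x x0 nC; apply: hC.
    by rewrite lt_neqAle x0 andbT; apply/eqP => e; apply: nC; right.
  by move=> Cx; apply: nC; left; split => //; rewrite /= in_itv/= x0.
Qed.

Let mF' : measurable_fun (`[0, +oo[%classic : set R) ((F^`())%classic : R -> R).
Proof. by have /measurable_int/measurable_EFinP := nuF. Qed.

Let int_Dp (x : R) : 0 <= x -> nu.-integrable `[x, +oo[ (EFin \o Dp).
Proof.
move=> x0; apply: (@integrableS _ _ R nu (`[0, +oo[%classic : set R)) => //.
  by move=> z /=; rewrite !in_itv/= !andbT; exact: le_trans.
have [C [nC _] hC] := bad.
apply: (integrable_ae_eq _ _ nC _ nuF) => //; first exact: mDp.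
by move=> z; rewrite /= in_itv/= andbT; exact: hC.
Qed.

Let I (x : R) : R := Rintegral nu `[x, +oo[ Dp.

Let SgE (x : R) : 0 <= x -> p x * Sg x = I x.
Proof.
move=> x0; rewrite /Sigma nuE//= -/(p x) mulrA divff ?gt_eqF// mul1r.
have [C [nC _] hC] := bad.
apply: (Rintegral_ae_eq _ _ _ nC) => //.
- apply: measurable_funS mF' => //.
  by move=> z /=; rewrite !in_itv/= !andbT; exact: le_trans.
- exact: mDp.
- by move=> z; rewrite /= in_itv/= andbT => xz; apply: hC; exact: le_trans xz.
Qed.

Let J (x y : R) : R := Rintegral nu `[x, y[ Dp.

Let I_split (x y : R) : 0 <= x -> x <= y -> I x = J x y + I y.
Proof.
move=> x0 xy; rewrite /I /J (itv_split xy) Rintegral_setU//.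
- by rewrite -(itv_split xy); exact: int_Dp.
- by apply/disj_set2P; exact: itv_disj.
Qed.

Let J_bound (x y : R) : 0 <= x -> x <= y ->
  Dp x * (p x - p y) <= J x y <= Dp y * (p x - p y).
Proof.
move=> x0 xy.
have e := nu_itv x0 xy.
have := @Rintegral_between _ _ _ nu `[x, y[%classic Dp (Dp x) (Dp y).
rewrite e ltry => /(_ (measurable_itv _) isT); apply.
  by apply: (@integrableS _ _ R nu (`[x, +oo[%classic : set R)) (int_Dp x0) => // z /=; rewrite !in_itv/= => /andP[->].
by move=> z /=; rewrite in_itv/= => /andP[xz zy]; rewrite !Dp_nd// ltW.
Qed.

(** [Sg x] is the [nu]-average over [[x, +oo[] of the nondecreasing function [Dp]. *)
Let Sg_ge_Dp (x : R) : 0 <= x -> Dp x <= Sg x.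
Proof.
move=> x0; rewrite -(ler_pM2l (p_gt0 x)) SgE//.
have fin : (nu `[x, +oo[%classic < +oo)%E by rewrite nuE// ltry.
have : Rintegral nu `[x, +oo[ (fun=> Dp x) <= I x.
  apply: le_Rintegral => //; last 2 first.
  - exact: int_Dp.
  - by move=> z; rewrite /= in_itv/= andbT => xz; exact: Dp_nd.
  apply: ge0_integrable_real => //.
  by rewrite integral_cst//; rewrite nuE// -EFinM ltry.
by rewrite Rintegral_cst// nuE//= mulrC.
Qed.

Let Sg_step (x y : R) : 0 <= x -> x <= y -> p x * Sg x = J x y + p y * Sg y.
Proof.
move=> x0 xy; have y0 : 0 <= y by exact: le_trans xy.
by rewrite !SgE//; exact: I_split.
Qed.

Let p_ni (x y : R) : 0 <= x -> x <= y -> 0 <= p x - p y.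
Proof. by move=> x0 xy; rewrite subr_ge0 ler_expR lerN2 Dl_nd. Qed.

Let Sg_nd (x y : R) : 0 <= x -> x <= y -> Sg x <= Sg y.
Proof.
move=> x0 xy; have y0 : 0 <= y by exact: le_trans xy.
have /andP[_ h1] := J_bound x0 xy.
exact: ratio_step_ge0 (p_gt0 x) (Sg_step x0 xy) (p_ni x0 xy) (Sg_ge_Dp y0) h1.
Qed.

Let Sg_ge0 (x : R) : 0 <= x -> 0 <= Sg x.
Proof. by move=> x0; apply: le_trans (Sg_ge_Dp x0). Qed.

Let Sg_incr (x y : R) : 0 <= x -> x <= y -> Sg y - Sg x <= (Sg y - Dp x) * (Dl y - Dl x).
Proof.
move=> x0 xy; have y0 : 0 <= y by exact: le_trans xy.
have /andP[h1 _] := J_bound x0 xy.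
have h2 : 0 <= Sg y - Dp x.
  by rewrite subr_ge0 (le_trans (Dp_nd xy))// Sg_ge_Dp.
exact: ratio_step_le (p_gt0 x) (Sg_step x0 xy) h2 (p_diff x0 xy) h1.
Qed.

Let sub0 (l : R) : `[0, l]%classic `<=` (`[0, +oo[%classic : set R).
Proof. by move=> x /=; rewrite !in_itv/= => /andP[->]. Qed.

Let mSg (l : R) : measurable_fun (`[0, l]%classic : set R) (Sg : R -> R).
Proof.
pose S (x : R) := Sg (Num.max x 0).
have mS : measurable_fun setT S.
  apply: nondecreasing_measurable => // x y xy; apply: Sg_nd.
    by rewrite le_max lexx orbT.
  by rewrite ge_max !le_max xy lexx !orbT.
apply: (eq_measurable_fun S); last exact: measurable_funTS.
by move=> x; rewrite inE /= in_itv/= => /andP[x0 _]; rewrite /S max_l.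
Qed.

Let dp (x : R) : R := Sg x - Dp x.

Let dp_ge0 (x : R) : 0 <= x -> 0 <= dp x.
Proof. by move=> x0; rewrite subr_ge0 Sg_ge_Dp. Qed.

(** [dp] is a difference of monotone functions and need not be monotone; this bracket replaces
    monotonicity in the integral estimates. *)
Let dp_between (x y z : R) : 0 <= x -> x <= z -> z <= y -> Sg x - Dp y <= dp z <= Sg y - Dp x.
Proof.
move=> x0 xz zy; have z0 : 0 <= z by exact: le_trans xz.
by rewrite /dp !lerB ?Sg_nd ?Dp_nd.
Qed.

Let dp_le (x y : R) : 0 <= x -> x <= y -> dp x <= Sg y.
Proof.
move=> x0 xy; have /andP[_ h] := dp_between x0 (lexx x) xy.
by apply: le_trans h _; rewrite gerBl.
Qed.

Let mdp (l : R) : measurable_fun (`[0, l]%classic : set R) (dp : R -> R).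
Proof. by apply: measurable_funB; [exact: mSg|exact: mDp]. Qed.

Let mdelta (l : R) : measurable_fun (`[0, l]%classic : set R) (delta nu F : R -> R).
Proof.
apply: measurable_funB; first exact: mSg.
exact: measurable_funS (measurable_itv _) (@sub0 l) mF'.
Qed.

(** On [[0, l]] the factor [dp] is at most [Sg l], so integrability comes from that of [rr], which
    is finiteness of [Delta]. *)
Let int_dpM (v : R -> R) (l : R) : measurable_fun (`[0, l]%classic : set R) v ->
  (forall x, 0 <= x -> 0 <= v x <= 2 * rr x) -> mu.-integrable `[0, l] (EFin \o (fun x => dp x * v x)).
Proof.
move=> mv hv.
apply: (@le_integrable_real _ _ R mu _ _ (fun x => (2 * Sg l) * rr x)).
- exact: measurable_itv.
- by apply: measurable_funM mv; exact: mdp.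
- move=> x; rewrite /= in_itv/= => /andP[x0 xl]; have /andP[v0 v1] := hv x x0.
  rewrite ger0_norm ?mulr_ge0 ?dp_ge0// [2 * _]mulrC -mulrA.
  by apply: ler_pM => //; [exact: dp_ge0|exact: dp_le].
- by apply: integrableZ_real; [exact: measurable_itv|exact: int_rr].
Qed.

Let vp_rr (x : R) : 0 <= x -> 0 <= vp x <= 2 * rr x.
Proof. by move=> x0; rewrite vp_ge0//= /rr mulVKf// lerDl. Qed.
Let vm_rr (x : R) : 0 <= x -> 0 <= vm x <= 2 * rr x.
Proof. by move=> x0; rewrite vm_ge0//= /rr mulVKf// lerDr vp_ge0. Qed.
Let rr_rr (x : R) : 0 <= x -> 0 <= rr x <= 2 * rr x.
Proof. by move=> x0; rewrite rr_ge0//= mulr2n mulrDl mul1r lerDl rr_ge0. Qed.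

Let int_p (l : R) := int_dpM (@mvp l) vp_rr.
Let int_m (l : R) := int_dpM (@mvm l) vm_rr.
Let int_r (l : R) := int_dpM (@mrr l) rr_rr.

Let int_dp (l : R) : mu.-integrable `[0, l] (EFin \o dp).
Proof.
have [l0|l0] := leP 0 l; last by rewrite set_itv_ge ?bnd_simp -?ltNge//; exact: integrable_set0.
apply: (@le_integrable_real _ _ R mu _ _ (fun=> Sg l)).
- exact: measurable_itv.
- exact: mdp.
- by move=> x; rewrite /= in_itv/= => /andP[x0 xl]; rewrite ger0_norm ?dp_ge0 ?dp_le.
- apply: ge0_integrable_real.
  + exact: measurable_cst.
  + by move=> x _; exact: Sg_ge0.
  + rewrite integral_cst//= lebesgue_measure_itv/=; case: ifP => _; first by rewrite -EFinB -EFinM ltry.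
    by rewrite mule0 ltry.
Qed.

Let Rint_delta (v : R -> R) (l : R) : measurable_fun (`[0, l]%classic : set R) v ->
  Rintegral mu `[0, l] (fun m => delta nu F m * v m) = Rintegral mu `[0, l] (fun m => dp m * v m).
Proof.
move=> mv; have [C [_ nC] hC] := bad.
apply: (@Rintegral_ae_eq R _ (measurableTypeR R) mu _ C) => //.
- by apply: measurable_funM mv; exact: mdelta.
- by apply: measurable_funM mv; exact: mdp.
- by move=> x; rewrite /= in_itv/= => /andP[x0 _] nx; rewrite /delta hC.
Qed.

Local Notation Ap := (Aplus nu F phip).
Local Notation Am := (fun l => - Aminus nu F phim l).
Local Notation C := (Cfun nu F).

Let ApE (l : R) : Ap l = Sg 0 + Rintegral mu `[0, l] (fun m => dp m * vp m).
Proof. by rewrite /Aplus; congr (_ + _); exact: Rint_delta. Qed.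

Let AmE (l : R) : - Aminus nu F phim l = Sg 0 + Rintegral mu `[0, l] (fun m => dp m * vm m).
Proof. by rewrite /Aminus opprB opprK addrC; congr (_ + _); exact: Rint_delta. Qed.

Let CE (l : R) : C l = - F 0 + Rintegral mu `[0, l] dp.
Proof.
rewrite /Cfun; congr (_ + _).
have e (f : R -> R) : Rintegral mu `[0, l] f = Rintegral mu `[0, l] (fun m => f m * 1).
  by apply: eq_Rintegral => x _; rewrite mulr1.
by rewrite e [RHS]e; apply: (@Rint_delta (fun=> 1)); exact: measurable_cst.
Qed.

Let Rint_nd (f : R -> R) : (forall l, mu.-integrable `[0, l] (EFin \o f)) ->
  (forall x, 0 <= x -> 0 <= f x) -> forall x y : R, 0 <= x -> x <= y ->
  Rintegral mu `[0, x] f <= Rintegral mu `[0, y] f.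
Proof.
move=> If f0 x y x0 xy; rewrite -subr_ge0 (Rintegral_itv0B x0 xy (If y)).
apply: Rintegral_ge0 => z /=; rewrite in_itv/= => /andP[xz _].
by apply: f0; rewrite ltW// (le_lt_trans x0).
Qed.

Let Rint0 (f : R -> R) : Rintegral mu `[0, 0] f = 0.
Proof. by rewrite set_itv1 Rintegral_set1. Qed.

Let Ap_nd (x y : R) : 0 <= x -> x <= y -> Ap x <= Ap y.
Proof.
move=> x0 xy; rewrite !ApE lerD2l; apply: (Rint_nd int_p) => // z z0.
by rewrite mulr_ge0 ?dp_ge0 ?vp_ge0.
Qed.

Let Am_nd (x y : R) : 0 <= x -> x <= y -> - Aminus nu F phim x <= - Aminus nu F phim y.
Proof.
move=> x0 xy; rewrite !AmE lerD2l; apply: (Rint_nd int_m) => // z z0.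
by rewrite mulr_ge0 ?dp_ge0 ?vm_ge0.
Qed.

Let C_nd (x y : R) : 0 <= x -> x <= y -> C x <= C y.
Proof. by move=> x0 xy; rewrite !CE lerD2l; apply: (Rint_nd int_dp). Qed.

Let C_incr (x y : R) : 0 <= x -> x <= y -> C y - C x <= (Sg y - Dp x) * (y - x).
Proof.
move=> x0 xy; have -> : C y - C x = Rintegral mu `]x, y] dp.
  by rewrite !CE -(Rintegral_itv0B x0 xy (int_dp y)) opprD addrACA subrr add0r.
have := @Rintegral_lebesgue_between R dp x y (Sg x - Dp y) (Sg y - Dp x) xy (integrable_itvS x0 (int_dp y)).
case/(_ _)/andP => // z /andP[xz zy].
by apply: dp_between => //; exact: ltW.
Qed.

Let G (l : R) : R := Rintegral mu `[0, l] (fun m => dp m * rr m).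

Let G_incr (x y : R) : 0 <= x -> x <= y -> (Sg x - Dp y) * (Dl y - Dl x) <= G y - G x.
Proof.
move=> x0 xy; rewrite Dl_incr// (Rintegral_itv0B x0 xy (int_r y)).
have ir := integrable_itvS x0 (int_rr y).
rewrite -(RintegralZl_lebesgue _ ir).
apply: le_Rintegral => //.
- by apply: integrableZ_real ir; exact: measurable_itv.
- exact: integrable_itvS (int_r y).
- move=> z; rewrite /= in_itv/= => /andP[xz zy].
  have /andP[h _] := dp_between x0 (ltW xz) zy.
  by apply: ler_wpM2r h; apply: rr_ge0; rewrite ltW// (le_lt_trans x0).
Qed.

(** The halves in the definition of [Delta] make the mean of [A_+] and [- A_-] equal to [Sigma(0)]
    plus the integral of [delta] against [dDelta]. *)
Let half_sum (l : R) : 2^-1 * (Ap l + - Aminus nu F phim l) = Sg 0 + G l.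
Proof.
have -> : G l = 2^-1 * (Rintegral mu `[0, l] (fun m => dp m * vp m) +
    Rintegral mu `[0, l] (fun m => dp m * vm m)).
  rewrite -(RintegralD_lebesgue (int_p l) (int_m l)).
  rewrite -RintegralZl_lebesgue; last first.
    by apply: integrableD_real; [exact: measurable_itv|exact: int_p|exact: int_m].
  by apply: eq_Rintegral => x _ /=; rewrite /rr; ring.
by rewrite ApE AmE; move: (Sg 0) (Rintegral _ _ _) (Rintegral _ _ _) => a b c; field.
Qed.

(** Formally an equality, from [dSigma = delta dDelta]; the grid comparison yields the direction
    that the drift estimate requires. *)
Let Sg_le_half (l : R) : 0 <= l -> Sg l <= 2^-1 * (Ap l + - Aminus nu F phim l).
Proof.
move=> l0; rewrite half_sum.
have : Sg l - Sg 0 <= G l - G 0.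
  apply: (@le_of_grid_increments R Sg G (fun x => Sg x + Dp x) Dl l l0 _ Dl_cont).
    by move=> x y x0 xy; rewrite lerD ?Sg_nd ?Dp_nd.
  by move=> x y x0 xy; apply: ratio_increment_le; [exact: Sg_incr|exact: G_incr].
by rewrite {2}/G Rint0 subr0 lerBlDl.
Qed.

Let F_incr (x y : R) : 0 <= x -> x <= y -> F y - F x <= Dp y * (y - x).
Proof.
move=> x0 xy; have y0 : 0 <= y by exact: le_trans xy.
rewrite (halfline_extE F x0) (halfline_extE F y0).
exact: (slope_le_rderiv (halfline_ext_cvx cvxF ndF) xy).
Qed.

(** The interface to the probabilistic side. The linear bound on [C] near [0] serves to reach
    [l = 0] in the supremum defining [H], and [V] gathers the monotone functions whose increments
    bound the Riemann error. *)
Lemma dual_functions_properties :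
  [/\ (forall x y, 0 <= x -> x <= y -> Ap x <= Ap y) /\ 0 <= Ap 0,
      (forall x y, 0 <= x -> x <= y -> Am x <= Am y) /\ 0 <= Am 0,
      (forall x y, 0 <= x -> x <= y -> C x <= C y) /\ C 0 = - F 0,
      (exists c : R, forall l, 0 <= l <= 1 -> C l + F 0 <= c * l) &
      (exists2 V : R -> R, forall x y, 0 <= x -> x <= y -> V x <= V y &
        forall x y, 0 <= x -> x <= y -> (F y + C y) - (F x + C x) <=
          2^-1 * (Ap x + Am x) * (y - x) + (V y - V x) * (y - x))].
Proof.
have C0 : C 0 = - F 0 by rewrite CE Rint0 addr0.
split.
- by split=> //; rewrite ApE Rint0 addr0 Sg_ge0.
- by split=> //; rewrite AmE Rint0 addr0 Sg_ge0.
- by split.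
- exists (Sg 1 - Dp 0) => l /andP[l0 l1].
  have := C_incr (lexx 0) l0; rewrite C0 opprK subr0 => /le_trans; apply.
  by apply: ler_wpM2r => //; rewrite lerB// Sg_nd.
- exists (fun x => 2^-1 * (Ap x + Am x) + Dp x) => x y x0 xy.
    by rewrite lerD ?Dp_nd// ler_pM2l// lerD ?Ap_nd ?Am_nd.
  rewrite opprD addrACA; apply: drift_increment_le (F_incr x0 xy) (C_incr x0 xy).
    by rewrite subr_ge0.
  by apply: Sg_le_half; exact: le_trans xy.
Qed.

End analytic_facts.

Section dual_function.
Context {R : realType}.

Lemma measurable_sup_affine (a c : R -> R) (S : set R) :
  measurable_fun setT (fun x : R => ereal_sup [set (x * a l - c l)%:E | l in S]).
Proof.
apply: lower_semicontinuous_measurable => x r /ereal_sup_gt[_ [l Sl <-]]; rewrite lte_fin => h.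
exists [set y : R | r < y * a l - c l].
  have : {for x, continuous (fun y : R => y * a l - c l)}.
    by apply: cvgB; [apply: cvgMl; exact: cvg_id|exact: cvg_cst].
  by move/(@cvgr_gt _ _ _ _ _ _) => /(_ _ h).
move=> y /= hy; apply: (@lt_le_trans _ _ (y * a l - c l)%:E); first by rewrite lte_fin.
by apply: ereal_sup_ubound; exists l.
Qed.

Lemma measurable_Hfun (nu : {measure set R -> \bar R}) (F phip phim : R -> R) :
  measurable_fun setT (Hfun nu F phip phim).
Proof.
apply: measurable_fun_ifT; first exact: measurable_fun_ltr.
  exact: measurable_sup_affine.
apply: measurable_fun_ifT; first exact: measurable_fun_ltr.
  exact: measurable_sup_affine.
exact: measurable_cst.
Qed.

(* At [l = 0], which the supremum excludes, the bound is reached by letting [l] tend to [0+]. *)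
Lemma Hfun_ge (nu : {measure set R -> \bar R}) (F phip phim : R -> R) (cst l x : R) :
  (forall x y, 0 <= x -> x <= y -> Aplus nu F phip x <= Aplus nu F phip y) ->
  (forall x y, 0 <= x -> x <= y -> - Aminus nu F phim x <= - Aminus nu F phim y) ->
  (forall x y, 0 <= x -> x <= y -> Cfun nu F x <= Cfun nu F y) ->
  Cfun nu F 0 = - F 0 ->
  (forall l, 0 <= l <= 1 -> Cfun nu F l + F 0 <= cst * l) -> 0 <= l ->
  ((Num.max x 0 * Aplus nu F phip l + Num.max (- x) 0 * - Aminus nu F phim l -
    Cfun nu F l)%:E <= Hfun nu F phip phim x)%E.
Proof.
move=> ndp ndm ndC C0 hC l0.
have key (a : R -> R) (y : R) : 0 <= y -> (forall x y, 0 <= x -> x <= y -> a x <= a y) ->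
    ((y * a l - Cfun nu F l)%:E <= ereal_sup [set (y * a l - Cfun nu F l)%:E | l in (`]0%R, +oo[%classic : set R)])%E.
  move=> y0 nda; have [lp|ln] := ltP 0 l.
    by apply: ereal_sup_ubound; exists l => //=; rewrite in_itv/= lp.
  have -> : l = 0 by apply/eqP; rewrite eq_le l0 ln.
  apply/lee_addgt0Pr => e e0.
  pose k := Num.min 1 (e / (`|cst| + 1)).
  have c1 : 0 < `|cst| + 1 by rewrite ltr_wpDl.
  have k0 : 0 < k by rewrite /k lt_min ltr01 divr_gt0.
  have hk : Cfun nu F k + F 0 <= e.
    apply: (le_trans (hC k _)); first by rewrite (ltW k0) /k ge_min lexx.
    have h1 : k * (`|cst| + 1) <= e by rewrite -ler_pdivlMr// /k ge_min lexx orbT.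
    have h2 := ler_wpM2r (ltW k0) (ler_norm cst).
    by lra.
  have h3 := ler_wpM2l y0 (nda 0 k (lexx _) (ltW k0)).
  apply: (@le_trans _ _ ((y * a k - Cfun nu F k)%:E + e%:E)%E).
    by rewrite -EFinD lee_fin C0; lra.
  by apply: leeD => //; apply: ereal_sup_ubound; exists k => //=; rewrite in_itv/= k0.
rewrite /Hfun; have [x0|x0] := ltP 0 x.
  have -> : Num.max (- x) 0 = 0 by rewrite max_r// oppr_le0 ltW.
  by rewrite mul0r addr0; exact: (key (Aplus nu F phip) x (ltW x0)).
rewrite mul0r add0r; have [xn|xp] := ltP x 0.
  rewrite max_l ?oppr_ge0 ?(ltW xn)//.
  have nx : 0 <= - x by rewrite oppr_ge0 ltW.
  have := key (fun l => - Aminus nu F phim l) (- x) nx ndm.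
  have -> // : (fun l1 : R => (- x * - Aminus nu F phim l1 - Cfun nu F l1)%:E) =
      (fun l1 => (x * Aminus nu F phim l1 - Cfun nu F l1)%:E).
  by apply/funext => k; rewrite mulrNN.
have -> : x = 0 by apply/eqP; rewrite eq_le x0 xp.
rewrite oppr0 maxxx mul0r add0r lee_fin lerNl -C0; exact: ndC.
Qed.

End dual_function.

(** * Passing to the stopping time *)

Section probability_integrals.
Context {R : realType} {d : measure_display} {T : measurableType d}.
Variable P : probability T R.

Lemma integral_cst_prob (c : R) : (\int[P]_w c%:E = c%:E)%E.
Proof.
rewrite integral_cst//; transitivity (c%:E * 1)%E; last by rewrite mule1.
by congr (_ * _)%E; exact: probability_setT.
Qed.

(** For [c < 0] the sum [h] may change sign, so its integral is a difference. The negative part is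
    at most [- c], hence integrable, and the identity of [h^\+ - c] with [f + h^\-] allows [f] to
    have infinite integral. *)
Lemma ge0_integral_addr_prob (f : T -> \bar R) (c : R) :
  measurable_fun setT f -> (forall w, 0 <= f w)%E ->
  (\int[P]_w (f w + c%:E) = \int[P]_w f w + c%:E)%E.
Proof.
move=> mf f0; have [c0|c0] := leP 0 c.
  by rewrite ge0_integralD ?integral_cst_prob//.
pose h w := (f w + c%:E)%E.
have mh : measurable_fun setT h by apply: emeasurable_funD => //; exact: measurable_cst.
have e : (\int[P]_w h^\+ w + (- c)%:E = \int[P]_w f w + \int[P]_w h^\- w)%E.
  rewrite -(integral_cst_prob (- c)) -ge0_integralD//; last 2 first.
  - exact: measurable_funepos.
  - by move=> w _; rewrite lee_fin; lra.
  rewrite -ge0_integralD//; last exact: measurable_funeneg.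
  apply: eq_integral => w _; rewrite funeposE funenegE /h.
  move: (f0 w); case: (f w) => [r| |]// r0.
    rewrite -EFinD -EFinN -!EFin_max -!EFinD; congr EFin.
    by case: leP => ?; case: leP => ?; lra.
  by rewrite /= maxye// maxNye ?adde0//.
have n1 : (\int[P]_w h^\- w <= (- c)%:E)%E.
  rewrite -(integral_cst_prob (- c)); apply: ge0_le_integral => //.
  - exact: measurable_funeneg.
  - move=> w _; rewrite funenegE /h ge_max; apply/andP; split; last by rewrite lee_fin; lra.
    by rewrite EFinN leeN2 leeDr.
have n0 : (0 <= \int[P]_w h^\- w)%E by apply: integral_ge0.
rewrite [LHS](integralE _ _ h); move: e n0 n1.
case: (\int[P]_w h^\- w)%E => [r| |]//= + _ _.
case: (\int[P]_w h^\+ w)%E => [p| |]//=; case: (\int[P]_w f w)%E => [q| |]//=.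
by rewrite -!EFinD => -[e]; congr EFin; lra.
Qed.

(** [F 0] may be negative; subtracting this common lower bound brings the comparison to nonnegative
    functions without assuming integrability. *)
Lemma le_integral_shift (f g : T -> \bar R) (c : R) :
  measurable_fun setT f -> measurable_fun setT g ->
  (forall w, c%:E <= f w)%E -> (forall w, c%:E <= g w)%E ->
  (\int[P]_w (f w - c%:E) <= \int[P]_w (g w - c%:E))%E -> (\int[P]_w f w <= \int[P]_w g w)%E.
Proof.
move=> mf mg fc gc h.
have e (k : T -> \bar R) : measurable_fun setT k -> (forall w, c%:E <= k w)%E ->
    (\int[P]_w k w = \int[P]_w (k w - c%:E) + c%:E)%E.
  move=> mk kc; rewrite -ge0_integral_addr_prob.
  - by apply: eq_integral => w _; rewrite subeK.
  - by apply: emeasurable_funB => //; exact: measurable_cst.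
  - by move=> w; rewrite sube_ge0// orbT.
by rewrite (e f)// (e g)//; apply: leeD.
Qed.

End probability_integrals.

(** * Finiteness of the stopping time and vanishing tails *)

Section uniformly_integrable_stopping.
Context {R : realType} {d : measure_display} {T : measurableType d}.
Variables (P : probability T R) (Filt : R -> set (set T)) (B : R -> T -> R) (tau : T -> \bar R).
Hypothesis hB : brownian_motion P Filt B.
Hypothesis hT : stopping_time Filt tau.
Let tau0 w : (0 <= tau w)%E. Proof. exact: hT.1. Qed.

Lemma eventually_le_nat (x : R) : exists N : nat, forall n, (N <= n)%N -> x <= n%:R.
Proof.
exists (Num.truncn x).+1 => n Nn; apply: (@le_trans _ _ (Num.truncn x).+1%:R).
  by rewrite ltW// truncnS_gt.
by rewrite ler_nat.
Qed.

Lemma stopped_eventually (Y : R -> T -> R) w : (tau w < +oo)%E -> exists N : nat, forall n, (N <= n)%N ->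
  (tau w <= n%:R%:E)%E /\ stopped Y tau n%:R w = Y (fine (tau w)) w.
Proof.
move=> tw; have ft : tau w \is a fin_num by rewrite ge0_fin_numE.
have [N hN] := eventually_le_nat (fine (tau w)).
exists N => n Nn; have h : (tau w <= n%:R%:E)%E by rewrite -(fineK ft) lee_fin hN.
by split => //; rewrite /stopped -/(clip _ _) clip_fine.
Qed.

(** The approximations are set to [0] while [tau] is not yet reached. Where [tau] is infinite this
    is the right limit, because [fine +oo] is [0] and [Y] starts at [0]. *)
Lemma measurable_at_stopping (Y : R -> T -> R) : (forall w, Y 0 w = 0) ->
  (forall t, 0 <= t -> measurable_fun setT (stopped Y tau t)) ->
  measurable_fun setT (fun w => Y (fine (tau w)) w).
Proof.
move=> Y0 mY.
pose h (n : nat) w : R := if (n%:R%:E < tau w)%E then 0 else stopped Y tau n%:R w.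
apply: (@measurable_fun_cvg _ _ R setT h).
  move=> n; apply: measurable_fun_ifT => //; first exact: (measurable_tau_gt hB hT).
  exact: mY.
move=> w _; apply: cvg_near_cst.
have [tw|tw] := ltP (tau w) +oo%E.
  have [N hN] := stopped_eventually Y tw; exists N => // n /= Nn.
  by have [h1 h2] := hN n Nn; rewrite /h ltNge h1.
have e : tau w = +oo%E by apply/eqP; rewrite eq_le tw leey.
by exists 0%N => // n _; rewrite /h e ltry /= Y0.
Qed.

Hypothesis aX : adapted Filt (stopped B tau).
Hypothesis hU : uniformly_integrable P (stopped B tau).
Local Notation X := (stopped B tau).
Let hF : filtration Filt. Proof. by case: hB. Qed.

Let mX (t : R) : 0 <= t -> measurable_fun setT (X t).
Proof. exact: (adapted_measurable hF aX). Qed.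

Let mnX (t : R) D : 0 <= t -> measurable_fun D (fun w => `|X t w|%:E).
Proof.
move=> t0; apply: measurable_funTS; apply/measurable_EFinP.
by apply: measurableT_comp => //; exact: mX.
Qed.

Let mgt (t K : R) : 0 <= t -> measurable [set w | K < `|X t w|].
Proof.
move=> t0; rewrite -[X in measurable X]setTI.
have m : measurable_fun setT (fun w => K < `|X t w|).
  by apply: measurable_fun_ltr => //; apply: measurableT_comp => //; exact: mX.
exact: (m measurableT [set true]).
Qed.

Let mtau (t : R) : 0 <= t -> measurable [set w | (t%:E < tau w)%E].
Proof. by move=> t0; exact: (filt_measurable hF t0 (filt_tau_gt hB hT t0)). Qed.

Let small_ball (t K : R) : 0 < t -> 0 <= K ->
  (P [set w | (`|B t w| <= K)%R] <= (K / Num.sqrt t)%:E)%E.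
Proof.
move=> t0 K0; have [_ _ B0 _ hN] := hB.
have := hN 0 t (lexx 0) t0 setT (filt_setT hF (lexx 0)) `[- K, K]%classic (measurable_itv _).
rewrite subr0 setTI.
have -> : [set w | `[- K, K]%classic (B t w - B 0 w)] = [set w | `|B t w| <= K].
  by apply/seteqP; split=> w /=; rewrite in_itv/= B0 subr0 ler_norml.
move=> ->; apply: (@le_trans _ _ (1 * normal_prob 0%R (Num.sqrt t) `[(- K)%R, K]%classic)%E).
  by apply: lee_wpmul2r => //; exact: probability_le1.
by rewrite mul1e; apply: normal_prob_itv => //; rewrite sqrtr_gt0.
Qed.

(** On the event [m < tau] the stopped value is [B m]. It is at most [K] in size with probability at
    most [K / Num.sqrt m], and above [K] with probability at most [1 / K], by uniform integrability
    and Markov's inequality. *)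
Lemma probability_tau_gt_small (e : R) : 0 < e -> exists N : nat, forall m, (N <= m)%N ->
  (P [set w | (m%:R%:E < tau w)%E] <= e%:E)%E.
Proof.
move=> e0; have [K1 hK1] := hU ltr01.
(* [2 / e] makes [1 / K] at most [e / 2]; then [m >= (2 * K / e) ^+ 2] does the same for
   [K / Num.sqrt m]. *)
pose K := Num.max K1 (2 / e).
have K0 : 0 < K by rewrite /K lt_max divr_gt0// orbT.
have K1K : K1 <= K by rewrite /K le_max lexx.
have hK : K^-1 <= e / 2.
  by rewrite -[e / 2]invrK invf_div lef_pV2 ?posrE ?divr_gt0// /K le_max lexx orbT.
have [N hN] := eventually_le_nat (Num.max 1 ((2 * K / e) ^+ 2)).
exists N => m Nm; have := hN m Nm; rewrite ge_max => /andP[m1 m2].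
have m0 : 0 < m%:R :> R by exact: lt_le_trans m1.
have s0 : 0 < Num.sqrt m%:R :> R by rewrite sqrtr_gt0.
have hs : K / Num.sqrt m%:R <= e / 2.
  have h : 2 * K / e <= Num.sqrt m%:R.
    rewrite -(@ler_pXn2r _ 2)// ?nnegrE ?divr_ge0 ?mulr_ge0 ?(ltW e0) ?(ltW K0) ?(ltW s0)//.
    by rewrite sqr_sqrtr// ltW.
  by rewrite ler_pdivrMr//; move: h; rewrite ler_pdivrMr//; lra.
have hX : (P [set w | (K < `|X m%:R w|)%R] <= (e / 2)%:E)%E.
  have h1 : (K%:E * P [set w | (K < `|X m%:R w|)%R] <= 1%:E)%E.
    rewrite -integral_cst//; last exact: (mgt _ (ltW m0)).
    apply: le_trans (hK1 _ (ltW m0)).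
    apply: (@le_trans _ _ (\int[P]_(w in [set w | (K < `|X m%:R w|)%R]) `|X m%:R w|%:E)%E).
      apply: ge0_le_integral => //.
      - exact: (mgt _ (ltW m0)).
      - by move=> w _; rewrite lee_fin ltW.
      - exact: mnX (ltW m0).
      - by move=> w /= h; rewrite lee_fin ltW.
    apply: ge0_subset_integral => //.
    - exact: (mgt _ (ltW m0)).
    - exact: (mgt _ (ltW m0)).
    - exact: mnX (ltW m0).
    - by move=> w /=; exact: le_lt_trans.
  apply: le_trans (_ : (K^-1)%:E <= _)%E; last by rewrite lee_fin.
  have Ki : (0 <= (K^-1)%:E)%E by rewrite lee_fin invr_ge0 ltW.
  have := lee_wpmul2l Ki h1.
  by rewrite muleA -EFinM mulVf ?gt_eqF// mul1e mule1.
have mB : measurable [set w | (`|B m%:R w| <= K)%R].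
  rewrite -[X in measurable X]setTI.
  have mm : measurable_fun setT (fun w => `|B m%:R w| <= K).
    by apply: measurable_fun_ler => //; apply: measurableT_comp => //; exact: (bm_measurable hB (ltW m0)).
  exact: (mm measurableT [set true]).
apply: (@le_trans _ _ (P ([set w | (`|B m%:R w| <= K)%R] `|` [set w | (K < `|X m%:R w|)%R]))).
  apply: le_measure_sub => //.
  - exact: (mtau (ltW m0)).
  - by apply: measurableU => //; exact: (mgt _ (ltW m0)).
  - move=> w /= h; rewrite /stopped -/(clip _ _) clip_lt//.
    by case: leP; [left|right].
apply: (le_trans (measureU2 _ _ _)) => //; first exact: (mgt _ (ltW m0)).
rewrite (splitr e) EFinD; apply: leeD => //.
by apply: le_trans (small_ball m0 (ltW K0)) _; rewrite lee_fin.
Qed.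

(** Values above [K] are controlled by uniform integrability, the others by [K] times the
    probability that [tau] exceeds [m]. It bounds the error of replacing [X m] by [B] at [tau]. *)
Lemma stopped_tail_small (e : R) : 0 < e -> exists N : nat, forall m, (N <= m)%N ->
  (\int[P]_(w in [set w | (m%:R%:E < tau w)%E]) `|X m%:R w|%:E <= e%:E)%E.
Proof.
move=> e0; have e20 : 0 < e / 2 by rewrite divr_gt0.
have [K1 hK1] := hU e20; pose K := Num.max K1 1.
have K0 : 0 < K by rewrite /K lt_max ltr01 orbT.
have K1K : K1 <= K by rewrite /K le_max lexx.
have [N hN] := probability_tau_gt_small (divr_gt0 e20 K0).
exists N => m Nm; have m0 : 0 <= m%:R :> R by [].
set E := [set w | (m%:R%:E < tau w)%E].
have mE : measurable E by exact: mtau.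
rewrite (@ge0_integral_splitI _ _ _ P E [set w | (K < `|X m%:R w|)%R])//; last 2 first.
- exact: mgt.
- exact: mnX.
rewrite (splitr e) EFinD; apply: leeD.
  apply: le_trans (hK1 _ m0); apply: ge0_subset_integral => //.
  - by apply: measurableI => //; exact: mgt.
  - exact: mgt.
  - exact: mnX.
  - by move=> w [_] /=; exact: le_lt_trans.
apply: (@le_trans _ _ (\int[P]_(w in E `&` ~` [set w | (K < `|X m%:R w|)%R]) K%:E)%E).
  apply: ge0_le_integral => //.
  - by apply: measurableI => //; apply: measurableC; exact: mgt.
  - exact: mnX.
  - by move=> w [_] /= /negP; rewrite -leNgt lee_fin.
rewrite integral_cst//; last by apply: measurableI => //; apply: measurableC; exact: mgt.
apply: (@le_trans _ _ (K%:E * P E)%E).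
  apply: lee_wpmul2l; first by rewrite lee_fin ltW.
  apply: le_measure_sub => //.
  by apply: measurableI => //; apply: measurableC; exact: mgt.
apply: (@le_trans _ _ (K%:E * (e / 2 / K)%:E)%E).
  by apply: lee_wpmul2l; [rewrite lee_fin ltW|exact: hN].
by rewrite -EFinM lee_fin mulrC mulfVK// gt_eqF.
Qed.

End uniformly_integrable_stopping.

(** * Truncation of the local time and the final limits *)

Section expected_value_bound.
Context {R : realType} {d : measure_display} {T : measurableType d}.
Variables (P : probability T R) (Filt : R -> set (set T)) (B L : R -> T -> R).
Variable tau : T -> \bar R.
Hypothesis hB : brownian_motion P Filt B.
Hypothesis hL : local_time_at0 P Filt B L.
Hypothesis hT : stopping_time Filt tau.
Hypothesis aX : adapted Filt (stopped B tau).
Hypothesis hU : uniformly_integrable P (stopped B tau).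
Variables (F Ap Am C V : R -> R) (H : R -> \bar R).
Hypothesis ndF : forall x y, 0 <= x -> x <= y -> F x <= F y.
Hypotheses (ndp : forall x y, 0 <= x -> x <= y -> Ap x <= Ap y) (Ap0 : 0 <= Ap 0).
Hypotheses (ndm : forall x y, 0 <= x -> x <= y -> Am x <= Am y) (Am0 : 0 <= Am 0).
Hypotheses (ndC : forall x y, 0 <= x -> x <= y -> C x <= C y) (C0 : C 0 = - F 0).
Hypothesis ndV : forall x y, 0 <= x -> x <= y -> V x <= V y.
Hypothesis drift : forall x y, 0 <= x -> x <= y ->
  (F y + C y) - (F x + C x) <= 2^-1 * (Ap x + Am x) * (y - x) + (V y - V x) * (y - x).
Hypothesis mH : measurable_fun setT H.
Hypothesis H_ge : forall l x, 0 <= l ->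
  ((Num.max x 0 * Ap l + Num.max (- x) 0 * Am l - C l)%:E <= H x)%E.
Local Notation X := (stopped B tau).
Local Notation l := (stopped L tau).

Let hF : filtration Filt. Proof. by case: hB. Qed.
Let tau0 w : (0 <= tau w)%E. Proof. exact: hT.1. Qed.

Let H_ge_F0 x : ((F 0)%:E <= H x)%E.
Proof.
apply: le_trans (H_ge x (lexx 0)); rewrite lee_fin C0 opprK lerDr.
by rewrite addr_ge0// mulr_ge0// le_max lexx orbT.
Qed.

(** The upper cut bounds the weights by [Ap n] and [Am n] and makes [C] integrable; the lower cut
    extends functions monotone on the half-line to monotone functions on the line. *)
Let trunc (n x : R) : R := Num.min (Num.max x 0) n.

Let trunc_ge0 n x : 0 <= n -> 0 <= trunc n x.
Proof. by move=> n0; rewrite /trunc le_min n0 le_max lexx orbT. Qed.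

Let trunc_le n x : trunc n x <= n.
Proof. by rewrite /trunc ge_min lexx orbT. Qed.

Let trunc_nd n : {homo trunc n : x y / x <= y}.
Proof. by move=> x y xy; rewrite /trunc le_min !ge_min lexx orbT andbT ge_max !le_max xy lexx !orbT. Qed.

Let trunc_lip n x y : 0 <= x -> x <= y -> trunc n y - trunc n x <= y - x.
Proof.
move=> x0 xy; rewrite /trunc (max_l x0) (max_l (le_trans x0 xy)).
by have [?|?] := leP x n; have [?|?] := leP y n; lra.
Qed.

Let trunc_id n x : 0 <= x -> x <= n -> trunc n x = x.
Proof. by move=> x0 xn; rewrite /trunc max_l// min_l. Qed.

Let nd_trunc (g : R -> R) (n : R) : 0 <= n -> (forall x y, 0 <= x -> x <= y -> g x <= g y) ->
  {homo (fun x => g (trunc n x)) : x y / x <= y}.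
Proof. by move=> n0 ndg x y xy; apply: ndg; [exact: trunc_ge0|exact: trunc_nd]. Qed.

Let ml (t : R) : 0 <= t -> measurable_fun setT (l t).
Proof. exact: (measurable_stopped_local_time hB hL hT). Qed.

Let mX (t : R) : 0 <= t -> measurable_fun setT (X t).
Proof. exact: (adapted_measurable hF aX). Qed.

Let mg (g : R -> R) (n : R) : 0 <= n -> (forall x y, 0 <= x -> x <= y -> g x <= g y) ->
  measurable_fun setT (fun w => g (trunc n (l n w))).
Proof.
move=> n0 ndg; apply: (@measurableT_comp _ _ _ _ _ _ (fun x => g (trunc n x))); last exact: ml.
by apply: nondecreasing_measurable => //; exact: nd_trunc.
Qed.

Let mBtau : measurable_fun setT (fun w => B (fine (tau w)) w).
Proof. by apply: (measurable_at_stopping hB hT) => //; case: hB. Qed.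

Let mLtau : measurable_fun setT (fun w => L (fine (tau w)) w).
Proof. by apply: (measurable_at_stopping hB hT) => //; case: hL. Qed.

Let HB w := (H (B (fine (tau w)) w) - (F 0)%:E)%E.

Let HB_ge0 w : (0 <= HB w)%E.
Proof. by rewrite sube_ge0// orbT. Qed.

Let mHB : measurable_fun setT HB.
Proof.
apply: emeasurable_funB; last exact: measurable_cst.
exact: (measurableT_comp mH mBtau).
Qed.

Let C_ge (x : R) : 0 <= x -> 0 <= C x + F 0.
Proof. by move=> x0; have := ndC (lexx 0) x0; rewrite C0; lra. Qed.

Let F_ge (x : R) : 0 <= x -> 0 <= F x - F 0.
Proof. by move=> x0; rewrite subr_ge0 ndF. Qed.

Let truncated_bound (n m : R) : 0 < n -> n < m ->
  (\int[P]_w ((F (trunc n (l n w)) - F 0) + (C (trunc n (l n w)) + F 0))%:E <=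
   \int[P]_w (Ap (trunc n (l n w)) * Num.max (1 * X m w) 0 +
              Am (trunc n (l n w)) * Num.max (- 1 * X m w) 0)%:E)%E.
Proof.
move=> n0 nm; have n0' := ltW n0.
pose Psi x := (F (trunc n x) - F 0) + (C (trunc n x) + F 0).
apply: (@riemann_bound _ _ _ P Filt B L tau hB hL hT aX (fun x => Ap (trunc n x))
  (fun x => Am (trunc n x)) Psi (fun x => V (trunc n x))) => //.
- exact: nd_trunc.
- by move=> x; apply: le_trans (ndp _ (trunc_ge0 _ _)).
- exact: nd_trunc.
- by move=> x; apply: le_trans (ndm _ (trunc_ge0 _ _)).
- exact: nd_trunc.
- apply: nondecreasing_measurable => // x y xy; rewrite /Psi lerD// ?lerD2r ?lerD2l.
    exact: (nd_trunc n0' ndF).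
  exact: (nd_trunc n0' ndC).
- by rewrite /Psi trunc_id// C0 subrr addNr addr0.
- by move=> x; rewrite addr_ge0// ?F_ge ?C_ge ?trunc_ge0.
- move=> x y x0 xy; have t0 := trunc_ge0 x n0'; have txy := trunc_nd n xy.
  have h1 := drift t0 txy; have h2 := trunc_lip n x0 xy.
  (* The drift inequality holds at the truncated points; as its slope is nonnegative and [trunc n]
     does not expand increments, [y - x] may replace the truncated increment. *)
  apply: (@le_trans _ _ ((2^-1 * (Ap (trunc n x) + Am (trunc n x)) +
      (V (trunc n y) - V (trunc n x))) * (trunc n y - trunc n x))).
    by rewrite /Psi mulrDl; lra.
  rewrite -mulrDl; apply: ler_wpM2l => //.
  have a1 := ndp (lexx 0) t0; have a2 := ndm (lexx 0) t0; have a3 := ndV t0 txy.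
  apply: addr_ge0; last by rewrite subr_ge0.
  by rewrite mulr_ge0// addr_ge0//; [exact: le_trans a1|exact: le_trans a2].
Qed.

(** If [tau <= m], then [X m] is already [B] at [tau] and the lower bound on [H] applies. Otherwise
    the nonnegative terms [HB] and [C + F 0] are discarded and the weights are bounded by their
    values at [n]. *)
Let pointwise_bound (n m : R) (w : T) : 0 < n ->
  ((Ap (trunc n (l n w)) * Num.max (1 * X m w) 0 +
    Am (trunc n (l n w)) * Num.max (- 1 * X m w) 0)%:E <=
   HB w + ((C (trunc n (l n w)) + F 0)%:E +
     (if (m%:E < tau w)%E then (Ap n + Am n) * `|X m w| else 0)%:E))%E.
Proof.
move=> n0; set k := trunc n (l n w).
have k0 : 0 <= k by exact/trunc_ge0/ltW.
have kn : k <= n by exact: trunc_le.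
rewrite mul1r mulN1r.
case: ifPn => [mt|]; last first.
  rewrite -leNgt => tm; rewrite adde0.
  have -> : X m w = B (fine (tau w)) w by rewrite /stopped -/(clip _ _) clip_fine.
  rewrite /HB; have := H_ge (B (fine (tau w)) w) k0.
  case: (H _) => [h| |]//; last by move=> _ /=; exact: leey.
  by rewrite -EFinB -EFinD !lee_fin => h1; lra.
rewrite -[leLHS]add0e; apply: leeD => //; rewrite -[leLHS]add0e; apply: leeD.
  by rewrite lee_fin C_ge.
rewrite lee_fin mulrDl; apply: lerD; apply: ler_pM => //.
- exact: le_trans (ndp _ k0).
- by rewrite le_max lexx orbT.
- exact: ndp.
- by rewrite ge_max ler_norm normr_ge0.
- exact: le_trans (ndm _ k0).
- by rewrite le_max lexx orbT.
- exact: ndm.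
- by rewrite ge_max -normrN ler_norm normr_ge0.
Qed.

(** The expectation of the truncated [C] stands on both sides and is finite, so it cancels; what
    remains of the late event vanishes as [m] grows. *)
Let step_bound (n : R) : 0 < n ->
  (\int[P]_w (F (trunc n (l n w)) - F 0)%:E <= \int[P]_w HB w)%E.
Proof.
move=> n0; have n0' := ltW n0; apply/lee_addgt0Pr => e e0.
(* The added [1] makes [M] positive, so that [e / M] is a legitimate tail level. *)
pose M := Ap n + Am n + 1.
have ap : 0 <= Ap n by exact: le_trans (ndp (lexx 0) n0').
have am : 0 <= Am n by exact: le_trans (ndm (lexx 0) n0').
have M0 : 0 < M by rewrite /M; lra.
have [N1 hN1] := stopped_tail_small hB hT aX hU (divr_gt0 e0 M0).
have [N2 hN2] := eventually_le_nat (n + 1).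
pose m := maxn N1 N2.
have nm : n < m%:R by have := hN2 m (leq_maxr _ _); lra.
have m0 : 0 <= m%:R :> R by [].
set E := [set w | (m%:R%:E < tau w)%E].
have tail := hN1 m (leq_maxl _ _).
have mE : measurable E by exact: (filt_measurable hF m0 (filt_tau_gt hB hT m0)).
pose Cw w : R := C (trunc n (l n w)) + F 0.
pose err w : R := if (m%:R%:E < tau w)%E then (Ap n + Am n) * `|X m%:R w| else 0.
have mF' : measurable_fun setT (fun w => (F (trunc n (l n w)) - F 0)%:E).
  apply/measurable_EFinP; apply: measurable_funB; last exact: measurable_cst.
  exact: mg.
have mC' : measurable_fun setT (fun w => (Cw w)%:E).
  apply/measurable_EFinP; apply: measurable_funD; last exact: measurable_cst.
  exact: mg.
have mnX : measurable_fun setT (fun w => `|X m%:R w|) by apply: measurableT_comp => //; exact: mX.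
have merr : measurable_fun setT (fun w => (err w)%:E).
  apply/measurable_EFinP; apply: measurable_fun_ifT => //.
    exact: (measurable_tau_gt hB hT).
  by apply: measurable_funM => //; exact: measurable_cst.
have Cw0 w : (0 <= (Cw w)%:E)%E by rewrite lee_fin C_ge// trunc_ge0.
have err0 w : (0 <= (err w)%:E)%E.
  by rewrite lee_fin /err; case: ifP => // _; rewrite mulr_ge0// addr_ge0.
have errE : (\int[P]_w (err w)%:E <= e%:E)%E.
  apply: (@le_trans _ _ (\int[P]_(w in E) ((Ap n + Am n)%:E * `|X m%:R w|%:E))%E).
    rewrite [leRHS]integral_mkcond le_eqVlt; apply/orP; left; apply/eqP.
    apply: eq_integral => w _; rewrite patchE /err -EFinM.
    by case: ifPn => h; [rewrite mem_set|rewrite memNset//; exact/negP].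
  rewrite ge0_integralZl//; last 2 first.
  - by apply: measurable_funTS; exact/measurable_EFinP.
  - by rewrite lee_fin addr_ge0.
  apply: (@le_trans _ _ (M%:E * (e / M)%:E)%E); last first.
    by rewrite -EFinM lee_fin mulrC mulfVK// gt_eqF.
  apply: lee_pmul => //; first by rewrite lee_fin addr_ge0.
  - by apply: integral_ge0.
  - by rewrite lee_fin /M; lra.
have CwF : (\int[P]_w (Cw w)%:E)%E \is a fin_num.
  rewrite ge0_fin_numE; last by apply: integral_ge0 => w _; exact: Cw0.
  apply: (@le_lt_trans _ _ (\int[P]_w (C n + F 0)%:E)%E); last by rewrite integral_cst_prob ltry.
  apply: ge0_le_integral => // w _; rewrite lee_fin lerD2r; apply: ndC => //.
  exact: trunc_ge0.
rewrite -(@leeD2rE _ (\int[P]_w (Cw w)%:E)%E)//.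
rewrite -ge0_integralD//; last by move=> w _; rewrite lee_fin F_ge// trunc_ge0.
apply: (le_trans (truncated_bound n0 nm)).
apply: (@le_trans _ _ (\int[P]_w (HB w + ((Cw w)%:E + (err w)%:E)))%E).
  apply: ge0_le_integral => //.
  - move=> w _; rewrite lee_fin addr_ge0// mulr_ge0// ?le_max ?lexx ?orbT//.
      by apply: le_trans (ndp _ (trunc_ge0 _ _)).
    by apply: le_trans (ndm _ (trunc_ge0 _ _)).
  - apply/measurable_EFinP; apply: measurable_funD; apply: measurable_funM; try exact: mg.
      by apply: measurable_maxr => //; apply: measurable_funM => //; exact: mX.
    by apply: measurable_maxr => //; apply: measurable_funM => //; exact: mX.
  - by apply: emeasurable_funD => //; exact: emeasurable_funD.
  - by move=> w _; exact: pointwise_bound.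
rewrite ge0_integralD//; last 2 first.
- by move=> w _; exact: adde_ge0.
- exact: emeasurable_funD.
have key (a b c r : \bar R) : (c <= r)%E -> (a + (b + c) <= a + r + b)%E.
  by move=> h; rewrite addeA [leRHS]addeAC; exact: leeD2l.
by rewrite ge0_integralD//; exact: key.
Qed.

Lemma expected_local_time_le :
  (\int[P]_w (F (L (fine (tau w)) w))%:E <= \int[P]_w H (B (fine (tau w)) w))%E.
Proof.
have [_ L0 _ _ _] := hL.
have Lt0 w : 0 <= L (fine (tau w)) w.
  by rewrite -(L0 w); apply: (local_time_mono hL) => //; exact: fine_ge0.
have mFL : measurable_fun setT (fun w => F (L (fine (tau w)) w)).
  have -> : (fun w => F (L (fine (tau w)) w)) = (fun w => halfline_ext F (L (fine (tau w)) w)).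
    by apply/funext => w; rewrite -halfline_extE.
  apply: (measurableT_comp _ mLtau); apply: nondecreasing_measurable => // x y xy.
  by apply: ndF; [rewrite le_max lexx orbT|rewrite ge_max !le_max xy lexx !orbT].
apply: (@le_integral_shift _ _ _ P _ _ (F 0)).
- exact/measurable_EFinP.
- exact: (measurableT_comp mH mBtau).
- by move=> w; rewrite lee_fin ndF.
- by move=> w; exact: H_ge_F0.
(* The same [n.+1] is truncation level and stopping horizon; the successor keeps it positive, as
   [step_bound] requires. *)
apply: (@fatou_le R _ T P setT (fun n w => (F (trunc n.+1%:R (l n.+1%:R w)) - F 0)%:E)) => //.
- move=> n; apply/measurable_EFinP; apply: measurable_funB; last exact: measurable_cst.
  exact: mg.
- by move=> n w; rewrite lee_fin F_ge// trunc_ge0.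
- by apply: emeasurable_funB; [exact/measurable_EFinP|exact: measurable_cst].
- by move=> w _; rewrite -EFinB lee_fin F_ge.
- apply: aeW => w _; rewrite -EFinB.
  have [tw|tw] := ltP (tau w) +oo%E; last first.
    (* For infinite [tau] the local time is read at [fine +oo], which is [0], so the shifted
       integrand is [0] and the lower limit is nonnegative. *)
    have -> : tau w = +oo%E by apply/eqP; rewrite eq_le tw leey.
    rewrite /= L0 subrr; apply: limn_einf_ge0 => n.
    by rewrite lee_fin F_ge// trunc_ge0.
  have [N1 h1] := stopped_eventually hT L tw.
  have [N2 h2] := eventually_le_nat (L (fine (tau w)) w).
  apply: limn_einf_ge => e e0; exists (maxn N1 N2) => n; rewrite geq_max => /andP[n1 n2].
  have [_ ->] := h1 n.+1 (leqW n1).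
  by rewrite trunc_id ?h2 ?(leqW n2)// leeDl// lee_fin ltW.
- apply: limn_einf_le => e e0 N; exists N => //.
  apply: (le_trans (step_bound (ltr0Sn _ N))).
  by rewrite leeDl// lee_fin ltW.
Qed.

End expected_value_bound.

Theorem theorem2p6 (R : realType) (d : measure_display) (T : measurableType d)
  (P : probability T R) (Filt : R -> set (set T)) (B L : R -> T -> R)
  (phip phim F : R -> R) (nu : {measure set R -> \bar R}) (tau : T -> \bar R) :
  brownian_motion P Filt B ->
  local_time_at0 P Filt B L ->
  {in `[0, +oo[, forall m, 0 <= phip m} ->
  {in `[0, +oo[ &, {homo phip : x y / x <= y}} ->
  {in `[0, +oo[, forall m, phim m <= 0} ->
  {in `[0, +oo[ &, {homo phim : x y / x <= y >-> y <= x}} ->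
  convex_function (`[0, +oo[%classic : set R) F ->
  {in `[0, +oo[ &, {homo F : x y / x <= y}} ->
  (forall l, 0 < l -> (DeltaE phip phim l < +oo)%E) ->
  Delta phip phim x @[x --> +oo] --> +oo ->
  nu [set x | x < 0] = 0%E ->
  (forall l, 0 <= l -> nu `[l, +oo[%classic = (expR (- Delta phip phim l))%:E) ->
  nu.-integrable `[0, +oo[%classic (EFin \o (F^`())%classic) ->
  stopping_time Filt tau ->
  martingale P Filt (stopped B tau) ->
  uniformly_integrable P (stopped B tau) ->
  (\int[P]_w (F (L (fine (tau w)) w))%:E
     <= \int[P]_w Hfun nu F phip phim (B (fine (tau w)) w))%E.
Proof.
move=> hB hL phip0 ndp phim0 nim cvxF ndF Dfin _ _ nuE nuF hT [aX _ _] hU.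
have [[ndA A0] [ndM M0] [ndC C0] [cst hC] [V ndV hV]] :=
  dual_functions_properties phip0 ndp phim0 nim cvxF ndF Dfin nuE nuF.
apply: (expected_local_time_le hB hL hT aX hU _ ndA A0 ndM M0 ndC C0 ndV hV) => //.
- by move=> x y x0 xy; apply: ndF => //; rewrite in_itv/= ?x0// (le_trans x0).
- exact: measurable_Hfun.
- by move=> l x l0; exact: Hfun_ge ndA ndM ndC C0 hC l0.
Qed.
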